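(* Let $E$ and $F$ be real Banach lattices such that $E^*$ and $F^*$ are lattice isomorphic and at least one of $E^*$, $F^*$ has order continuous norm. Then for every $n\in\mathbb{N}$ and every Banach lattice $G$, $\mathcal{P}^r_o(^nE;G^* )$ and $\mathcal{P}^r_o(^nF;G^* )$ are lattice isomorphic.
   Context: For Banach lattices $E,H$ with $H$ Dedekind complete, $\mathcal{P}^r(^nE;H)$ is the Banach lattice of regular $n$-homogeneous polynomials (differences of positive ones, where $P$ is positive if its symmetric $n$-linear map $T_P$ is positive) with the regular norm $\|P\|_r=\||P|\|$. A regular polynomial $P$ is orthogonally additive if $P(x+y)=P(x)+P(y)$ whenever $|x|\wedge|y|=0$ (equivalently, $T_P$ vanishes whenever two of its arguments are disjoint). $\mathcal{P}^r_o(^nE;H)$ denotes the Banach lattice of all $P\in\mathcal{P}^r(^nE;H)$ such that $|P|$ is orthogonally additive. *)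

(* Defs.v *)
From HB Require Import structures.
From mathcomp Require Import all_boot all_order all_algebra all_fingroup.
From mathcomp Require Import all_classical all_reals all_analysis.
Set Implicit Arguments. Unset Strict Implicit. Unset Printing Implicit Defensive.
Import Order.TTheory GRing.Theory Num.Theory numFieldNormedType.Exports.
Local Open Scope classical_set_scope.
Local Open Scope ring_scope.

Section BanachLattice.
Variables (R : realType) (E : normedModType R) (join : E -> E -> E).

Definition bl_le (x y : E) : Prop := join x y = y.
Definition bl_abs (x : E) : E := join x (- x).
Definition bl_meet (x y : E) : E := - join (- x) (- y).
Definition bl_disjoint (x y : E) : Prop := bl_meet (bl_abs x) (bl_abs y) = 0.

(* E (a complete normed space) with [join] is a Banach lattice:
   [join] is the supremum of a partial order compatible with the linear
   structure, and the norm is a lattice norm. *)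
Record banach_lattice_axioms : Prop := {
  bl_joinC : forall x y, join x y = join y x;
  bl_joinA : forall x y z, join x (join y z) = join (join x y) z;
  bl_joinxx : forall x, join x x = x;
  bl_le_add : forall x y z, bl_le x y -> bl_le (x + z) (y + z);
  bl_le_scale : forall (a : R) x y, 0 <= a -> bl_le x y -> bl_le (a *: x) (a *: y);
  bl_norm_mono : forall x y, bl_le (bl_abs x) (bl_abs y) -> `|x| <= `|y| }.

Definition dual_space : set (E -> R) :=
  [set f | (forall x y, f (x + y) = f x + f y) /\
           (forall (a : R) x, f (a *: x) = a * f x) /\ continuous f].

Definition dual_le (f g : E -> R) : Prop :=
  forall x, bl_le 0 x -> f x <= g x.

Definition dual_norm (f : E -> R) : R :=
  sup ((fun x : E => `|f x|) @` [set x : E | `|x| <= 1]).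

(* E^star has order continuous norm: for every downward directed D in E^star
   with infimum 0 (in E^star), inf { ||f|| : f in D } = 0 (equivalently,
   ||f_a|| -> 0 for every net f_a decreasing to 0). *)
Definition oc_dual_norm : Prop :=
  forall D : set (E -> R), D `<=` dual_space -> D !=set0 ->
  (forall f g, D f -> D g -> exists2 h, D h & dual_le h f /\ dual_le h g) ->
  (forall f, D f -> dual_le (fun _ => 0) f) ->
  (forall h, dual_space h -> (forall f, D f -> dual_le h f) ->
     dual_le h (fun _ => 0)) ->
  forall eps : R, 0 < eps -> exists2 f, D f & dual_norm f < eps.

End BanachLattice.

(* Lattice isomorphism between (sub)spaces A, B: a linear bijection
   T : A -> B with x <= y <-> T x <= T y (a linear order isomorphism
   between vector lattices is exactly a lattice isomorphism). *)
Definition lattice_iso (R : realType) (X Y : lmodType R)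
  (A : set X) (leA : X -> X -> Prop) (B : set Y) (leB : Y -> Y -> Prop) : Prop :=
  exists T : X -> Y,
  [/\ forall x y, A x -> A y -> T (x + y) = T x + T y,
      forall (a : R) x, A x -> T (a *: x) = a *: T x,
      forall x, A x -> B (T x),
      forall y, B y -> exists2 x, A x & T x = y &
      forall x y, A x -> A y -> (leA x y <-> leB (T x) (T y))].

Section Polynomials.
Variables (R : realType) (n : nat) (E G : normedModType R)
  (joinE : E -> E -> E) (joinG : G -> G -> G).

Definition nmap := ('I_n -> E) -> (G -> R).

Definition upd (xs : 'I_n -> E) (i : 'I_n) (u : E) : 'I_n -> E :=
  fun j => if j == i then u else xs j.

Definition multilinear (T : nmap) : Prop :=
  forall (i : 'I_n) (xs : 'I_n -> E) (a : R) (u v : E),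
    T (upd xs i (a *: u + v)) = a *: T (upd xs i u) + T (upd xs i v).

Definition symmetric_map (T : nmap) : Prop :=
  forall (s : {perm 'I_n}) (xs : 'I_n -> E), T (xs \o s) = T xs.

Definition positive_map (T : nmap) : Prop :=
  forall xs : 'I_n -> E, (forall i, bl_le joinE 0 (xs i)) ->
    dual_le joinG (fun _ => 0) (T xs).

Definition pos_poly (P : E -> G -> R) : Prop :=
  exists T : nmap, [/\ multilinear T, symmetric_map T,
    forall xs, dual_space (T xs),
    forall x, P x = T (fun _ => x) & positive_map T].

Definition reg_poly (P : E -> G -> R) : Prop :=
  exists P1 P2, [/\ pos_poly P1, pos_poly P2 & P = (fun x => P1 x - P2 x)].

Definition poly_le (P Q : E -> G -> R) : Prop := pos_poly (fun x => Q x - P x).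

Definition is_poly_abs (P Q : E -> G -> R) : Prop :=
  [/\ reg_poly Q, poly_le P Q, poly_le (fun x => - P x) Q &
      forall S, reg_poly S -> poly_le P S -> poly_le (fun x => - P x) S ->
        poly_le Q S].

Definition orth_additive (P : E -> G -> R) : Prop :=
  forall x y, bl_disjoint joinE x y -> P (x + y) = P x + P y.

Definition Pro : set (E -> G -> R) :=
  [set P | reg_poly P /\ exists Q, is_poly_abs P Q /\ orth_additive Q].

End Polynomials.

(* Main.v *)
(* A positive orthogonally additive polynomial is the diagonal of a positive
   multilinear form T vanishing on disjoint pairs of arguments. Moving the
   variables one at a time from E to F through the isomorphism s : E^* -> F^*
   (the Arens-Nicodemi extension) preserves positivity and linearity. The crux
   is that it preserves orthosymmetry of pairs of variables: for u, v disjoint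
   in F, the functional x |-> s (T (x, .)) v on E is carried by the band of v,
   because a decreasing sequence of pieces of x that peels off its part outside
   the band gives functionals decreasing to 0, on which s ( . ) v tends to 0 by
   order continuity. Positive orthosymmetric forms are symmetric, so
   the order in which the variables are moved is irrelevant, and extending back
   along the inverse of s undoes the extension. Hence s induces an isomorphism
   of the cones of positive orthogonally additive polynomials, and these cones
   generate the two spaces since, by Riesz-Kantorovich, a difference of two
   elements of the cone has a modulus, which is dominated by their sum. *)

(* Neither [E] nor [F] need be Dedekind complete, so they may lack band projections, and [s] need
   not come from a map between [E] and [F]. Bands are therefore used only in the duals; on the
   spaces themselves they are replaced by the pieces [(x - z / m)^+] and [(z - m x)^+], which are
   disjoint, and disjointness arguments become estimates with an error of order [1 / m]. Order
   continuity may be given on either side. On the side of [F] it applies to the transported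
   functionals; on the side of [E], a subsequence with norms at most [2^-k] is summed inside the
   dual of [E], and the image of the sum under [s] would have to exceed every multiple of a positive
   lower bound. Continuity of the functionals built on the way comes from positivity, since a
   positive functional on a Banach lattice is continuous. Values in the dual of [G] are tested at
   each positive [g], which reduces the work to scalar forms. *)
Require Import Defs.
From HB Require Import structures.
From mathcomp Require Import all_boot all_order all_algebra all_fingroup.
From mathcomp Require Import all_classical all_reals all_analysis.
From mathcomp Require Import ring lra.
Set Implicit Arguments. Unset Strict Implicit. Unset Printing Implicit Defensive.
Import Order.TTheory GRing.Theory Num.Theory numFieldNormedType.Exports.
Local Open Scope classical_set_scope.
Local Open Scope ring_scope.

(** * Vector lattices *)

Section VectorLattice.
Variables (R : realType) (E : normedModType R) (j : E -> E -> E).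
Hypothesis hj : banach_lattice_axioms j.
Local Notation le := (bl_le j).

Lemma vle_refl x : le x x.
Proof. exact: (bl_joinxx hj). Qed.

Lemma vle_trans y x z : le x y -> le y z -> le x z.
Proof. by rewrite /bl_le => xy yz; rewrite -yz (bl_joinA hj) xy. Qed.

Lemma vle_anti x y : le x y -> le y x -> x = y.
Proof. by rewrite /bl_le => xy; rewrite (bl_joinC hj) xy. Qed.

Lemma vle_joinl x y : le x (j x y).
Proof. by rewrite /bl_le (bl_joinA hj) (bl_joinxx hj). Qed.

Lemma vle_joinr x y : le y (j x y).
Proof. by rewrite (bl_joinC hj); exact: vle_joinl. Qed.

Lemma vjoin_le x y z : le x z -> le y z -> le (j x y) z.
Proof. by rewrite /bl_le => xz yz; rewrite -(bl_joinA hj) yz. Qed.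

Lemma vleD2r z x y : le (x + z) (y + z) <-> le x y.
Proof.
split; last exact: (bl_le_add hj).
by move=> /(bl_le_add hj (-z)); rewrite !addrK.
Qed.

Lemma vleD2l z x y : le (z + x) (z + y) <-> le x y.
Proof. by rewrite !(addrC z); exact: vleD2r. Qed.

Lemma vleBl x y z : le (x - y) z <-> le x (z + y).
Proof. by rewrite -(vleD2r y) subrK. Qed.

Lemma vleBr x y z : le x (z - y) <-> le (x + y) z.
Proof. by rewrite -(vleD2r y) subrK. Qed.

Lemma vsub_ge0 x y : le 0 (y - x) <-> le x y.
Proof. by rewrite vleBr add0r. Qed.

Lemma vsub_le0 x y : le (y - x) 0 <-> le y x.
Proof. by rewrite vleBl add0r. Qed.

Lemma vleN x y : le (- x) (- y) <-> le y x.
Proof. by rewrite -vsub_ge0 opprK addrC vsub_ge0. Qed.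

Lemma vleD a b c d : le a b -> le c d -> le (a + c) (b + d).
Proof.
by move=> /(vleD2r c) ab /(vleD2l b) cd; exact: vle_trans ab cd.
Qed.

Lemma vaddr_ge0 x y : le 0 x -> le 0 y -> le 0 (x + y).
Proof. by move=> x0 y0; rewrite -[0]addr0; exact: vleD. Qed.

Lemma vleDl x y : le 0 y -> le x (x + y).
Proof. by move=> y0; rewrite -{1}[x]addr0; apply/vleD2l. Qed.

Lemma vleDr x y : le 0 y -> le x (y + x).
Proof. by move=> y0; rewrite addrC; exact: vleDl. Qed.

Lemma vle_subl x y : le 0 y -> le (x - y) x.
Proof. by move=> y0; apply/vleBl; exact: vleDl. Qed.

Lemma vscale_ge0 (a : R) x : 0 <= a -> le 0 x -> le 0 (a *: x).
Proof. by move=> a0 x0; rewrite -(scaler0 _ a); exact: (bl_le_scale hj). Qed.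

Lemma vscale_lel (a b : R) x : a <= b -> le 0 x -> le (a *: x) (b *: x).
Proof.
move=> ab x0; apply/vsub_ge0; rewrite -scalerBl.
by apply: vscale_ge0; rewrite ?subr_ge0.
Qed.

Lemma vsum_ge0 (I : Type) (r : seq I) (P : pred I) (F : I -> E) :
  (forall i, P i -> le 0 (F i)) -> le 0 (\sum_(i <- r | P i) F i).
Proof.
move=> F0; elim/big_ind: _ => //; [exact: vle_refl|exact: vaddr_ge0].
Qed.

Definition vpos (x : E) : E := j x 0.

Lemma vpos_ge0 x : le 0 (vpos x).
Proof. exact: vle_joinr. Qed.

Lemma vle_pos x : le x (vpos x).
Proof. exact: vle_joinl. Qed.

Lemma vpos_le x z : le x z -> le 0 z -> le (vpos x) z.
Proof. exact: vjoin_le. Qed.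

Lemma vpos_mono x y : le x y -> le (vpos x) (vpos y).
Proof.
move=> xy; apply: vpos_le; last exact: vpos_ge0.
exact: vle_trans xy (vle_pos _).
Qed.

Lemma vpos_decomp x : x = vpos x - vpos (- x).
Proof.
apply: vle_anti.
  apply/vleBr; rewrite addrC; apply/vleBr; apply: vpos_le.
    by apply/vleBr; rewrite addNr; exact: vpos_ge0.
  by apply/vsub_ge0; exact: vle_pos.
apply/vleBl; apply: vpos_le.
  by rewrite -{1}[x]addr0; apply/vleD2l; exact: vpos_ge0.
by rewrite addrC -[x in _ + x]opprK; apply/vsub_ge0; exact: vle_pos.
Qed.

Lemma vposN x : vpos (- x) = vpos x - x.
Proof. by rewrite {3}(vpos_decomp x) opprB addrC subrK. Qed.

Lemma vpos_scale (a : R) x : 0 < a -> vpos (a *: x) = a *: vpos x.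
Proof.
move=> a0; have sc y z : le y (a *: z) -> le (a^-1 *: y) z.
  have ai : 0 <= a^-1 by rewrite invr_ge0 ltW.
  move=> /(bl_le_scale hj ai).
  by rewrite scalerA mulVf ?gt_eqF// scale1r.
apply: vle_anti.
  apply: vpos_le; last by apply: vscale_ge0; [exact: ltW|exact: vpos_ge0].
  by apply: (bl_le_scale hj); [exact: ltW|exact: vle_pos].
rewrite -[X in le _ X]scale1r -(@mulfV _ a) ?gt_eqF// -scalerA.
apply: (bl_le_scale hj); first exact: ltW.
apply: vpos_le.
  have := vle_pos (a *: x); have ai : 0 <= a^-1 by rewrite invr_ge0 ltW.
  move=> /(bl_le_scale hj ai).
  by rewrite scalerA mulVf ?gt_eqF// scale1r.
by apply: vscale_ge0; [rewrite invr_ge0 ltW|exact: vpos_ge0].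
Qed.

(** The sum [vpos a + vpos b] is the supremum of 0, [a], [b] and [a + b]. *)
Lemma vposD_le a b c : le 0 c -> le a c -> le b c -> le (a + b) c ->
  le (vpos a + vpos b) c.
Proof.
move=> c0 ac bc abc; apply/vleBr; apply: vpos_le.
  apply/vleBr; rewrite addrC; apply/vleBr; apply: vpos_le.
    by apply/vleBr; rewrite addrC.
  by apply/vsub_ge0.
by apply/vsub_ge0; exact: vpos_le.
Qed.

(** Written so that [x = vmeet x y + vpos (x - y)] is immediate: this splitting is the basic cut of
    the whole proof. *)
Definition vmeet (x y : E) : E := x - vpos (x - y).

Lemma vmeet_lel x y : le (vmeet x y) x.
Proof. by apply: vle_subl; exact: vpos_ge0. Qed.

Lemma vmeet_ler x y : le (vmeet x y) y.
Proof.
by apply/vleBl; rewrite addrC; apply/vleBl; exact: vle_pos.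
Qed.

Lemma le_vmeet x y z : le z x -> le z y -> le z (vmeet x y).
Proof.
move=> zx zy; apply/vleBr; rewrite addrC; apply/vleBr; apply: vpos_le.
  by apply/vleD2l/vleN.
by apply/vsub_ge0.
Qed.

Lemma vmeet_ge0 x y : le 0 x -> le 0 y -> le 0 (vmeet x y).
Proof. exact: le_vmeet. Qed.

Lemma vmeet_split x y : x = vmeet x y + vpos (x - y).
Proof. by rewrite subrK. Qed.

Lemma bl_meetE x y : bl_meet j x y = vmeet x y.
Proof.
apply: vle_anti.
  apply: le_vmeet; apply/vleN; rewrite opprK.
    exact: vle_joinl.
  exact: vle_joinr.
apply/vleN; rewrite opprK; apply: vjoin_le; apply/vleN.
  exact: vmeet_lel.
exact: vmeet_ler.
Qed.

(** For positive elements this is disjointness; phrased through lower bounds, it is stable under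
    domination and sums without computing meets. *)
Definition perp (a b : E) : Prop := forall w, le w a -> le w b -> le w 0.

Lemma perpC a b : perp a b -> perp b a.
Proof. by move=> ab w wb wa; exact: ab. Qed.

Lemma perpP a b : le 0 a -> le 0 b -> (perp a b <-> bl_meet j a b = 0).
Proof.
move=> a0 b0; rewrite bl_meetE; split=> [ab|ab w wa wb]; last first.
  by rewrite -ab; exact: le_vmeet.
apply: vle_anti; last exact: vmeet_ge0.
by apply: ab; [exact: vmeet_lel|exact: vmeet_ler].
Qed.

Lemma perp_mono a b c d : le a c -> le b d -> perp c d -> perp a b.
Proof.
by move=> ac bd cd w wa wb; apply: cd; [exact: vle_trans wa ac|
  exact: vle_trans wb bd].
Qed.

(** Subtracting [b] from a common lower bound of [a + b] and [c] gives one of [a] and [c], so the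
    original bound lies below [b]. *)
Lemma perpDl a b c : le 0 b -> perp a c -> perp b c -> perp (a + b) c.
Proof.
move=> b0 ac bc w wab wc; apply: bc => //.
apply/vsub_le0; apply: ac; first by apply/vleBl.
by apply: vle_trans wc; exact: vle_subl.
Qed.

Lemma perpZl (t : R) a b : 0 <= t -> le 0 a -> le 0 b -> perp a b ->
  perp (t *: a) b.
Proof.
move=> t0 a0 b0 ab.
have nP (n : nat) : perp (n%:R *: a) b.
  elim: n => [|n IH]; first by rewrite scale0r => w w0.
  by rewrite -addn1 natrD scalerDl scale1r; exact: perpDl.
apply: perp_mono (nP (Num.truncn t).+1); last exact: vle_refl.
by apply: vscale_lel => //; rewrite ltW//; exact: truncnS_gt.
Qed.

Lemma perpZr (t : R) a b : 0 <= t -> le 0 a -> le 0 b -> perp a b ->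
  perp a (t *: b).
Proof. by move=> t0 a0 b0 /perpC ab; apply/perpC; exact: perpZl. Qed.

Lemma perpDr a b c : le 0 b -> perp a c -> perp a b -> perp a (c + b).
Proof. by move=> b0 /perpC ac /perpC ab; apply/perpC; exact: perpDl. Qed.

Lemma perp_pos x : perp (vpos x) (vpos (- x)).
Proof.
move=> w wp wn.
have : le (vpos x) (vpos x - w).
  apply: vpos_le; last by apply/vsub_ge0.
  by apply/vleBr; rewrite addrC; apply/vleBr; rewrite -vposN.
by move=> /vleBr; rewrite -{2}[vpos x]addr0 => /vleD2l.
Qed.

(* The pieces of [x] above [z / m] and of [z] above [m x] live where the ratio
   [z / x] is below, resp. above, [m]. *)
Lemma perp_cut (m : R) x z : 0 < m ->
  perp (vpos (x - m^-1 *: z)) (vpos (z - m *: x)).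
Proof.
move=> m0; have -> : x - m^-1 *: z = m^-1 *: - (z - m *: x).
  by rewrite scalerN scalerBr scalerA mulVf ?gt_eqF// scale1r opprB.
rewrite vpos_scale ?invr_gt0//.
apply: perpZl; [by rewrite invr_ge0 ltW|exact: vpos_ge0|exact: vpos_ge0|].
exact/perpC/perp_pos.
Qed.

Lemma riesz_decomp w u v : le 0 w -> le 0 u -> le 0 v -> le w (u + v) ->
  exists w1 w2, [/\ w = w1 + w2, le 0 w1, le 0 w2, le w1 u & le w2 v].
Proof.
move=> w0 u0 v0 wuv; exists (vmeet w u), (vpos (w - u)).
split; [exact: vmeet_split|exact: vmeet_ge0|exact: vpos_ge0|exact: vmeet_ler|].
by apply: vpos_le => //; apply/vleBl; rewrite addrC.
Qed.

Lemma vmeet_mono x x' y y' : le x x' -> le y y' -> le (vmeet x y) (vmeet x' y').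
Proof.
move=> xx yy; apply: le_vmeet; [exact: vle_trans (vmeet_lel _ _) xx|
  exact: vle_trans (vmeet_ler _ _) yy].
Qed.

Lemma vmeet_idl x y : le x y -> vmeet x y = x.
Proof.
move=> xy; apply: vle_anti; first exact: vmeet_lel.
by apply: le_vmeet => //; exact: vle_refl.
Qed.

Lemma vmeet_subadd x x' y : le 0 x -> le 0 x' -> le 0 y ->
  le (vmeet (x + x') y) (vmeet x y + vmeet x' y).
Proof.
move=> x0 x'0 y0; rewrite /vmeet addrACA -opprD; apply/vleD2l/vleN.
apply: vposD_le; first exact: vpos_ge0.
- by apply: vle_trans (vle_pos _); apply/vleD2r; exact: vleDl.
- by apply: vle_trans (vle_pos _); apply/vleD2r; exact: vleDr.
- apply: vle_trans (vle_pos _); rewrite addrACA; apply/vleD2l.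
  by rewrite -opprD; apply/vleN; exact: vleDl.
Qed.

Lemma vmeet_addl x x' y y' :
  le (vmeet x y + vmeet x' y') (vmeet (x + x') (y + y')).
Proof.
by apply: le_vmeet; apply: vleD; (exact: vmeet_lel || exact: vmeet_ler).
Qed.

Lemma vabs_ge0 x : le 0 (bl_abs j x).
Proof.
have h0 : le 0 (bl_abs j x + bl_abs j x).
  rewrite -(subrr x); apply: vleD; [exact: vle_joinl|exact: vle_joinr].
have i0 : (0 : R) <= 2^-1 by rewrite invr_ge0.
have := vscale_ge0 i0 h0.
have -> : bl_abs j x + bl_abs j x = 2 *: bl_abs j x.
  by rewrite scaler_nat mulr2n.
by rewrite scalerA mulVf ?pnatr_eq0// scale1r.
Qed.

Lemma vabs_id x : le 0 x -> bl_abs j x = x.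
Proof.
move=> x0; apply: vle_anti; last exact: vle_joinl.
apply: vjoin_le; first exact: vle_refl.
by apply: (vle_trans (y := 0)) => //; rewrite -oppr0; apply/vleN.
Qed.

Lemma vpos_le_abs x : le (vpos x) (bl_abs j x).
Proof. by apply: vpos_le; [exact: vle_joinl|exact: vabs_ge0]. Qed.

Lemma vposN_le_abs x : le (vpos (- x)) (bl_abs j x).
Proof. by apply: vpos_le; [exact: vle_joinr|exact: vabs_ge0]. Qed.

Lemma vnorm_le x y : le 0 x -> le 0 y -> le x y -> `|x| <= `|y|.
Proof. by move=> x0 y0 xy; apply: (bl_norm_mono hj); rewrite !vabs_id. Qed.

Lemma vnorm_pos x : `|vpos x| <= `|x|.
Proof.
by apply: (bl_norm_mono hj); rewrite (vabs_id (vpos_ge0 _)); exact: vpos_le_abs.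
Qed.

Lemma disjoint_parts x y : bl_disjoint j x y ->
  [/\ perp (vpos x) (vpos y), perp (vpos x) (vpos (- y)),
      perp (vpos (- x)) (vpos y) & perp (vpos (- x)) (vpos (- y))].
Proof.
move=> /(perpP (vabs_ge0 _) (vabs_ge0 _)) xy.
by split; apply: perp_mono xy; (exact: vpos_le_abs || exact: vposN_le_abs).
Qed.

Lemma perp_disjoint x y : le 0 x -> le 0 y -> perp x y -> bl_disjoint j x y.
Proof. by move=> x0 y0 xy; rewrite /bl_disjoint !vabs_id//; exact/perpP. Qed.

(** If [y_ n] is positive then [(- y)^+ <= (y_ n - y)^+], and positive parts do not increase the
    norm. *)
Lemma vge0_closed (y_ : nat -> E) (y : E) :
  (forall n, le 0 (y_ n)) -> y_ @ \oo --> y -> le 0 y.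
Proof.
move=> y0 /cvgrPdist_lt yy.
suff n0 : `|vpos (- y)| <= 0.
  have : vpos (- y) = 0 by apply/eqP; rewrite -normr_le0.
  by rewrite {2}(vpos_decomp y) => ->; rewrite subr0; exact: vpos_ge0.
apply/ler_addgt0Pl => e e0; rewrite addr0.
have [N _ /(_ N (leqnn _)) /ltW hN] := yy e e0.
apply: le_trans hN; rewrite distrC; apply: le_trans (vnorm_pos _).
apply: vnorm_le; [exact: vpos_ge0|exact: vpos_ge0|].
by apply: vpos_mono; exact: vleDr.
Qed.

End VectorLattice.

(** * The Riesz-Kantorovich theorem *)

Definition lin1 (R : realType) (E : normedModType R) (Y : lmodType R)
  (f : E -> Y) : Prop := forall a x y, f (a *: x + y) = a *: f x + f y.

Section Linear.
Variables (R : realType) (E : normedModType R) (Y : lmodType R) (f : E -> Y).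
Hypothesis lf : lin1 f.

Lemma lin1_0 : f 0 = 0.
Proof.
have := lf 1 0 0; rewrite !scale1r addr0 => /eqP.
by rewrite -subr_eq0 opprD addNKr oppr_eq0 => /eqP.
Qed.

Lemma lin1D x y : f (x + y) = f x + f y.
Proof. by rewrite -[x]scale1r lf !scale1r. Qed.

Lemma lin1Z a x : f (a *: x) = a *: f x.
Proof. by rewrite -[_ *: _]addr0 lf lin1_0 addr0. Qed.

Lemma lin1N x : f (- x) = - f x.
Proof. by rewrite -[- x]scaleN1r lin1Z scaleN1r. Qed.

Lemma lin1B x y : f (x - y) = f x - f y.
Proof. by rewrite lin1D lin1N. Qed.

End Linear.

Lemma lin1_sub (R : realType) (E : normedModType R) (Y : lmodType R)
  (f g : E -> Y) : lin1 f -> lin1 g -> lin1 (f - g).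
Proof.
move=> lf lg a x y; rewrite !fctE lf lg scalerBr opprD.
by rewrite -!addrA; congr (_ + _); rewrite addrCA.
Qed.

Lemma lin1_add (R : realType) (E : normedModType R) (Y : lmodType R)
  (f g : E -> Y) : lin1 f -> lin1 g -> lin1 (f + g).
Proof. by move=> lf lg a x y; rewrite !fctE lf lg scalerDr addrACA. Qed.

(** * Linear extension of additive maps given on the positive cone *)

Section ConeExtension.
Variables (R : realType) (E : normedModType R) (j : E -> E -> E).
Hypothesis hj : banach_lattice_axioms j.
Variables (Y : lmodType R) (f : E -> Y).
Local Notation le := (bl_le j).
Hypothesis fD : forall x y, le 0 x -> le 0 y -> f (x + y) = f x + f y.
Hypothesis fZ : forall a x, 0 <= a -> le 0 x -> f (a *: x) = a *: f x.

Definition cone_ext (x : E) : Y := f (vpos j x) - f (vpos j (- x)).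

(** Independence of the chosen difference of positive elements, to which linearity of the extension
    reduces. *)
Let extB u v : le 0 u -> le 0 v -> cone_ext (u - v) = f u - f v.
Proof.
move=> u0 v0; set x := u - v; apply/eqP; rewrite subr_eq addrAC eq_sym subr_eq.
have p0 := vpos_ge0 hj x; have n0 := vpos_ge0 hj (- x).
rewrite -!fD//; apply/eqP; congr f.
by apply/eqP; rewrite -subr_eq addrAC -/x {1}(vpos_decomp hj x) subrK.
Qed.

Lemma cone_ext_id x : le 0 x -> cone_ext x = f x.
Proof.
move=> x0; rewrite -[x]subr0 extB// ?subr0; last exact: vle_refl.
suff -> : f 0 = 0 by rewrite subr0.
by rewrite -(scale0r (0 : E)) fZ ?scale0r//; exact: vle_refl.
Qed.

Lemma cone_ext_lin : lin1 cone_ext.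
Proof.
have eD x y : cone_ext (x + y) = cone_ext x + cone_ext y.
  rewrite {1}(vpos_decomp hj x) {1}(vpos_decomp hj y) addrACA -opprD extB;
    try by apply: vaddr_ge0 => //; exact: vpos_ge0.
  by rewrite !fD; try exact: vpos_ge0; rewrite opprD addrACA.
have eZ a x : 0 <= a -> cone_ext (a *: x) = a *: cone_ext x.
  move=> a0; rewrite {1}(vpos_decomp hj x) scalerBr extB;
    try by apply: vscale_ge0 => //; exact: vpos_ge0.
  by rewrite !fZ ?scalerBr//; exact: vpos_ge0.
have eN x : cone_ext (- x) = - cone_ext x.
  by rewrite /cone_ext opprK opprB.
move=> a x y; rewrite eD; congr (_ + _).
have [a0|a0] := leP 0 a; first exact: eZ.
by rewrite -[a *: x]opprK -scaleNr eN eZ ?oppr_ge0 1?ltW// scaleNr opprK.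
Qed.

End ConeExtension.

(** * Suprema of sets of positive maps *)

Section DedekindCompleteness.

(** The order of the target is carried by a cone, not by a lattice structure: positive maps into [Y]
    then form such a cone again, and the theorem can be iterated over the variables of a form. *)
Record pointed_cone (R : realType) (Y : lmodType R) (K : set Y) : Prop := {
  pcone0 : K 0;
  pconeD : forall x y, K x -> K y -> K (x + y);
  pconeZ : forall (a : R) x, 0 <= a -> K x -> K (a *: x);
  pcone_anti : forall x, K x -> K (- x) -> x = 0 }.

Definition cone_ub (R : realType) (Y : lmodType R) (K A : set Y) (b : Y) :=
  forall a, A a -> K (b - a).

Definition cone_lub (R : realType) (Y : lmodType R) (K A : set Y) (s : Y) :=
  cone_ub K A s /\ forall b, cone_ub K A b -> K (b - s).

Definition cone_complete (R : realType) (Y : lmodType R) (K : set Y) :=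
  forall A : set Y, A !=set0 -> (exists b, cone_ub K A b) ->
  exists s, cone_lub K A s.

Lemma cone_lub_uniq (R : realType) (Y : lmodType R) (K A : set Y) s t :
  pointed_cone K -> cone_lub K A s -> cone_lub K A t -> s = t.
Proof.
move=> cK [us ls] [ut lt]; apply/eqP; rewrite -subr_eq0; apply/eqP.
by apply: (pcone_anti cK); [exact: lt|rewrite opprB; exact: ls].
Qed.

Lemma cone_lubD (R : realType) (Y : lmodType R) (K A B : set Y) s t :
  pointed_cone K -> cone_lub K A s -> cone_lub K B t ->
  cone_lub K [set a + b | a in A & b in B] (s + t).
Proof.
move=> cK [us ls] [ut lt]; split=> [_ [a Aa [b Bb <-]]|c uc].
  by rewrite opprD addrACA; apply: (pconeD cK); [exact: us|exact: ut].
rewrite opprD addrA; apply: lt => b Bb; rewrite addrAC.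
apply: ls => a Aa; rewrite addrAC -addrA -opprD; apply: uc.
by exists a => //; exists b.
Qed.

Variables (R : realType) (E : normedModType R) (j : E -> E -> E).
Hypothesis hj : banach_lattice_axioms j.
Variables (Y : lmodType R) (K : set Y).
Hypothesis cK : pointed_cone K.
Local Notation le := (bl_le j).

Definition pos_maps : set (E -> Y) :=
  [set f | lin1 f /\ forall x, le 0 x -> K (f x)].

Lemma pos_maps_cone : pointed_cone pos_maps.
Proof.
split.
- by split=> [a x y|x _]; [rewrite scaler0 addr0|exact: pcone0].
- move=> f g [lf pf] [lg pg]; split; first exact: lin1_add.
  by move=> x x0; apply: (pconeD cK); [exact: pf|exact: pg].
- move=> a f a0 [lf pf]; split=> [b x y|x x0]; last by apply: (pconeZ cK); auto.
  by rewrite !fctE lf scalerDr !scalerA mulrC.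
- move=> f [lf pf] [_ nf]; apply/funext => x.
  have f0 y : le 0 y -> f y = 0.
    by move=> y0; apply: (pcone_anti cK); [exact: pf|exact: nf].
  rewrite (vpos_decomp hj x) lin1B// !f0 ?subr0//; exact: vpos_ge0.
Qed.

(* [riesz_sums A x y]: [y] is a sum [\sum a_i u_i] over a partition
   [x = \sum u_i] with [u_i >= 0] and [a_i] in [A]. *)
Inductive riesz_sums (A : set (E -> Y)) : E -> Y -> Prop :=
| riesz_nil : riesz_sums A 0 0
| riesz_cons a u x y : A a -> le 0 u -> riesz_sums A x y ->
    riesz_sums A (u + x) (a u + y).

Section Sums.
Variable A : set (E -> Y).
Hypothesis lA : forall a, A a -> lin1 a.

Lemma riesz_sums_ge0 x y : riesz_sums A x y -> le 0 x.
Proof.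
by elim=> [|a u {}x {}y _ u0 _ x0]; [exact: vle_refl|exact: vaddr_ge0].
Qed.

Lemma riesz_sums1 a x : A a -> le 0 x -> riesz_sums A x (a x).
Proof.
move=> Aa x0; rewrite -[x in riesz_sums _ x]addr0 -[a x]addr0.
by apply: riesz_cons => //; exact: riesz_nil.
Qed.

Lemma riesz_sumsD x y x' y' : riesz_sums A x y -> riesz_sums A x' y' ->
  riesz_sums A (x + x') (y + y').
Proof.
move=> h h'; elim: h => [|a u {}x {}y Aa u0 _ IH]; first by rewrite !add0r.
by rewrite -!addrA; exact: riesz_cons.
Qed.

Lemma riesz_sumsZ (a : R) x y : 0 <= a -> riesz_sums A x y ->
  riesz_sums A (a *: x) (a *: y).
Proof.
move=> a0; elim=> [|b u {}x {}y Ab u0 _ IH].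
  by rewrite !scaler0; exact: riesz_nil.
rewrite !scalerDr -(lin1Z (lA Ab)).
by apply: riesz_cons => //; exact: vscale_ge0.
Qed.

(** Riesz decomposition cuts the first piece [u] between [x] and [x'], and the remaining pieces
    partition what is left of both. This yields additivity of the supremum. *)
Lemma riesz_sums_split z y : riesz_sums A z y ->
  forall x x', le 0 x -> le 0 x' -> z = x + x' ->
  exists y1 y2, [/\ riesz_sums A x y1, riesz_sums A x' y2 & y = y1 + y2].
Proof.
elim=> [|a u {}z {}y Aa u0 hz IH] x x' x0 x'0 e.
  have xE : x = 0.
    apply: (vle_anti hj) => //; rewrite e; exact: vleDl.
  have x'E : x' = 0 by rewrite e xE add0r.
  by exists 0, 0; rewrite xE x'E addr0; split=> //; exact: riesz_nil.
have [|u1 [u2 [ue u10 u20 u1x u2x]]] := riesz_decomp hj u0 x0 x'0.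
  by rewrite -e; apply: vleDl => //; exact: riesz_sums_ge0 hz.
have [|||y1 [y2 [h1 h2 ye]]] := IH (x - u1) (x' - u2).
- exact/vsub_ge0.
- exact/vsub_ge0.
- by rewrite addrACA -opprD -e -ue addrAC subrr add0r.
exists (a u1 + y1), (a u2 + y2); split.
- by rewrite -(subrK u1 x) addrC; exact: riesz_cons.
- by rewrite -(subrK u2 x') addrC; exact: riesz_cons.
- by rewrite ue (lin1D (lA Aa)) ye addrACA.
Qed.

Lemma riesz_sums_ub c x y : cone_ub pos_maps A c -> lin1 c ->
  riesz_sums A x y -> K (c x - y).
Proof.
move=> uc lc; elim=> [|a u {}x {}y Aa u0 _ IH].
  by rewrite lin1_0// subr0; exact: pcone0.
rewrite lin1D// opprD addrACA; apply: (pconeD cK) => //.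
by have [_] := uc _ Aa; exact.
Qed.

End Sums.

(** Having 0 in [A] makes every upper bound linear, hence also each member [a = b - (b - a)]. The
    pointwise formula is kept in the conclusion for use in [disjoint_split]. *)
Lemma riesz_kantorovich (A : set (E -> Y)) : cone_complete K -> A 0 ->
  (exists b, cone_ub pos_maps A b) ->
  exists S, cone_lub pos_maps A S /\
    forall x, le 0 x -> cone_lub K [set y | riesz_sums A x y] (S x).
Proof.
move=> dK A0 [b ub].
have lub_ c : cone_ub pos_maps A c -> lin1 c.
  by move=> /(_ _ A0) [+ _]; rewrite subr0.
have lA a : A a -> lin1 a.
  move=> Aa; have -> : a = b - (b - a) by rewrite opprB addrC subrK.
  by apply: lin1_sub; [exact: lub_|have [] := ub _ Aa].
(* The default 0 can occur only off the cone, where [cone_ext] never evaluates [f]. *)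
pose f x := xget 0 [set s | cone_lub K [set y | riesz_sums A x y] s].
have fP x : le 0 x -> cone_lub K [set y | riesz_sums A x y] (f x).
  move=> x0; rewrite /f; case: xgetP => [y _ //|].
  have [||s hs] := dK [set y | riesz_sums A x y].
  - by exists ((0 : E -> Y) x); exact: riesz_sums1.
  - by exists (b x) => y; apply: (riesz_sums_ub ub); exact: lub_.
  - by move=> /(_ s).
have fD x y : le 0 x -> le 0 y -> f (x + y) = f x + f y.
  move=> x0 y0; apply: (cone_lub_uniq cK) (fP _ _) _; first exact: vaddr_ge0.
  suff -> : [set z | riesz_sums A (x + y) z] = [set z + t |
      z in [set z | riesz_sums A x z] & t in [set t | riesz_sums A y t]].
    by apply: (cone_lubD cK); exact: fP.
  apply/seteqP; split=> [z /= hz|_ [z hz [t ht <-]]]; last exact: riesz_sumsD.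
  by have [z1 [z2 [h1 h2 ->]]] := riesz_sums_split lA hz x0 y0 erefl;
    exists z1 => //; exists z2.
have f0 : f 0 = 0.
  apply: (addIr (f 0)); rewrite add0r -fD ?addr0//; exact: vle_refl.
have fZ a x : 0 <= a -> le 0 x -> f (a *: x) = a *: f x.
  rewrite le_eqVlt => /predU1P[<- _|a0 x0]; first by rewrite !scale0r.
  have ai : 0 <= a^-1 by rewrite invr_ge0 ltW.
  apply: (cone_lub_uniq cK) (fP _ _) _; first exact: vscale_ge0 (ltW a0) _.
  have [u l] := fP _ x0; split=> [y /(riesz_sumsZ lA ai)|c uc].
    rewrite scalerA mulVf ?gt_eqF// scale1r => /u /(pconeZ cK (ltW a0)).
    by rewrite scalerBr scalerA mulfV ?gt_eqF// scale1r.
  have /l /(pconeZ cK (ltW a0)) : cone_ub K [set y | riesz_sums A x y] (a^-1 *: c).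
    move=> y /(riesz_sumsZ lA (ltW a0)) /uc /(pconeZ cK ai).
    by rewrite scalerBr scalerA mulVf ?gt_eqF// scale1r.
  by rewrite scalerBr scalerA mulfV ?gt_eqF// scale1r.
have lS := cone_ext_lin hj fD fZ; have eS := cone_ext_id hj fD fZ.
exists (cone_ext j f); split; last by move=> x x0; rewrite eS//; exact: fP.
split=> [a Aa|c uc]; (split; first by apply: lin1_sub; auto).
  move=> x x0; rewrite !fctE eS//; have [u _] := fP _ x0; apply: u.
  exact: riesz_sums1.
move=> x x0; rewrite !fctE eS//; have [_] := fP _ x0; apply => y.
by apply: riesz_sums_ub => //; exact: lub_.
Qed.

(** Translation by a member of [A] brings 0 into the set. *)
Lemma pos_maps_complete : cone_complete K -> cone_complete pos_maps.
Proof.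
move=> dK A [a0 Aa0] [b ub].
have [||S [[uS lS] _]] := @riesz_kantorovich [set a - a0 | a in A] dK.
- by exists a0 => //; rewrite subrr.
- exists (b - a0) => _ [a Aa <-]; rewrite opprB addrA subrK; exact: ub.
- exists (S + a0); split=> [a Aa|c uc].
  rewrite -addrA -[a0 - a]opprB; apply: uS; by exists a.
rewrite opprD addrCA addrC; apply: lS => _ [a Aa <-].
by rewrite opprB addrA subrK; exact: uc.
Qed.

End DedekindCompleteness.

Lemma real_cone (R : realType) : pointed_cone [set r : R^o | 0 <= r].
Proof.
split=> /=; [by []|exact: addr_ge0|move=> a x; exact: mulr_ge0|].
by move=> x x0; rewrite oppr_ge0 => x1; apply/eqP; rewrite eq_le x0 x1.
Qed.

Lemma real_cone_complete (R : realType) : cone_complete [set r : R^o | 0 <= r].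
Proof.
move=> A A0 [b ub].
have hA : has_sup (A : set R).
  by split=> //; exists b => a /ub /=; rewrite subr_ge0.
exists (sup (A : set R)); split=> [a Aa|c uc] /=; rewrite subr_ge0.
  exact: ub_le_sup (proj2 hA) _ Aa.
by apply: ge_sup => // a /uc /=; rewrite subr_ge0.
Qed.

(** * Orthosymmetric bilinear forms are symmetric *)

Lemma le0_archi (R : realType) (r C : R) :
  (forall n : nat, r <= n.+1%:R^-1 * C) -> r <= 0.
Proof.
move=> h; apply/ler_addgt0Pr => e e0; rewrite add0r.
have [n hn] : exists n : nat, C / e <= n.+1%:R.
  by exists (Num.truncn (C / e)); rewrite ltW//; exact: truncnS_gt.
apply: le_trans (h n) _; rewrite mulrC ler_pdivrMr ?ltr0n//.
by rewrite mulrC -ler_pdivrMr.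
Qed.

Lemma le0_archi2 (R : realType) (r C : R) : 0 <= C ->
  (forall n : nat, r <= (2 ^- n) * C) -> r <= 0.
Proof.
move=> C0 h; apply: (@le0_archi R r C) => n; apply: le_trans (h n) _.
apply: ler_wpM2r => //; rewrite lef_pV2 ?posrE ?exprn_gt0 ?ltr0n//.
by rewrite -natrX ler_nat ltn_expl.
Qed.

Section Orthosymmetric.
Variables (R : realType) (E : normedModType R) (j : E -> E -> E).
Hypothesis hj : banach_lattice_axioms j.
Local Notation le := (bl_le j).
Local Notation perp := (perp j).

Record orthosym_bil (B : E -> E -> R) : Prop := {
  osbl : forall y, lin1 (B^~ y : E -> R^o);
  osbr : forall x, lin1 (B x : E -> R^o);
  osb_ge0 : forall x y, le 0 x -> le 0 y -> 0 <= B x y;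
  osb_perp : forall x y, le 0 x -> le 0 y -> perp x y -> B x y = 0 }.

Lemma orthosym_tr B : orthosym_bil B -> orthosym_bil (fun x y => B y x).
Proof.
case=> bl br b0 bp; split=> // x y x0 y0; first exact: b0.
by move=> /perpC; exact: bp.
Qed.

Section Bilinear.
Variable B : E -> E -> R.
Hypothesis hB : orthosym_bil B.

Lemma osb_mono x y z w : le 0 x -> le x y -> le 0 z -> le z w ->
  B x z <= B y w.
Proof.
move=> x0 xy z0 zw; have y0 := vle_trans hj x0 xy.
apply: (@le_trans _ _ (B y z)); rewrite -subr_ge0.
  by rewrite -[_ - _](lin1B (osbl hB z)); apply: (osb_ge0 hB) => //; exact/vsub_ge0.
by rewrite -[_ - _](lin1B (osbr hB y)); apply: (osb_ge0 hB) => //; exact/vsub_ge0.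
Qed.

(** Bound [x] by [(x - z / m)^+ + z / m]: the first term is disjoint from the second argument, so
    only [z / m] contributes. *)
Lemma osb_cut (m : R) x z : 0 < m -> le 0 x -> le 0 z ->
  B x (vpos j (z - m *: x)) <= m^-1 * B z z.
Proof.
move=> m0 x0 z0; set w := vpos j (z - _); have w0 := vpos_ge0 hj (z - m *: x).
have mi : 0 <= m^-1 by rewrite invr_ge0 ltW.
have mz := vscale_ge0 hj mi z0.
apply: (@le_trans _ _ (B (vpos j (x - m^-1 *: z) + m^-1 *: z) w)).
  apply: osb_mono => //; last exact: vle_refl.
  by apply/(vleBl hj); exact: vle_pos.
rewrite (lin1D (osbl hB w)) (lin1Z (osbl hB w)) (osb_perp hB) ?add0r //.
- apply: ler_wpM2l => //; apply: osb_mono => //; first exact: vle_refl.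
  apply: vpos_le => //; apply: vle_subl => //.
  by apply: vscale_ge0 => //; exact: ltW.
- exact: vpos_ge0.
- exact: perp_cut.
Qed.

(** Here [a + t - e] is a common lower bound of [a] and [t]. *)
Lemma perp_add_le a t e : perp a t -> le a e -> le t e -> le (a + t) e.
Proof.
move=> at_ ae te; apply/(vsub_le0 hj); apply: at_.
  by apply/(vleBl hj)/(vleD2l hj).
by apply/(vleBl hj); rewrite addrC; apply/(vleD2l hj).
Qed.

End Bilinear.

Lemma osb_cut_diff B (m : R) x z : orthosym_bil B -> 0 < m -> le 0 x ->
  le 0 z ->
  `|B x (vpos j (z - m *: x)) - B (vpos j (z - m *: x)) x| <= m^-1 * B z z.
Proof.
move=> hB m0 x0 z0; set w := vpos _ _; have w0 : le 0 w by exact: vpos_ge0.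
have h1 := osb_cut hB m0 x0 z0; have h2 := osb_cut (orthosym_tr hB) m0 x0 z0.
have p1 : 0 <= B x w by exact: osb_ge0.
have p2 : 0 <= B w x by exact: osb_ge0.
by rewrite ler_norml; apply/andP; split; rewrite -/w in h1 h2; lra.
Qed.

(* Halving: [2x - e = a - b] with [a], [b] disjoint, and [e] splits into a part
   containing [a] and disjoint from [b], up to [O(1/M)], and a part containing
   [b] and disjoint from [a]; so a bound [|B x e - B e x| <= K B e e] for all
   [0 <= x <= e] improves to the same bound with [K / 2]. *)
Lemma orthosym_diff_le B n x e : orthosym_bil B -> le 0 x -> le x e ->
  `|B x e - B e x| <= 2 ^- n * B e e.
Proof.
move=> hB; elim: n x e => [|n IH] x e x0 xe; have e0 := vle_trans hj x0 xe.
  rewrite expr0 invr1 mul1r.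
  have p1 : 0 <= B x e by exact: osb_ge0.
  have p2 : 0 <= B e x by exact: osb_ge0.
  have q1 : B x e <= B e e by apply: osb_mono => //; exact: vle_refl.
  have q2 : B e x <= B e e by apply: osb_mono => //; exact: vle_refl.
  by rewrite ler_norml; apply/andP; split; lra.
set K := 2 ^- n in IH; have K0 : 0 <= K by rewrite invr_ge0 exprn_ge0.
have -> : 2 ^- n.+1 = K / 2 :> R by rewrite exprSr invfM.
set N := B x e - B e x; rewrite -subr_le0.
have Q0 : 0 <= B e e by exact: osb_ge0.
apply: (@le0_archi R _ (B e e)) => k; set M : R := k.+1%:R.
have M0 : 0 < M by rewrite ltr0n.
have M1 : 1 <= M by rewrite ler1n.
set d := x + x - e; set a := vpos j d; set b := vpos j (- d).
have a0 : le 0 a by exact: vpos_ge0.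
have b0 : le 0 b by exact: vpos_ge0.
have dE : d = a - b by exact: vpos_decomp.
have ae : le a e.
  by apply: vpos_le => //; apply/(vleBl hj); exact: vleD.
have be : le b e.
  by apply: vpos_le => //; rewrite opprB; apply: vle_subl => //; exact: vaddr_ge0.
have ab : perp a b by exact: perp_pos.
set w := vpos j (e - M *: b); set t := vmeet j e (M *: b).
have et : e = t + w by exact: vmeet_split.
have Mb0 : le 0 (M *: b) by apply: vscale_ge0 => //; exact: ltW.
have t0 : le 0 t by exact: vmeet_ge0.
have w0 : le 0 w by exact: vpos_ge0.
have at_ : perp a t.
  apply: (@perp_mono _ _ _ hj _ _ a (M *: b)); first exact: vle_refl.
    exact: vmeet_ler.
  by apply: perpZr => //; exact: ltW.
have aw : le a w.
  have -> : w = e - t by rewrite et addrC addKr.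
  by apply/(vleBr hj); apply: perp_add_le => //; exact: vmeet_lel.
have bt : le b t.
  apply: le_vmeet => //; rewrite -{1}[b]scale1r; exact: vscale_lel.
(* The terms [B e e] cancel, so passing from [x] to [d = 2x - e] doubles the difference; this is the
   gain of each round. *)
have hNd : B d e - B e d = 2 * N.
  by rewrite /d !(lin1B (osbl hB _)) !(lin1B (osbr hB _)) !(lin1D (osbl hB _))
    !(lin1D (osbr hB _)) /N; ring.
have hN : 2 * N = (B a e - B e a) - (B b e - B e b).
  by rewrite -hNd dE !(lin1B (osbl hB _)) !(lin1B (osbr hB _)); ring.
have hN2 : 2 * N = (B a w - B w a) - (B b t - B t b) - (B b w - B w b).
  have z1 : B a t = 0 by exact: (osb_perp hB).
  have z2 : B t a = 0 by apply: (osb_perp hB) => //; exact: perpC.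
  rewrite hN et !(lin1D (osbl hB _) t w) !(lin1D (osbr hB _) t w) z1 z2; ring.
have i1 := IH _ _ a0 aw; have i2 := IH _ _ b0 bt.
have i3 := osb_cut_diff hB M0 b0 e0; rewrite -/w in i3.
(* Since [t] and [w] add up to [e], the two uses of the induction hypothesis together cost a single
   [K * B e e]. *)
have Qs : B w w + B t t <= B e e.
  have p1 : 0 <= B w t by exact: osb_ge0.
  have p2 : 0 <= B t w by exact: osb_ge0.
  by rewrite et (lin1D (osbr hB _) t w) !(lin1D (osbl hB _) t w); lra.
have KQ : K * B w w + K * B t t <= K * B e e.
  by rewrite -mulrDr; exact: ler_wpM2l.
have MQ : 0 <= M^-1 * B e e by rewrite mulr_ge0// invr_ge0 ltW.
move: i1 i2 i3 KQ MQ hN2; clear hNd hN; clearbody N.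
move: (B a w - B w a) (B b t - B t b) (B b w - B w b) => d1 d2 d3.
rewrite mulrAC; move: (K * _) (K * _) (K * _) (M^-1 * _) N => q1 q2 q3 q4 r.
rewrite lerBlDr !ler_norml => /andP[? ?] /andP[? ?] /andP[? ?] ? ? ?.
by apply/andP; split; lra.
Qed.

(** With [e = u + v] the difference [B u e - B e u] equals [B u v - B v u], and the halving bound
    sends it to 0. *)
Lemma orthosym_sym B x y : orthosym_bil B -> B x y = B y x.
Proof.
move=> hB.
have pos u v : le 0 u -> le 0 v -> B u v = B v u.
  move=> u0 v0; have e0 : le 0 (u + v) by exact: vaddr_ge0.
  have : `|B u (u + v) - B (u + v) u| <= 0.
    apply: (@le0_archi2 R _ (B (u + v) (u + v))); first exact: osb_ge0.
    by move=> n; apply: orthosym_diff_le => //; exact: vleDl.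
  rewrite normr_le0 (lin1D (osbr hB _)) (lin1D (osbl hB _)) => /eqP; lra.
rewrite (vpos_decomp hj x) (vpos_decomp hj y).
rewrite !(lin1B (osbr hB _)) !(lin1B (osbl hB _)).
have px := vpos_ge0 hj x; have nx := vpos_ge0 hj (- x).
have py := vpos_ge0 hj y; have ny := vpos_ge0 hj (- y).
rewrite (pos _ _ px py) (pos _ _ px ny) (pos _ _ nx py) (pos _ _ nx ny).
ring.
Qed.

End Orthosymmetric.

(** * Duals of Banach lattices *)

Lemma dual_lin1 (R : realType) (E : normedModType R) (f : E -> R) :
  dual_space f -> lin1 (f : E -> R^o).
Proof. by move=> [fD [fZ _]] a x y; rewrite fD fZ. Qed.

Lemma dual0 (R : realType) (E : normedModType R) : dual_space (0 : E -> R).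
Proof.
split; first by move=> x y; rewrite -[LHS]/(0 : R) -[RHS]/(0 + 0 : R) addr0.
split=> [a x|]; last exact: cst_continuous.
by rewrite -[LHS]/(0 : R) -[RHS]/(a * 0 : R) mulr0.
Qed.

Lemma dualD (R : realType) (E : normedModType R) (f g : E -> R) :
  dual_space f -> dual_space g -> dual_space (f + g).
Proof.
move=> [fD [fZ fc]] [gD [gZ gc]]; split.
  by move=> x y; rewrite !fctE fD gD addrACA.
split=> [a x|x]; first by rewrite !fctE fZ gZ mulrDr.
by apply: cvgD; [exact: fc|exact: gc].
Qed.

Lemma dualZ (R : realType) (E : normedModType R) (a : R) (f : E -> R) :
  dual_space f -> dual_space (a *: (f : E -> R^o)).
Proof.
move=> [fD [fZ fc]]; split.
  by move=> x y; rewrite -[LHS]/(a * f (x + y)) fD mulrDr.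
split=> [b x|x]; first by rewrite -[LHS]/(a * f (b *: x)) fZ mulrCA.
exact: (cvgM (cvg_cst a) (fc x)).
Qed.

Lemma dualB (R : realType) (E : normedModType R) (f g : E -> R) :
  dual_space f -> dual_space g -> dual_space (f - g).
Proof.
move=> hf hg; rewrite -[- g](@scaleN1r _ (E -> R^o)); apply: dualD => //.
exact: dualZ.
Qed.

(** * Continuity of positive functionals *)

Section AutomaticContinuity.
Variables (R : realType) (E : completeNormedModType R) (j : E -> E -> E).
Hypothesis hj : banach_lattice_axioms j.
Local Notation le := (bl_le j).

(** Otherwise there are positive [y n] of norm at most [2^-n] with [f (y n) >= 1]; by completeness
    they have a sum, at which [f] would exceed every integer. *)
Lemma pos_fun_bounded (f : E -> R) : lin1 (f : E -> R^o) ->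
  (forall x, le 0 x -> 0 <= f x) ->
  exists2 C, 0 <= C & forall x, `|f x| <= C * `|x|.
Proof.
move=> lf pf.
have fle x y : le x y -> f x <= f y.
  by move=> /(vsub_ge0 hj) /pf; rewrite (lin1B lf) subr_ge0.
suff [C C0 hC] : exists2 C, 0 <= C & forall x, le 0 x -> f x <= C * `|x|.
  exists C => // x; have hp := vpos_ge0 hj x; have hn := vpos_ge0 hj (- x).
  have p0 := pf _ hp; have n0 := pf _ hn.
  have pC : f (vpos j x) <= C * `|x|.
    by apply: le_trans (hC _ hp) _; apply: ler_wpM2l => //; exact: vnorm_pos.
  have nC : f (vpos j (- x)) <= C * `|x|.
    apply: le_trans (hC _ hn) _; apply: ler_wpM2l => //.
    by rewrite -[leRHS]normrN; exact: vnorm_pos.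
  rewrite {1}(vpos_decomp hj x) (lin1B lf) ler_norml.
  by apply/andP; split; lra.
apply: contrapT => hC.
have ex (n : nat) : exists x, [/\ le 0 x, `|x| <= 2 ^- n & 1 <= f x].
  have p2 : 0 < 2 ^+ n :> R by exact: exprn_gt0.
  have [x [x0 fx]] : exists x, le 0 x /\ 2 ^+ n * `|x| < f x.
    apply: contrapT => h; apply: hC; exists (2 ^+ n); first exact: ltW.
    by move=> x x0; rewrite leNgt; apply/negP => fx; apply: h; exists x.
  have nx : 0 < `|x|.
    rewrite normr_gt0; apply/eqP => xE; move: fx.
    by rewrite xE normr0 mulr0 (lin1_0 lf) ltxx.
  have t0 : 0 < (2 ^+ n * `|x|)^-1 by rewrite invr_gt0 mulr_gt0.
  exists ((2 ^+ n * `|x|)^-1 *: x); split.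
  - by apply: vscale_ge0 => //; exact: ltW.
  - by rewrite normrZ gtr0_norm// invfM mulfVK ?gt_eqF.
  - rewrite (lin1Z lf) [_ *: _]mulrC ler_pdivlMr ?mulr_gt0// mul1r.
    exact: ltW.
have [y hy] := choice ex.
have cy : cvgn (series y).
  apply: normed_cvg; apply: (@series_le_cvg _ _ (geometric 1 2^-1)).
  - by move=> n; rewrite normr_ge0.
  - by move=> n; rewrite /geometric /= mul1r exprn_ge0.
  - by move=> n; rewrite /geometric /= mul1r exprVn; have [] := hy n.
  - by apply: is_cvg_geometric_series; rewrite ger0_norm ?invr_ge0// invf_lt1 ?ltr1n.
have yS n : le (series y n) (limn (series y)).
  apply/(vsub_ge0 hj).
  apply: (@vge0_closed _ _ _ hj (fun m => series y (m + n)%N - series y n)).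
    move=> m; rewrite sub_series_geq ?leq_addl//.
    by apply: vsum_ge0 => // i _; have [] := hy i.
  apply: cvgB; last exact: cvg_cst.
  by rewrite (cvg_shiftn n (series y)).
have fn (n : nat) : n%:R <= f (series y n).
  elim: n => [|n IH]; first by rewrite /series /= big_geq// (lin1_0 lf).
  rewrite seriesSr (lin1D lf) -addn1 natrD; apply: lerD => //.
  by have [] := hy n.
have := truncnS_gt (f (limn (series y))); rewrite ltNge => /negP; apply.
by apply: le_trans (fn _) _; exact: fle.
Qed.

Lemma pos_fun_dual (f : E -> R) : lin1 (f : E -> R^o) ->
  (forall x, le 0 x -> 0 <= f x) -> dual_space f.
Proof.
move=> lf pf; split; first exact: (lin1D lf).
split; first exact: (lin1Z lf).
have [C C0 hC] := pos_fun_bounded lf pf.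
move=> x; apply/cvgrPdist_lt => e e0.
have d0 : 0 < e / (C + 1) by rewrite divr_gt0// ltr_wpDl.
near=> t; have -> : f x - f t = f (x - t) by rewrite (lin1B lf).
apply: le_lt_trans (hC _) _.
have xt : `|x - t| < e / (C + 1).
  by near: t; exact: (@cvgr_dist_lt _ _ _ (nbhs x)).
apply: (@le_lt_trans _ _ ((C + 1) * `|x - t|)).
  by apply: ler_wpM2r => //; rewrite lerDl.
by rewrite mulrC -ltr_pdivlMr// ltr_wpDl.
Unshelve. all: by end_near. Qed.

(** A real [sup] is informative only for bounded sets; [pos_fun_bounded] supplies the bound. *)
Lemma dual_norm_bound (f : E -> R) (e : R) : dual_space f ->
  (forall x, le 0 x -> 0 <= f x) -> dual_norm f < e ->
  forall x, `|f x| <= e * `|x|.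
Proof.
move=> df pf fe x; have lf := dual_lin1 df.
have [C C0 hC] := pos_fun_bounded lf pf.
have [->|x0] := eqVneq x 0; first by rewrite (lin1_0 lf) !normr0 mulr0.
have nx : 0 < `|x| by rewrite normr_gt0.
rewrite -ler_pdivrMr// -[`|x| in leLHS]normr_id -normfV -normrM.
apply: le_trans (ltW fe); apply: ub_le_sup.
  exists C => _ [y /= y1 <-]; apply: le_trans (hC y) _.
  by rewrite -[leRHS]mulr1; exact: ler_wpM2l.
exists (`|x|^-1 *: x) => /=; last by rewrite (lin1Z lf) [_ *: _]mulrC.
by rewrite normrZ normfV normr_id mulVf ?gt_eqF.
Qed.

(** The series is summed pointwise on the cone and extended linearly; positivity makes the result
    continuous. *)
Lemma dual_series (f : nat -> E -> R) : (forall n, dual_space (f n)) ->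
  (forall n, dual_le j 0 (f n)) ->
  (forall n x, le 0 x -> f n x <= 2 ^- n * `|x|) ->
  exists2 g, dual_space g &
    forall n, dual_le j (\sum_(k < n) f k) g.
Proof.
move=> df pf fb.
have lf n := dual_lin1 (df n).
have cf x : le 0 x -> cvgn (series (f ^~ x)).
  move=> x0; apply: (@series_le_cvg _ _ (geometric `|x| 2^-1)).
  - by move=> n; exact: pf.
  - by move=> n; rewrite /geometric /= mulr_ge0// exprn_ge0.
  - by move=> n; rewrite /geometric /= exprVn mulrC; exact: fb.
  - by apply: is_cvg_geometric_series; rewrite ger0_norm ?invr_ge0// invf_lt1 ?ltr1n.
pose h x : R^o := limn (series (f ^~ x)).
have hD x y : le 0 x -> le 0 y -> h (x + y) = h x + h y.
  move=> x0 y0; rewrite /h -limD; [|exact: cf|exact: cf]; congr (limn _).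
  apply/funext => n; rewrite fctE /series /= -big_split; apply: eq_bigr => i _.
  exact: (lin1D (lf i)).
have hZ a x : 0 <= a -> le 0 x -> h (a *: x) = a *: h x.
  move=> a0 x0; rewrite /h -limZr; last exact: cf.
  congr (limn _); apply/funext => n; rewrite fctE /series /= scaler_sumr.
  by apply: eq_bigr => i _; exact: (lin1Z (lf i)).
have eg := cone_ext_id hj hD hZ; have lg := cone_ext_lin hj hD hZ.
have hn n x : le 0 x -> series (f ^~ x) n <= h x.
  move=> x0; apply: nondecreasing_cvgn_le; last exact: cf.
  by apply: nondecreasing_series => k _ _; exact: pf.
exists (cone_ext j h).
  apply: pos_fun_dual => // x x0; rewrite eg//.
  by apply: le_trans (hn 0%N x x0); rewrite /series /= big_geq.
move=> n x x0; rewrite eg//; apply: le_trans (hn n x x0).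
by rewrite fct_sumE /series /= big_mkord.
Qed.

End AutomaticContinuity.

(** * Order isomorphisms between duals *)

Section DualIsomorphism.
Variable R : realType.

(** The map [s] accepts every function [E -> R] but is controlled only on [dual_space], so each
    application must first establish continuity. *)
Record dual_map (E F : normedModType R) (jE : E -> E -> E) (jF : F -> F -> F)
  (s : (E -> R) -> F -> R) : Prop := {
  dmD : forall f g, dual_space f -> dual_space g -> s (f + g) = s f + s g;
  dmZ : forall (a : R) f, dual_space f ->
    s (a *: (f : E -> R^o)) = a *: (s f : F -> R^o);
  dm_dual : forall f, dual_space f -> dual_space (s f);
  dm_le : forall f g, dual_space f -> dual_space g -> dual_le jE f g ->
    dual_le jF (s f) (s g) }.

(** The inverse is kept as data, so that results for [s] transfer to [t] through [dual_iso_sym]. *)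
Record dual_iso (E F : normedModType R) (jE : E -> E -> E) (jF : F -> F -> F)
  (s : (E -> R) -> F -> R) (t : (F -> R) -> E -> R) : Prop := {
  di_map : dual_map jE jF s;
  di_inv : dual_map jF jE t;
  di_can : forall f, dual_space f -> t (s f) = f;
  di_can' : forall f, dual_space f -> s (t f) = f }.

Lemma dual_iso_sym (E F : normedModType R) (jE : E -> E -> E)
  (jF : F -> F -> F) s t : dual_iso jE jF s t -> dual_iso jF jE t s.
Proof. by case. Qed.

Lemma dual_le_anti (E : normedModType R) (jE : E -> E -> E) (f g : E -> R) :
  banach_lattice_axioms jE -> dual_space f -> dual_space g ->
  dual_le jE f g -> dual_le jE g f -> f = g.
Proof.
move=> hE df dg fg gf; apply/funext => x.
have e y : bl_le jE 0 y -> f y = g y.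
  by move=> y0; apply/eqP; rewrite eq_le fg// gf.
rewrite (vpos_decomp hE x) (lin1B (dual_lin1 df)) (lin1B (dual_lin1 dg)).
by rewrite !e//; exact: vpos_ge0.
Qed.

Lemma lattice_iso_dual (E F : normedModType R) (jE : E -> E -> E)
  (jF : F -> F -> F) : banach_lattice_axioms jE -> banach_lattice_axioms jF ->
  lattice_iso (@dual_space R E) (dual_le jE) (@dual_space R F) (dual_le jF) ->
  exists s t, dual_iso jE jF s t.
Proof.
move=> hE hF [s [sD sZ sd ssurj sle]].
have ex (g : F -> R) : exists f, dual_space g -> dual_space f /\ s f = g.
  have [dg|ndg] := pselect (dual_space g); last by exists 0.
  by have [f df fg] := ssurj _ dg; exists f.
have [t ht] := choice ex.
have td g : dual_space g -> dual_space (t g) by move=> /ht[].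
have st g : dual_space g -> s (t g) = g by move=> /ht[].
(* Injectivity follows from reflection of the order and its antisymmetry. *)
have sinj f f' : dual_space f -> dual_space f' -> s f = s f' -> f = f'.
  move=> df df' e; apply: (dual_le_anti hE) => //; apply/sle => //;
  by rewrite e => x.
exists s, t; split=> //.
- split=> // f g df dg fg; exact/sle.
- split=> //.
  + move=> f g df dg; apply: sinj; [exact/td/dualD|
      by apply: dualD; exact: td|].
    rewrite st; last exact: dualD.
    by rewrite sD; [rewrite !st|exact: td|exact: td].
  + move=> a f df; apply: sinj; [exact/td/dualZ|by apply: dualZ; exact: td|].
    rewrite st; last exact: dualZ.
    by rewrite (sZ a (t f)); [rewrite st|exact: td].
  + by move=> f g df dg fg; apply/sle; [exact: td|exact: td|rewrite !st].
- by move=> f df; apply: sinj; [exact/td/sd|by []|rewrite st//; exact: sd].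
Qed.

Lemma dm0 (E F : normedModType R) (jE : E -> E -> E) (jF : F -> F -> F) s :
  dual_map jE jF s -> s 0 = 0.
Proof.
move=> hs; rewrite -(scale0r (0 : E -> R^o)) (dmZ hs); last exact: dual0.
by rewrite scale0r.
Qed.

Lemma dm_ge0 (E F : normedModType R) (jE : E -> E -> E) (jF : F -> F -> F) s f :
  dual_map jE jF s -> dual_space f -> dual_le jE 0 f -> dual_le jF 0 (s f).
Proof. by move=> hs df f0; rewrite -(dm0 hs); exact: (dm_le hs (dual0 _)). Qed.

Lemma dm_sum (E F : normedModType R) (jE : E -> E -> E) (jF : F -> F -> F) s
  (f : nat -> E -> R) n : dual_map jE jF s -> (forall n, dual_space (f n)) ->
  dual_space (\sum_(k < n) f k) /\
  s (\sum_(k < n) f k) = \sum_(k < n) s (f k).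
Proof.
move=> hs df; elim: n => [|n [IHd IH]].
  by rewrite !big_ord0; split; [exact: dual0|exact: dm0 hs].
rewrite !big_ord_recr /=; split; first exact: dualD.
by rewrite (dmD hs)// IH.
Qed.

End DualIsomorphism.

Section OrderContinuity.
Variables (R : realType) (E F : completeNormedModType R).
Variables (jE : E -> E -> E) (jF : F -> F -> F).
Hypotheses (hE : banach_lattice_axioms jE) (hF : banach_lattice_axioms jF).

Lemma oc_seq (f : nat -> E -> R) : oc_dual_norm jE ->
  (forall n, dual_space (f n)) -> (forall n, dual_le jE 0 (f n)) ->
  (forall n m, (n <= m)%N -> dual_le jE (f m) (f n)) ->
  (forall h, dual_space h -> (forall n, dual_le jE h (f n)) -> dual_le jE h 0) ->
  forall e, 0 < e -> exists n, forall x, `|f n x| <= e * `|x|.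
Proof.
move=> oc df pf fd f0 e e0.
have [|||||g [n _ <-] ng] := oc (range f) _ _ _ _ _ e e0.
- by move=> _ [n _ <-].
- by exists (f 0%N); exists 0%N.
- move=> _ _ [n _ <-] [m _ <-]; exists (f (maxn n m)).
    by exists (maxn n m).
  by split; apply: fd; rewrite ?leq_maxl ?leq_maxr.
- by move=> _ [n _ <-].
- by move=> h dh hf; apply: f0 => // n; apply: hf; exists n.
by exists n; exact: (dual_norm_bound hE (df n) (pf n) ng).
Qed.

End OrderContinuity.

(** For the dual of [F], the sequence [s (f n)] again decreases to 0 and tends to 0 in norm. For the
    dual of [E], if all [s (f n) v] exceeded [e], then [dual_series] would give [g] above the sums
    of a fast subsequence, and [k * e <= s g v] would hold for all [k]. *)
Lemma dual_iso_decr (R : realType) (E F : completeNormedModType R)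
  (jE : E -> E -> E) (jF : F -> F -> F)
  (s : (E -> R) -> F -> R) (t : (F -> R) -> E -> R) (f : nat -> E -> R) :
  banach_lattice_axioms jE -> banach_lattice_axioms jF ->
  oc_dual_norm jE \/ oc_dual_norm jF -> dual_iso jE jF s t ->
  (forall n, dual_space (f n)) -> (forall n, dual_le jE 0 (f n)) ->
  (forall n m, (n <= m)%N -> dual_le jE (f m) (f n)) ->
  (forall h, dual_space h -> (forall n, dual_le jE h (f n)) -> dual_le jE h 0) ->
  forall v, bl_le jF 0 v -> forall e, 0 < e -> exists n, s (f n) v <= e.
Proof.
move=> hE hF + [hs ht ts st] df pf fd f0 v v0 e e0.
have sf0 n : 0 <= s (f n) v by exact: (dm_ge0 hs (df n) (pf n)).
case=> oc; last first.
  have d0 : 0 < e / (`|v| + 1) by rewrite divr_gt0// ltr_wpDl.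
  have [||||n /(_ v) hn] := @oc_seq _ _ _ hF (fun n => s (f n)) oc _ _ _ _ _ d0.
  - by move=> n; exact: (dm_dual hs).
  - by move=> n; exact: (dm_ge0 hs).
  - by move=> n m nm; apply: (dm_le hs) => //; exact: fd.
  - move=> h dh hf; rewrite -(st _ dh) -(dm0 hs).
    apply: (dm_le hs); [exact: (dm_dual ht)|exact: dual0|].
    apply: f0 => [|n]; first exact: (dm_dual ht).
    rewrite -(ts _ (df n)); apply: (dm_le ht) => //; exact: (dm_dual hs).
  exists n; rewrite ger0_norm// in hn; apply: le_trans hn _.
  by rewrite mulrAC ler_pdivrMr ?ltr_wpDl// ler_wpM2l ?lerDl// ltW.
apply: contrapT => hn.
have he n : e <= s (f n) v.
  by rewrite leNgt; apply/negP => /ltW h; apply: hn; exists n.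
have ex k : exists n, forall x, `|f n x| <= 2 ^- k * `|x|.
  by apply: (oc_seq hE) => //; rewrite invr_gt0 exprn_gt0.
have [nu hnu] := choice ex.
have [|||g dg hg] := @dual_series _ _ _ hE (f \o nu).
- by move=> n; exact: df.
- by move=> n; exact: pf.
- by move=> n x x0; apply: le_trans (ler_norm _) _; exact: hnu.
have hk k : k%:R * e <= s g v.
  have [dk sk] := dm_sum k hs (fun n => df (nu n)).
  apply: (@le_trans _ _ (s (\sum_(i < k) f (nu i)) v)).
    rewrite sk fct_sumE mulr_natl -[k in leLHS]card_ord -sumr_const.
    by apply: ler_sum => i _; exact: he.
  by apply: (dm_le hs) => //; exact: hg.
have := truncnS_gt (s g v / e); rewrite ltNge => /negP; apply.
by rewrite ler_pdivlMr.
Qed.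

(** * Bands and disjointness in the dual *)

Section BandPart.
Variables (R : realType) (F : completeNormedModType R) (j : F -> F -> F).
Hypothesis hj : banach_lattice_axioms j.
Local Notation le := (bl_le j).
Variables (v : F) (v0 : le 0 v).

Definition band_cone (f : F -> R) (z : F) : R^o :=
  limn (fun k : nat => f (vmeet j z (k%:R *: v))).

(* The component of [f] in the band of functionals carried by [v]. *)
Definition band_part (f : F -> R) : F -> R^o := cone_ext j (band_cone f).

Let kv0 (k : nat) : le 0 (k%:R *: v).
Proof. exact: vscale_ge0. Qed.

Section Positive.
Variable f : F -> R.
Hypotheses (df : dual_space f) (pf : dual_le j 0 f).
Let lf := dual_lin1 df.
Let f_ge0 x : le 0 x -> 0 <= f x. Proof. exact: pf. Qed.

Let fle x y : le x y -> f x <= f y.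
Proof. by move=> /(vsub_ge0 hj) /pf; rewrite (lin1B lf) subr_ge0. Qed.

Let trunc_mono z : {homo (fun k : nat => f (vmeet j z (k%:R *: v))) :
  n m / (n <= m)%N >-> n <= m}.
Proof.
move=> n m nm; apply: fle; apply: vmeet_mono => //; first exact: vle_refl.
by apply: vscale_lel => //; rewrite ler_nat.
Qed.

Lemma band_cvg z : cvgn (fun k : nat => f (vmeet j z (k%:R *: v))).
Proof.
apply: nondecreasing_is_cvgn; first exact: trunc_mono.
by exists (f z) => _ [k _ <-]; apply: fle; exact: vmeet_lel.
Qed.

Lemma trunc_le_band z k : f (vmeet j z (k%:R *: v)) <= band_cone f z.
Proof. exact: (nondecreasing_cvgn_le (@trunc_mono z) (@band_cvg z)). Qed.

Lemma band_le z c : (forall k : nat, f (vmeet j z (k%:R *: v)) <= c) ->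
  band_cone f z <= c.
Proof. by move=> h; apply: limr_le; [exact: band_cvg|exact: nearW]. Qed.

Lemma band_coneD x y : le 0 x -> le 0 y ->
  band_cone f (x + y) = band_cone f x + band_cone f y.
Proof.
move=> x0 y0; apply/eqP; rewrite eq_le; apply/andP; split.
  apply: band_le => k.
  apply: (@le_trans _ _ (f (vmeet j x (k%:R *: v)) + f (vmeet j y (k%:R *: v)))).
    by rewrite -[_ + f _](lin1D lf); apply: fle; exact: vmeet_subadd.
  by apply: lerD; exact: trunc_le_band.
rewrite -[_ + _](limD (@band_cvg x) (@band_cvg y)).
apply: limr_le; first exact: is_cvgD (@band_cvg x) (@band_cvg y).
(* Two truncations at [k v] add up to at most the truncation of the sum at [2k v], hence the index
   [k + k]. *)
apply: nearW => k; apply: le_trans (trunc_le_band _ (k + k)).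
rewrite -[leLHS](lin1D lf); apply: fle; rewrite natrD scalerDl.
exact: vmeet_addl.
Qed.

(** One inequality suffices, used for [a] and for its inverse; in it [b^-1 * k] is rounded up to an
    integer multiple of [v]. *)
Lemma band_coneZ (a : R) x : 0 <= a -> le 0 x ->
  band_cone f (a *: x) = a *: band_cone f x.
Proof.
have half (b : R) y : 0 < b -> le 0 y -> band_cone f (b *: y) <= b * band_cone f y.
  move=> b0 y0; apply: band_le => k.
  have bi : 0 <= b^-1 by rewrite invr_ge0 ltW.
  set k' := (Num.truncn (b^-1 * k%:R)).+1.
  apply: (@le_trans _ _ (b * f (vmeet j y (k'%:R *: v)))); last first.
    by apply: ler_wpM2l; [exact: ltW|exact: trunc_le_band].
  rewrite -[leRHS](lin1Z lf); apply: fle.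
  have e1 z : z = b *: (b^-1 *: z) by rewrite scalerA mulfV ?gt_eqF// scale1r.
  have e2 z : z = b^-1 *: (b *: z) by rewrite scalerA mulVf ?gt_eqF// scale1r.
  rewrite [X in le X _]e1.
  apply: (bl_le_scale hj); first exact: ltW.
  apply: le_vmeet => //.
    rewrite [X in le _ X]e2.
    by apply: (bl_le_scale hj) => //; exact: vmeet_lel.
  apply: (vle_trans hj (y := b^-1 *: (k%:R *: v))).
    by apply: (bl_le_scale hj bi); exact: (vmeet_ler hj).
  by rewrite scalerA; apply: vscale_lel => //; rewrite ltW//; exact: truncnS_gt.
rewrite le_eqVlt => /predU1P[<- x0|a0 x0].
  rewrite !scale0r; apply/eqP; rewrite eq_le; apply/andP; split.
    apply: band_le => k; rewrite -[leRHS](lin1_0 lf); apply: fle.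
    exact: vmeet_lel.
  apply: (le_trans _ (trunc_le_band 0 0%N)).
  by apply: f_ge0; apply: vmeet_ge0 => //; exact: vle_refl.
apply/eqP; rewrite eq_le; apply/andP; split; first exact: half.
have ai : 0 < a^-1 by rewrite invr_gt0.
have := half a^-1 (a *: x) ai (vscale_ge0 hj (ltW a0) x0).
by rewrite scalerA mulVf ?gt_eqF// scale1r [a^-1 * _]mulrC ler_pdivlMr// mulrC.
Qed.

Lemma band_part_lin : lin1 (band_part f).
Proof. exact: cone_ext_lin band_coneD band_coneZ. Qed.

Lemma band_partE z : le 0 z -> band_part f z = band_cone f z.
Proof. exact: cone_ext_id band_coneD band_coneZ _. Qed.

Lemma band_part_ge0 : dual_le j 0 (band_part f).
Proof.
move=> z z0; rewrite band_partE//; apply: le_trans (trunc_le_band _ 0%N).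
by apply: f_ge0; exact: vmeet_ge0.
Qed.

Lemma band_part_dual : dual_space (band_part f).
Proof. exact: (pos_fun_dual hj band_part_lin band_part_ge0). Qed.

Lemma band_part_le : dual_le j (band_part f) f.
Proof.
move=> z z0; rewrite band_partE//; apply: band_le => k.
by apply: fle; exact: vmeet_lel.
Qed.

Lemma band_part_v : band_part f v = f v.
Proof.
apply/eqP; rewrite eq_le band_part_le//= band_partE//.
apply: le_trans (trunc_le_band _ 1%N).
by rewrite scale1r vmeet_idl//; exact: vle_refl.
Qed.

Lemma band_part_perp u : le 0 u -> perp j u v -> band_part f u = 0.
Proof.
move=> u0 uv; apply/eqP; rewrite eq_le band_part_ge0// andbT band_partE//.
apply: band_le => k; rewrite -(lin1_0 lf); apply: fle.
have : perp j u (k%:R *: v) by exact: perpZr.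
by apply; [exact: vmeet_lel|exact: vmeet_ler].
Qed.

Lemma band_part_approx z e : le 0 z -> 0 < e ->
  exists k : nat, band_part f z <= f (vmeet j z (k%:R *: v)) + e.
Proof.
move=> z0 e0; have /cvgrPdist_lt/(_ e e0) [k _ /(_ k (leqnn _))] := @band_cvg z.
exists k; rewrite band_partE// addrC -lerBlDr ltW//.
by apply: le_lt_trans (ler_norm _) _.
Qed.

End Positive.

Lemma band_partD f g : dual_space f -> dual_le j 0 f -> dual_space g ->
  dual_le j 0 g -> band_part (f + g) = band_part f + band_part g.
Proof.
move=> df pf dg pg; apply/funext => z; rewrite /band_part /cone_ext !fctE.
have e y : band_cone (f + g) y = band_cone f y + band_cone g y.
  by rewrite -[RHS](limD (band_cvg df pf (z := y)) (band_cvg dg pg (z := y))).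
by rewrite !e opprD addrACA.
Qed.

Lemma band_partZ (a : R) f : dual_space f -> dual_le j 0 f ->
  band_part (a *: (f : F -> R^o)) = a *: band_part f.
Proof.
move=> df pf; apply/funext => z; rewrite /band_part /cone_ext.
have e y : band_cone (a *: (f : F -> R^o)) y = a *: band_cone f y.
  by rewrite -[RHS](limZr a (band_cvg df pf (z := y))).
by rewrite !e -scalerBr.
Qed.

End BandPart.

(** By Riesz-Kantorovich, the infimum of [f] and [g] at [x] is the infimum of [f a + g (x - a)] over
    [0 <= a <= x]. It is reached as [g - S], where [S] is the supremum of 0 and [g - f], and
    disjointness makes it 0. *)
Lemma disjoint_split (R : realType) (E : completeNormedModType R)
  (j : E -> E -> E) (f g : E -> R) : banach_lattice_axioms j ->
  dual_space f -> dual_le j 0 f -> dual_space g -> dual_le j 0 g ->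
  (forall w, dual_space w -> dual_le j 0 w -> dual_le j w f -> dual_le j w g ->
    dual_le j w 0) ->
  forall x e, bl_le j 0 x -> 0 < e -> exists a,
    [/\ bl_le j 0 a, bl_le j a x & f a + g (x - a) <= e].
Proof.
move=> hj df pf dg pg fg x e x0 e0.
have lf := dual_lin1 df; have lg := dual_lin1 dg.
pose T : E -> R^o := (g : E -> R^o) - (f : E -> R^o).
pose A : set (E -> R^o) := [set a | a = 0 \/ a = T].
have lT : lin1 T by exact: lin1_sub.
(* As [A] contains only 0 and [T], the pieces assigned to [T] merge into a single [a]. *)
have sumsT z y : riesz_sums j A z y ->
    exists a, [/\ bl_le j 0 a, bl_le j a z & y = T a].
  elim=> [|b u {}z {}y Ab u0 _ [a [a0 ax ->]]].
    by exists 0; split; [exact: vle_refl|exact: vle_refl|rewrite (lin1_0 lT)].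
  case: Ab => ->.
    exists a; split=> //; last by rewrite add0r.
    by apply: (vle_trans hj ax); exact: vleDr.
  exists (u + a); split; [exact: vaddr_ge0|exact/(vleD2l hj)|].
  by rewrite (lin1D lT).
have [||S [[uS lS] hS]] := @riesz_kantorovich _ _ _ hj _ _ (@real_cone R) A
    (@real_cone_complete R).
- by left.
- exists (g : E -> R^o) => _ [->|->]; first by rewrite subr0; split.
  by rewrite /T opprB addrC subrK; split.
have [lS1 pS] : pos_maps j [set r : R^o | 0 <= r] S.
  by rewrite -[S]subr0; apply: uS; left.
have [_ hST] : pos_maps j [set r : R^o | 0 <= r] (S - T) by apply: uS; right.
have [lw pw] : pos_maps j [set r : R^o | 0 <= r] ((g : E -> R^o) - S).
  apply: lS => _ [->|->]; first by rewrite subr0; split.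
  by rewrite /T opprB addrC subrK; split.
have dw : dual_space (g - S) by exact: (pos_fun_dual hj lw pw).
have w0 : dual_le j (g - S) 0.
  apply: (fg _ dw pw) => y y0; rewrite -[leLHS]/(g y - S y).
    have h : 0 <= S y - (g y - f y) := hST _ y0.
    move: h; rewrite [S y : R^o]lock; lra.
  have h : 0 <= S y := pS _ y0.
  move: h; lra.
apply: contrapT => hn.
have [_ /(_ (g x - e))] := hS _ x0.
suff H : cone_ub [set r : R^o | 0 <= r] [set y | riesz_sums j A x y] (g x - e).
  move=> /(_ H) /= h1; have := w0 _ x0; rewrite fctE /= => h2.
  have h3 : g x - S x <= 0 by [].
  lra.
move=> y /sumsT [a [a0 ax yE]] /=.
rewrite subr_ge0 leNgt; apply/negP => h; apply: hn; exists a; split=> //.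
have {}h : g x - e < g a - f a by move: h; rewrite yE.
by rewrite (lin1B lg) -[leLHS]/(f a + (g x - g a)); lra.
Qed.

(** * Orthosymmetry survives the extension of one pair of variables *)

Section KeyLemma.
Variables (R : realType) (E F : completeNormedModType R).
Variables (jE : E -> E -> E) (jF : F -> F -> F).
Hypotheses (hE : banach_lattice_axioms jE) (hF : banach_lattice_axioms jF).
Variables (s : (E -> R) -> F -> R) (t : (F -> R) -> E -> R).
Hypothesis hst : dual_iso jE jF s t.
Hypothesis hoc : oc_dual_norm jE \/ oc_dual_norm jF.
Local Notation le := (bl_le jE).

Let hs : dual_map jE jF s := di_map hst.
Let ht : dual_map jF jE t := di_inv hst.

Variables (v : F) (v0 : bl_le jF 0 v).

(** The band of [v] lives in the dual of [F]; its projection is conjugated by [s], since in general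
    no element of [E] corresponds to [v]. *)
Definition band_proj (f : E -> R) : E -> R := t (band_part jF v (s f)).

Section Positive.
Variable f : E -> R.
Hypotheses (df : dual_space f) (pf : dual_le jE 0 f).

Let ds : dual_space (s f) := dm_dual hs df.
Let ps : dual_le jF 0 (s f) := dm_ge0 hs df pf.

Lemma band_proj_dual : dual_space (band_proj f).
Proof. exact: (dm_dual ht (band_part_dual hF v0 ds ps)). Qed.

Lemma band_proj_ge0 : dual_le jE 0 (band_proj f).
Proof.
exact: (dm_ge0 ht (band_part_dual hF v0 ds ps) (band_part_ge0 hF v0 ds ps)).
Qed.

Lemma band_proj_le : dual_le jE (band_proj f) f.
Proof.
rewrite -[X in dual_le _ _ X](di_can hst)//; apply: (dm_le ht) => //.
  exact: band_part_dual.
exact: band_part_le.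
Qed.

Lemma band_projE : s (band_proj f) = band_part jF v (s f).
Proof. by rewrite (di_can' hst)//; exact: band_part_dual. Qed.

End Positive.

Lemma band_projD f g : dual_space f -> dual_le jE 0 f -> dual_space g ->
  dual_le jE 0 g -> band_proj (f + g) = band_proj f + band_proj g.
Proof.
move=> df pf dg pg; rewrite /band_proj (dmD hs)// band_partD//; last 4 first.
- exact: (dm_dual hs).
- exact: (dm_ge0 hs).
- exact: (dm_dual hs).
- exact: (dm_ge0 hs).
by rewrite (dmD ht)//; apply: band_part_dual => //;
  solve [exact: (dm_dual hs)|exact: (dm_ge0 hs)].
Qed.

Lemma band_projZ (a : R) f : dual_space f -> dual_le jE 0 f ->
  band_proj (a *: (f : E -> R^o)) = a *: (band_proj f : E -> R^o).
Proof.
move=> df pf; rewrite /band_proj (dmZ hs)// band_partZ//; last 2 first.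
- exact: (dm_dual hs).
- exact: (dm_ge0 hs).
by rewrite (dmZ ht)//; apply: band_part_dual => //;
  solve [exact: (dm_dual hs)|exact: (dm_ge0 hs)].
Qed.

(* On [F], [w] is small on [z /\ k v] because [g] and its band part agree at
   [v], and small on [(z - k v)^+] because the band part of [f] is. *)
Lemma band_proj_disjoint f g w : dual_space f -> dual_le jE 0 f ->
  dual_space g -> dual_le jE 0 g -> dual_space w ->
  dual_le jE w (band_proj f) -> dual_le jE w (g - band_proj g) ->
  dual_le jE w 0.
Proof.
move=> df pf dg pg dw wf wg.
have dsf := dm_dual hs df; have psf := dm_ge0 hs df pf.
have dsg := dm_dual hs dg; have psg := dm_ge0 hs dg pg.
have dbf := band_part_dual hF v0 dsf psf; have dbg := band_part_dual hF v0 dsg psg.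
have dsw := dm_dual hs dw.
have swf : dual_le jF (s w) (band_part jF v (s f)).
  rewrite -band_projE//; apply: (dm_le hs) => //; exact: band_proj_dual.
have swg : dual_le jF (s w) (s g - band_part jF v (s g)).
  have dpg := band_proj_dual dg pg.
  have dN : dual_space (- band_proj g) by rewrite -sub0r; exact: dualB (dual0 _) _.
  suff <- : s (g - band_proj g) = s g - band_part jF v (s g).
    by apply: (dm_le hs) => //; exact: dualB.
  rewrite (dmD hs)//; congr (_ + _).
  rewrite -[- band_proj g](@scaleN1r _ (E -> R^o)) (dmZ hs)// band_projE//.
  exact: (@scaleN1r _ (F -> R^o)).
suff sw0 : dual_le jF (s w) 0.
  by rewrite -(di_can hst dw) -(dm0 ht); apply: (dm_le ht) => //; exact: dual0.
move=> z z0; apply/ler_addgt0Pr => e e0; rewrite -[leRHS]/(0 + e) add0r.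
have [k hk] := band_part_approx hF v0 dsf psf z0 e0.
have lw := dual_lin1 dsw; have lbf := dual_lin1 dbf.
set y := vmeet jF z (k%:R *: v) in hk; set r := vpos jF (z - k%:R *: v).
have kv : bl_le jF 0 (k%:R *: v) by exact: vscale_ge0.
have y0 : bl_le jF 0 y by exact: vmeet_ge0.
have ykv : bl_le jF y (k%:R *: v) by exact: vmeet_ler.
have r0 : bl_le jF 0 r by exact: vpos_ge0.
have zE : z = y + r by exact: vmeet_split.
have h1 : s w y <= 0.
  apply: le_trans (swg _ y0) _; rewrite -[leLHS]/(s g y - band_part jF v (s g) y).
  have := band_part_le hF v0 dsg psg ((vsub_ge0 hF _ _).2 ykv).
  rewrite (lin1B (dual_lin1 dbg)) (lin1B (dual_lin1 dsg)).
  rewrite (lin1Z (dual_lin1 dbg)) (lin1Z (dual_lin1 dsg)).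
  rewrite (band_part_v hF v0 dsg psg) => h.
  have {}h : k%:R * s g v - band_part jF v (s g) y <= k%:R * s g v - s g y by [].
  lra.
have h2 : s w r <= e.
  apply: le_trans (swf _ r0) _.
  have h3 : s f y <= band_part jF v (s f) y.
    rewrite band_partE//; apply: le_trans (trunc_le_band hF v0 dsf psf _ k).
    by rewrite (vmeet_idl hF ykv).
  move: hk; rewrite zE (lin1D lbf) => hk.
  have {}hk : band_part jF v (s f) y + band_part jF v (s f) r <= s f y + e by [].
  lra.
rewrite zE (lin1D lw) -[leLHS]/(s w y + s w r); lra.
Qed.

Variable B : E -> E -> R.
Hypothesis hB : orthosym_bil jE B.

Lemma osb_dual x : dual_space (B x).
Proof.
have pos y : le 0 y -> dual_space (B y).
  move=> y0; apply: (pos_fun_dual hE) => [|z z0]; first exact: osbr hB y.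
  exact: osb_ge0 hB _ _ y0 z0.
suff -> : B x = B (vpos jE x) - B (vpos jE (- x)).
  by apply: dualB; apply: pos; exact: vpos_ge0.
apply/funext => y; rewrite {1}(vpos_decomp hE x).
exact: (lin1B (osbl hB y)).
Qed.

Lemma osb_fun_ge0 x : le 0 x -> dual_le jE 0 (B x).
Proof. by move=> x0 z z0; exact: osb_ge0 hB _ _ x0 z0. Qed.

Lemma osb_lin : lin1 (B : E -> (E -> R^o)).
Proof. by move=> a x y; apply/funext => z; exact: (osbl hB z). Qed.

(** Built from the cone because additivity of [band_proj] is established for positive functionals
    only. *)
Definition band_bil : E -> E -> R :=
  cone_ext jE (fun x => band_proj (B x) : E -> R^o).

Let bbD x y : le 0 x -> le 0 y ->
  band_proj (B (x + y)) = band_proj (B x) + band_proj (B y).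
Proof.
move=> x0 y0; have -> : B (x + y) = B x + B y by exact: (lin1D osb_lin).
by apply: band_projD; solve [exact: osb_dual|exact: osb_fun_ge0].
Qed.

Let bbZ (a : R) x : 0 <= a -> le 0 x ->
  band_proj (B (a *: x)) = a *: (band_proj (B x) : E -> R^o).
Proof.
move=> a0 x0; have -> : B (a *: x) = a *: (B x : E -> R^o) by exact: (lin1Z osb_lin).
by apply: band_projZ; solve [exact: osb_dual|exact: osb_fun_ge0].
Qed.

Lemma band_bilE x : le 0 x -> band_bil x = band_proj (B x).
Proof. exact: (cone_ext_id hE bbD bbZ). Qed.

(** Domination by [B] passes orthosymmetry on, and with it the symmetry that [slice_in_band] needs
    to exchange the two slots. *)
Lemma band_bil_orthosym : orthosym_bil jE band_bil.
Proof.
have lD : lin1 (band_bil : E -> (E -> R^o)) := cone_ext_lin hE bbD bbZ.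
have dpos x : le 0 x -> dual_space (band_proj (B x)).
  by move=> x0; apply: band_proj_dual; [exact: osb_dual|exact: osb_fun_ge0].
have le_ x : le 0 x -> dual_le jE (band_bil x) (B x).
  move=> x0; rewrite band_bilE//; apply: band_proj_le; first exact: osb_dual.
  exact: osb_fun_ge0.
have ge0 x y : le 0 x -> le 0 y -> 0 <= band_bil x y.
  move=> x0 y0; rewrite band_bilE//.
  by apply: (band_proj_ge0 (osb_dual x) (osb_fun_ge0 x0)).
split=> //.
- by move=> y a x x'; rewrite lD.
- by move=> x; apply: lin1_sub; apply: dual_lin1; apply: dpos; exact: vpos_ge0.
- move=> x y x0 y0 xy; apply/eqP; rewrite eq_le ge0// andbT.
  by rewrite -(osb_perp hB x0 y0 xy); exact: le_.
Qed.

(* [h x = s (B x) v] is carried by [v]: its part [h2] off the band of [v]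
   vanishes. Writing [D] for the part of [B] in the band, [h x = s (D x) v] and
   [D x] is disjoint from [h2]; so [x] can be cut to [a k], decreasing in [k],
   with [h2 (x - a k)] small and [D x (a k) -> 0], whence [D (a k)] decreases
   to [0] and [h2 (a k) <= s (D (a k)) v -> 0]. *)
Lemma slice_in_band : let h := (fun x => s (B x) v) in
  dual_space h /\ dual_le jE 0 h /\ forall x, le 0 x -> h x <= band_proj h x.
Proof.
move=> h; have lB := osb_lin; have hD := band_bil_orthosym.
set D := band_bil in hD.
have lh : lin1 (h : E -> R^o).
  move=> a x y; rewrite /h.
  have -> : B (a *: x + y) = (a *: (B x : E -> R^o) : E -> R) + B y by exact: lB.
  rewrite (dmD hs) ?(dmZ hs)//; solve [exact: osb_dual|exact/dualZ/osb_dual].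
have ph : dual_le jE 0 h.
  by move=> x x0; exact: (dm_ge0 hs (osb_dual x) (osb_fun_ge0 x0) v0).
have dh : dual_space h by exact: (pos_fun_dual hE lh).
split=> //; split=> //; pose h2 := h - band_proj h.
have dh2 : dual_space h2 by apply: dualB => //; exact: band_proj_dual.
have ph2 : dual_le jE 0 h2.
  by move=> x x0; rewrite -[leRHS]/(h x - _) subr_ge0; exact: band_proj_le.
have h2h x : le 0 x -> h2 x <= h x.
  by move=> x0; rewrite -[leLHS]/(h x - _) gerBl; exact: band_proj_ge0.
have hDE x : le 0 x -> h x = s (D x) v.
  move=> x0; rewrite /D band_bilE// band_projE//; last exact: osb_fun_ge0.
    rewrite band_part_v//; first exact/(dm_dual hs)/osb_dual.
    by apply: (dm_ge0 hs); [exact: osb_dual|exact: osb_fun_ge0].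
  exact: osb_dual.
suff H x e : le 0 x -> 0 < e -> h2 x <= e.
  move=> x x0; rewrite -subr_le0; apply/ler_addgt0Pr => e e0; rewrite add0r.
  exact: H.
move=> x0 e0; have d0 : 0 < e / 2 by rewrite divr_gt0.
set d := e / 2 in d0.
have lh2 := dual_lin1 dh2.
have dD y : le 0 y -> dual_space (D y).
  move=> y0; rewrite /D band_bilE//; apply: band_proj_dual.
    exact: osb_dual.
  exact: osb_fun_ge0.
have pD y : le 0 y -> dual_le jE 0 (D y).
  by move=> y0 z z0; exact: (osb_ge0 hD).
(* The tolerances [d * 2^-(k+1)] sum to [d], so the losses of all cuts collected in [a k] stay below
   [d]. *)
have ex k : exists b, [/\ le 0 b, le b x & D x b + h2 (x - b) <= d * 2 ^- k.+1].
  apply: (@disjoint_split _ _ jE) => //; [exact: dD|exact: pD| |].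
    move=> w dw _; rewrite /D band_bilE// => w1 w2.
    by apply: band_proj_disjoint w1 w2 => //; solve [exact: osb_dual|exact: osb_fun_ge0].
  by rewrite mulr_gt0// invr_gt0 exprn_gt0.
have [b hb] := choice ex.
pose a := fix a k := if k is k'.+1 then vmeet jE (a k') (b k) else b 0%N.
have a0 k : le 0 (a k).
  elim: k => [|k IH] /=; first by have [] := hb 0%N.
  by apply: vmeet_ge0 => //; have [] := hb k.+1.
have ax k : le (a k) x.
  elim: k => [|k IH] /=; first by have [] := hb 0%N.
  exact: (vle_trans hE (vmeet_lel hE _ _) IH).
have ab k : le (a k) (b k).
  by case: k => [|k] /=; [exact: vle_refl|exact: vmeet_ler].
have adec n m : (n <= m)%N -> le (a m) (a n).
  move=> /subnK <-; elim: (m - n)%N => [|i IH]; first exact: vle_refl.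
  by rewrite addSn; exact: (vle_trans hE (vmeet_lel hE _ _) IH).
have Db k : D x (b k) <= d * 2 ^- k.+1.
  have [b0 bx hk] := hb k; apply: le_trans hk; rewrite lerDl.
  by apply: (ph2 (x - b k)); exact/(vsub_ge0 hE).
have hb2 k : h2 (x - b k) <= d * 2 ^- k.+1.
  have [b0 bx hk] := hb k; apply: le_trans hk; rewrite lerDr.
  exact: (osb_ge0 hD).
have Da k : D x (a k) <= d * 2 ^- k.+1.
  by apply: le_trans (Db k); apply: (osb_mono hE hD) => //; exact: vle_refl.
have h2le y z : le y z -> h2 y <= h2 z.
  move=> /(vsub_ge0 hE) /ph2; rewrite (lin1B lh2) => yz.
  by rewrite -subr_ge0; exact: yz.
have ha k : h2 (x - a k) <= d * (1 - 2 ^- k.+1).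
  elim: k => [|k IH] /=.
    by apply: le_trans (hb2 0%N) _; rewrite expr1; lra.
  apply: (@le_trans _ _ (h2 ((x - a k) + (x - b k.+1)))).
    (* As [a k] and [b k.+1] lie below [x], the element [a k + b k.+1 - x] lies below their meet. *)
    apply: h2le; have -> : x - a k + (x - b k.+1) = x - (a k + b k.+1 - x).
      by rewrite opprB opprD addrACA -addrA.
    apply/(vleD2l hE)/(vleN hE)/le_vmeet => //; apply/(vleBl hE).
      by apply/(vleD2l hE); have [] := hb k.+1.
    by rewrite addrC; apply/(vleD2l hE).
  rewrite (lin1D lh2); apply: le_trans (lerD IH (hb2 k.+1)) _.
  rewrite -mulrDr [2 ^+ k.+2]exprS invfM; lra.
have [||||k hk] := @dual_iso_decr _ _ _ _ _ s t (fun k => D (a k)) hE hF hoc hst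
    _ _ _ _ v v0 _ d0.
- by move=> k; exact: dD.
- by move=> k; exact: pD.
- move=> n m nm z z0; apply: (osb_mono hE hD) => //; last exact: vle_refl.
  exact: adec.
(* Cut [z] at [m x] with [m = n + 1]: below the cut [D (a k)] gives at most [m * D x (a k)], above
   it at most [D z z / m] by [osb_cut]. First [k], then [n], is sent to infinity. *)
- move=> g dg hg z z0; rewrite -[leRHS]/(0 : R).
  apply: (@le0_archi R _ (D z z)) => n; rewrite -subr_le0.
  have m0 : 0 < n.+1%:R :> R by rewrite ltr0n.
  apply: (@le0_archi2 R _ (n.+1%:R * d)).
    by rewrite mulr_ge0// ltW.
  move=> k; apply: (@le_trans _ _ (n.+1%:R * D x (a k))); last first.
    rewrite mulrCA; apply: ler_wpM2l; first exact: ltW.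
    apply: le_trans (Da k) _; rewrite [leRHS]mulrC; apply: ler_wpM2l; first exact: ltW.
    by rewrite lef_pV2 ?posrE ?exprn_gt0// ler_eXn2l ?ltr1n.
  rewrite lerBlDr; apply: le_trans (hg k z z0) _.
  rewrite {1}(vmeet_split jE z (n.+1%:R *: x)) (lin1D (osbr hD _)).
  apply: lerD.
    rewrite (orthosym_sym hE x _ hD) -[leRHS](lin1Z (osbr hD _)).
    apply: (osb_mono hE hD) => //; first exact: vle_refl.
      by apply: vmeet_ge0 => //; apply: vscale_ge0 => //; exact: ltW.
    exact: vmeet_ler.
  apply: (le_trans _ (osb_cut hE hD m0 x0 z0)).
  apply: (osb_mono hE hD) => //; first exact: vpos_ge0.
  exact: vle_refl.
have -> : x = a k + (x - a k) by rewrite addrC subrK.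
rewrite (lin1D lh2).
have h3 : h2 (a k) <= d by apply: le_trans (h2h _ (a0 k)) _; rewrite hDE.
have h4 : h2 (x - a k) <= d.
  by apply: le_trans (ha k) _; rewrite -[leRHS]mulr1 ler_pM2l// gerBl invr_ge0.
by rewrite -[leLHS]/(h2 (a k) + h2 (x - a k)); move: h3 h4; rewrite /d; lra.
Qed.

(** By [slice_in_band], [s h] is dominated by its own part in the band of [v], which vanishes at
    [u]. *)
Lemma perp_extension u : bl_le jF 0 u -> perp jF u v ->
  s (fun x => s (B x) v) u = 0.
Proof.
move=> u0 uv; have [dh [ph hle]] := slice_in_band; set h := (fun x => _) in dh ph hle *.
apply/eqP; rewrite eq_le; apply/andP; split; last exact: (dm_ge0 hs dh ph u0).
have -> : 0 = s (band_proj h) u.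
  rewrite band_projE// (band_part_perp hF v0 _ _ u0 uv)//; first exact: (dm_dual hs).
  exact: (dm_ge0 hs).
by apply: (dm_le hs) => //; exact: band_proj_dual.
Qed.

End KeyLemma.

(** * Multilinear forms as functions on lists *)

Section ListForms.
Variables (R : realType) (E : normedModType R) (j : E -> E -> E).
Hypothesis hj : banach_lattice_axioms j.
Local Notation le := (bl_le j).

Fixpoint allpos (l : seq E) : Prop :=
  if l is x :: l' then le 0 x /\ allpos l' else True.

Lemma allpos_cat l1 l2 : allpos (l1 ++ l2) <-> allpos l1 /\ allpos l2.
Proof. by elim: l1 => [|x l1 IH] /=; [tauto|rewrite IH; tauto]. Qed.

(* An [n]-linear map is a function on lists, of which only the values on lists
   of length [n] matter. *)
Definition mlin (Y : lmodType R) (n : nat) (T : seq E -> Y) : Prop :=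
  forall l1 l2 (a : R) u v, (size l1 + size l2).+1 = n ->
    T (l1 ++ (a *: u + v) :: l2) = a *: T (l1 ++ u :: l2) + T (l1 ++ v :: l2).

(** Only neighbours are exchanged, as that is what orthosymmetric pairs provide; [adjsym_perm]
    recovers all permutations. *)
Definition adjsym (Y : Type) (n : nat) (T : seq E -> Y) : Prop :=
  forall l1 x y l2, (size l1 + size l2).+2 = n ->
    T (l1 ++ x :: y :: l2) = T (l1 ++ y :: x :: l2).

Section Values.
Variable Y : lmodType R.
Implicit Types T : seq E -> Y.

Lemma mlin_cons n T x : mlin n.+1 T -> mlin n (fun l => T (x :: l)).
Proof. by move=> h l1 l2 a u v nE; rewrite -!cat_cons h//= addSn nE. Qed.

Lemma mlin_slot n T l1 l2 : mlin n T -> (size l1 + size l2).+1 = n ->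
  lin1 (fun x => T (l1 ++ x :: l2)).
Proof. by move=> h nE a u v; exact: h. Qed.

Lemma mlin_head n T l : mlin n.+1 T -> size l = n -> lin1 (fun x => T (x :: l)).
Proof. by move=> h nE; apply: (@mlin_slot n.+1 T [::] l h); rewrite nE. Qed.

Lemma mlin_comb n T T' (b : R) : mlin n T -> mlin n T' ->
  mlin n (fun l => b *: T l + T' l).
Proof.
move=> h h' l1 l2 a u v nE; rewrite h// h'// !scalerDr !scalerA mulrC.
by rewrite addrACA.
Qed.

(** Each argument in turn is split into positive and negative parts; [l1] collects the arguments
    already made positive. *)
Lemma mlin_pos_ext n T (Z : set Y) : mlin n T ->
  (forall y y', Z y -> Z y' -> Z (y - y')) ->
  (forall l, size l = n -> allpos l -> Z (T l)) ->
  forall l, size l = n -> Z (T l).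
Proof.
move=> h ZB Zp l.
suff H l2 l1 : allpos l1 -> size (l1 ++ l2) = n -> Z (T (l1 ++ l2)).
  exact: (H l [::]).
elim: l2 l1 => [|x l2 IH] l1 p1 nE; first by rewrite cats0 in nE *; exact: Zp.
have nE' : (size l1 + size l2).+1 = n by rewrite -nE size_cat addnS.
rewrite (vpos_decomp hj x) (lin1B (mlin_slot h nE')).
have H y : le 0 y -> Z (T (l1 ++ y :: l2)).
  move=> y0; rewrite -cat_rcons; apply: IH.
    by rewrite -cats1 allpos_cat /=.
  by rewrite cat_rcons size_cat /= addnS.
by apply: ZB; apply: H; exact: vpos_ge0.
Qed.

Lemma mlin_pos_eq0 n T : mlin n T ->
  (forall l, size l = n -> allpos l -> T l = 0) ->
  forall l, size l = n -> T l = 0.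
Proof.
move=> h; apply: (@mlin_pos_ext n T [set y | y = 0] h) => y y' /= -> ->.
by rewrite subrr.
Qed.

End Values.

Lemma adjsym_cons (Y : Type) n (T : seq E -> Y) x : adjsym n.+1 T ->
  adjsym n (fun l => T (x :: l)).
Proof. by move=> h l1 y z l2 nE; rewrite -!cat_cons h//= addSn nE. Qed.

Lemma adjsym_perm (Y : Type) n (T : seq E -> Y) l l' : adjsym n T ->
  size l = n -> perm_eq l l' -> T l = T l'.
Proof.
elim: l n T l' => [|x l IH] n T l' h nE pl.
  by have /perm_nilP -> : perm_eq l' [::] by rewrite perm_sym.
have xl' : x \in l' by rewrite -(perm_mem pl) mem_head.
case/splitPr: xl' pl => p q pl.
have nE' : (size p + size q).+1 = n.
  by rewrite -nE (perm_size pl) size_cat /= addnS.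
have mv p' c : (size c + size p' + size q).+1 = n ->
    T (c ++ p' ++ x :: q) = T (c ++ x :: p' ++ q).
  elim: p' c => [//|y p' IHp] c nc.
  rewrite -(h c y x); last by rewrite size_cat -nc /= !addnS addSn addnA.
  rewrite -[c ++ y :: x :: _]cat_rcons -[c ++ (y :: _) ++ _]cat_rcons.
  by apply: IHp; rewrite size_rcons -nc /= !addSn !addnS.
rewrite (mv p [::])//=; case: n => [//|n] in nE nE' h mv *.
apply: (IH n (fun l => T (x :: l))); [exact: adjsym_cons|by case: nE|].
by move: pl; rewrite perm_sym -cat1s perm_catCA perm_cons perm_sym.
Qed.

Definition pform (n : nat) (T : seq E -> R) : Prop :=
  mlin n (T : seq E -> R^o) /\
  forall l, size l = n -> allpos l -> 0 <= T l.

(** Fixing an argument of arbitrary sign in a positive form leaves a difference of positive forms;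
    this is the class on which the extension can recurse. *)
Definition rform (n : nat) (T : seq E -> R) : Prop :=
  exists T1 T2, [/\ pform n T1, pform n T2 &
    forall l, size l = n -> T l = T1 l - T2 l].

(** Testing neighbouring slots at positive arguments is enough: symmetry is derived in
    [oform_adjsym]. *)
Definition oform (n : nat) (T : seq E -> R) : Prop :=
  pform n T /\
  forall l1 x y l2, (size l1 + size l2).+2 = n -> allpos l1 -> allpos l2 ->
    le 0 x -> le 0 y -> perp j x y -> T (l1 ++ x :: y :: l2) = 0.

Lemma pform_cons n T x : le 0 x -> pform n.+1 T -> pform n (fun l => T (x :: l)).
Proof.
move=> x0 [h p]; split; first exact: (@mlin_cons R^o).
by move=> l nE pl; apply: p => //=; rewrite nE.
Qed.

Lemma pform_comb n T T' (a : R) : 0 <= a -> pform n T -> pform n T' ->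
  pform n (fun l => a * T l + T' l).
Proof.
move=> a0 [h p] [h' p']; split; first exact: (@mlin_comb R^o).
by move=> l nE pl; rewrite addr_ge0 ?mulr_ge0 ?p ?p'.
Qed.

Lemma pform_rform n T : pform n T -> rform n T.
Proof.
move=> h; exists T, (fun _ => 0); split=> //; last by move=> l _; rewrite subr0.
by split=> // l1 l2 a u v _; rewrite scaler0 addr0.
Qed.

Lemma rform_comb n T T' (a : R) : rform n T -> rform n T' ->
  rform n (fun l => a * T l + T' l).
Proof.
move=> [T1 [T2 [h1 h2 e]]] [T1' [T2' [h1' h2' e']]].
have [a0|/ltW a0] := leP 0 a.
  exists (fun l => a * T1 l + T1' l), (fun l => a * T2 l + T2' l).
  by split; [exact: pform_comb|exact: pform_comb|
    move=> l nE; rewrite e// e'//; ring].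
rewrite -oppr_ge0 in a0.
exists (fun l => - a * T2 l + T1' l), (fun l => - a * T1 l + T2' l).
by split; [exact: pform_comb|exact: pform_comb|
  move=> l nE; rewrite e// e'//; ring].
Qed.

Lemma rform_ext n T T' : (forall l, size l = n -> T l = T' l) -> rform n T ->
  rform n T'.
Proof.
by move=> e [T1 [T2 [h1 h2 h]]]; exists T1, T2; split=> // l nE; rewrite -e ?h.
Qed.

Lemma rform_mlin n T : rform n T -> mlin n (T : seq E -> R^o).
Proof.
move=> [T1 [T2 [[h1 _] [h2 _] e]]] l1 l2 a u v nE.
have sz w : size (l1 ++ w :: l2) = n by rewrite size_cat /= addnS.
rewrite !e// h1// h2// -[_ *: T1 _]/(a * T1 _) -[_ *: T2 _]/(a * T2 _).
rewrite -[RHS]/(a * (T1 _ - T2 _) + (T1 _ - T2 _)).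
by rewrite -[LHS]/(a * T1 _ + T1 _ - (a * T2 _ + T2 _)); ring.
Qed.

Lemma rform_sub n T T' : rform n T -> rform n T' -> rform n (fun l => T l - T' l).
Proof.
move=> h h'; apply: rform_ext (rform_comb (-1) h' h) => l _; ring.
Qed.

Lemma rform_cons n T x : rform n.+1 T -> rform n (fun l => T (x :: l)).
Proof.
have H U : pform n.+1 U -> rform n (fun l => U (x :: l)).
  move=> hU; apply: (@rform_ext _
      (fun l => U (vpos j x :: l) - U (vpos j (- x) :: l))).
    move=> l nE; rewrite [in RHS](vpos_decomp hj x).
    by rewrite (lin1B (@mlin_head R^o _ _ l (proj1 hU) nE)).
  by apply: rform_sub; apply: pform_rform; apply: pform_cons => //;
    exact: vpos_ge0.
move=> [T1 [T2 [h1 h2 e]]].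
apply: rform_ext (rform_sub (H _ h1) (H _ h2)) => l nE.
by rewrite e//= nE.
Qed.

Lemma oform_cons n T x : le 0 x -> oform n.+1 T -> oform n (fun l => T (x :: l)).
Proof.
move=> x0 [hp ho]; split; first exact: pform_cons.
by move=> l1 y z l2 nE p1 p2 y0 z0 yz; rewrite -cat_cons ho//= addSn nE.
Qed.

Lemma oform_bil n T l1 l2 : oform n T -> (size l1 + size l2).+2 = n ->
  allpos l1 -> allpos l2 -> orthosym_bil j (fun x y => T (l1 ++ x :: y :: l2)).
Proof.
move=> [[h p] ho] nE p1 p2; split=> [y|x|x y x0 y0|x y x0 y0 xy].
- by apply: (@mlin_slot R^o n T l1 (y :: l2) h); rewrite /= addnS.
- have e w : l1 ++ x :: w :: l2 = rcons l1 x ++ w :: l2 by rewrite cat_rcons.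
  by move=> a u v; rewrite !e; apply: h; rewrite size_rcons addSn.
- apply: p; first by rewrite size_cat /= !addnS.
  by rewrite allpos_cat /=.
- exact: ho.
Qed.

(** With the other arguments positive, the pair sees an orthosymmetric bilinear form, which is
    symmetric. [mlin_pos_eq0] then frees the arguments before the pair, and afterwards those behind
    it. *)
Lemma oform_adjsym n T : oform n T -> adjsym n T.
Proof.
move=> hT l1 x y l2 nE; have [[h _] _] := hT.
apply/eqP; rewrite -subr_eq0; apply/eqP.
have step2 k1 k2 : size k1 = size l1 -> size k2 = size l2 -> allpos k2 ->
    T (k1 ++ x :: y :: k2) - T (k1 ++ y :: x :: k2) = 0.
  move=> n1 n2 p2; move: k1 n1.
  apply: (@mlin_pos_eq0 R^o _
    (fun k1 => T (k1 ++ x :: y :: k2) - T (k1 ++ y :: x :: k2))).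
    move=> m1 m2 a u v m; rewrite -!catA !cat_cons.
    rewrite !h; try by rewrite size_cat /= n2 -nE -m !addSn !addnS addnA.
    rewrite scalerBr opprD addrACA; congr (_ + _).
  by move=> k1 n1 p1; rewrite (orthosym_sym hj x y (oform_bil hT _ p1 p2)) ?n1 ?n2// subrr.
move: l2 nE step2 => l2 nE step2.
have := @mlin_pos_eq0 R^o (size l2)
    (fun k2 => T (l1 ++ x :: y :: k2) - T (l1 ++ y :: x :: k2)).
apply=> // [m1 m2 a u v m|k2 n2 p2]; last exact: step2.
have e z w (k : seq E) : l1 ++ z :: w :: m1 ++ k = (l1 ++ z :: w :: m1) ++ k.
  by rewrite -catA.
rewrite !e !h; try by rewrite size_cat /= -nE -m !addnS !addSn addnA.
by rewrite scalerBr opprD addrACA.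
Qed.

Lemma oform_perm n T l l' : oform n T -> size l = n -> perm_eq l l' -> T l = T l'.
Proof. by move=> /oform_adjsym; exact: adjsym_perm. Qed.

End ListForms.

(** * Extension of forms along an isomorphism of duals *)

Section Extension.
Variable R : realType.

(* Arens-type extension: each variable of [T] is moved from [E] to [F] through
   the map [s] of the duals, the last variable first. *)
Fixpoint dext (E F : normedModType R) (s : (E -> R) -> F -> R)
  (T : seq E -> R) (ys : seq F) : R :=
  if ys is y :: ys' then s (fun x => dext s (fun l => T (x :: l)) ys') y
  else T [::].

(* The same with the first variable moved first. *)
Fixpoint rdext (E F : normedModType R) (s : (E -> R) -> F -> R)
  (T : seq E -> R) (ys : seq F) : R :=
  if ys is y :: ys' then rdext s (fun l => s (fun x => T (x :: l)) y) ys'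
  else T [::].

Section Basic.
Variables (E F : normedModType R) (s : (E -> R) -> F -> R).

Lemma dext_eq T T' ys : (forall l, size l = size ys -> T l = T' l) ->
  dext s T ys = dext s T' ys.
Proof.
elim: ys T T' => [|y ys IH] T T' e /=; first exact: e.
congr (s _ y); apply/funext => x; apply: IH => l nE.
by apply: e; rewrite /= nE.
Qed.

Lemma rdext_eq T T' ys : (forall l, size l = size ys -> T l = T' l) ->
  rdext s T ys = rdext s T' ys.
Proof.
elim: ys T T' => [|y ys IH] T T' e /=; first exact: e.
apply: IH => l nE; congr (s _ y); apply/funext => x.
by apply: e; rewrite /= nE.
Qed.

Lemma dext_rcons T ys y : dext s T (rcons ys y) =
  dext s (fun l => s (fun x => T (rcons l x)) y) ys.
Proof.
elim: ys T => [//|z ys IH] T /=.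
by congr (s _ z); apply/funext => x; rewrite IH.
Qed.

Lemma rdextE T ys : rdext s T ys = dext s (fun l => T (rev l)) (rev ys).
Proof.
elim: ys T => [//|y ys IH] T /=.
rewrite IH rev_cons dext_rcons; apply: dext_eq => l _.
by congr (s _ y); apply/funext => x; rewrite rev_rcons.
Qed.

End Basic.

Variables (E F : completeNormedModType R).
Variables (jE : E -> E -> E) (jF : F -> F -> F).
Hypotheses (hE : banach_lattice_axioms jE) (hF : banach_lattice_axioms jF).
Variables (s : (E -> R) -> F -> R) (t : (F -> R) -> E -> R).

Section Map.
Hypothesis hs : dual_map jE jF s.

Lemma dext0 ys : dext s (fun _ => 0) ys = 0.
Proof.
elim: ys => [//|y ys IH] /=.
have -> : (fun _ : E => dext s (fun _ => 0) ys) = 0 by apply/funext => x; exact: IH.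
by rewrite (dm0 hs).
Qed.

(** Linearity at [n.+1] needs the slices to lie in the dual, where [s] is linear, and this rests on
    linearity and positivity at [n]; hence the joint induction. *)
Let comb_at n := forall T T' a ys, rform jE n T -> rform jE n T' ->
  size ys = n -> dext s (fun l => a * T l + T' l) ys = a * dext s T ys + dext s T' ys.
Let lin_at n := forall T, rform jE n T -> mlin n (dext s T : seq F -> R^o).
Let pos_at n := forall T ys, pform jE n T -> size ys = n -> allpos jF ys ->
  0 <= dext s T ys.
Let dual_at n := forall T ys, rform jE n.+1 T -> size ys = n ->
  dual_space (fun x => dext s (fun l => T (x :: l)) ys).

Let dual_step n : comb_at n -> lin_at n -> pos_at n -> dual_at n.
Proof.
move=> hC hL hP.
have lin T ys : rform jE n.+1 T -> size ys = n ->
    lin1 (fun x => dext s (fun l => T (x :: l)) ys : R^o).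
  move=> hT nE a x y.
  rewrite -[RHS]/(a * dext s _ ys + dext s _ ys) -hC//; try exact: (rform_cons hE).
  apply: dext_eq => l lE; rewrite nE in lE.
  by apply: (@mlin_head _ _ R^o _ _ l (rform_mlin hT)).
have pos T ys : pform jE n.+1 T -> size ys = n ->
    dual_space (fun x => dext s (fun l => T (x :: l)) ys).
  move=> hT.
  apply: (@mlin_pos_ext _ _ _ hF (E -> R^o) n
      (fun ys => (fun x => dext s (fun l => T (x :: l)) ys) : E -> R^o)
      [set f | dual_space f]) => [|f g /=|{}ys nE py /=].
  - move=> l1 l2 a u v nE; apply/funext => x; apply: hL => //.
    by apply: (rform_cons hE); exact: pform_rform.
  - exact: dualB.
  - apply: (pos_fun_dual hE) => [|x x0]; first by apply: lin => //; exact: pform_rform.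
    by apply: hP => //; exact: pform_cons.
move=> T ys hT nE; have [T1 [T2 [h1 h2 e]]] := hT.
suff -> : (fun x => dext s (fun l => T (x :: l)) ys) =
    (fun x => dext s (fun l => T1 (x :: l)) ys) -
    (fun x => dext s (fun l => T2 (x :: l)) ys).
  by apply: dualB; exact: pos.
apply/funext => x; rewrite -[RHS]/(_ ys - _ ys).
transitivity (dext s (fun l => (-1) * T2 (x :: l) + T1 (x :: l)) ys).
  by apply: dext_eq => l lE; rewrite e /= ?lE ?nE//; ring.
by rewrite hC ?mulN1r 1?addrC//; apply: (rform_cons hE); exact: pform_rform.
Qed.

Let comb_step n : comb_at n -> dual_at n -> comb_at n.+1.
Proof.
move=> hC hD T T' a [//|y ys] hT hT' [nE] /=.
have df := hD _ _ hT nE; have df' := hD _ _ hT' nE.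
transitivity (s ((a *: (fun x => dext s (fun l => T (x :: l)) ys : R^o)) +
    (fun x => dext s (fun l => T' (x :: l)) ys)) y).
  congr (s _ y); apply/funext => x.
  rewrite -[RHS]/(a * dext s (fun l => T (x :: l)) ys +
    dext s (fun l => T' (x :: l)) ys).
  by apply: hC => //; exact: (rform_cons hE).
by rewrite (dmD hs)//; [rewrite (dmZ hs)|exact: dualZ].
Qed.

Let lin_step n : lin_at n -> dual_at n -> lin_at n.+1.
Proof.
move=> hL hD T hT [|y l1] l2 a u v /= [nE].
  exact: (dual_lin1 (dm_dual hs (hD _ _ hT nE))).
have du : dual_space (fun x => dext s (fun l => T (x :: l)) (l1 ++ u :: l2)).
  by apply: hD => //; rewrite size_cat /= addnS.
have dv : dual_space (fun x => dext s (fun l => T (x :: l)) (l1 ++ v :: l2)).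
  by apply: hD => //; rewrite size_cat /= addnS.
transitivity (s ((a *: (fun x => dext s (fun l => T (x :: l)) (l1 ++ u :: l2) : R^o)) +
    (fun x => dext s (fun l => T (x :: l)) (l1 ++ v :: l2))) y).
  congr (s _ y); apply/funext => x.
  by apply: (hL (fun l => T (x :: l))) => //; exact: (rform_cons hE).
by rewrite (dmD hs)//; [rewrite (dmZ hs)|exact: dualZ].
Qed.

Let pos_step n : pos_at n -> dual_at n -> pos_at n.+1.
Proof.
move=> hP hD T [//|y ys] hT [nE] [y0 py] /=.
apply: (dm_ge0 hs (hD _ _ (pform_rform hT) nE)) y0 => x x0.
by apply: hP => //; exact: pform_cons.
Qed.

Let dext_main n : [/\ comb_at n, lin_at n & pos_at n].
Proof.
elim: n => [|n [hC hL hP]]; last first.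
  have hD := dual_step hC hL hP.
  by split; [exact: comb_step|exact: lin_step|exact: pos_step].
split=> [T T' a ys _ _ /size0nil -> //|T _ l1 l2 a u v //|T ys [_ p]].
by move=> /size0nil -> _; exact: p.
Qed.

Lemma dext_comb n T T' a ys : rform jE n T -> rform jE n T' ->
  size ys = n -> dext s (fun l => a * T l + T' l) ys = a * dext s T ys + dext s T' ys.
Proof. by have [h _ _] := dext_main n; exact: h. Qed.

Lemma dext_mlin n T : rform jE n T -> mlin n (dext s T : seq F -> R^o).
Proof. by have [_ h _] := dext_main n; exact: h. Qed.

Lemma dext_ge0 n T ys : pform jE n T -> size ys = n -> allpos jF ys ->
  0 <= dext s T ys.
Proof. by have [_ _ h] := dext_main n; exact: h. Qed.

Lemma dext_dual n T ys : rform jE n.+1 T -> size ys = n ->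
  dual_space (fun x => dext s (fun l => T (x :: l)) ys).
Proof. by have [hC hL hP] := dext_main n; exact: dual_step. Qed.

Lemma dext_pform n T : pform jE n T -> pform jF n (dext s T).
Proof.
move=> hT; split; first exact/dext_mlin/pform_rform.
by move=> ys nE py; exact: (dext_ge0 hT nE py).
Qed.

End Map.

Hypothesis hst : dual_iso jE jF s t.

(** In [dext] the outermost [s] acts on the first variable, and [rdext] applies [t] to that variable
    first, so the two cancel. *)
Lemma rdextK n T xs : rform jE n T -> size xs = n ->
  rdext t (dext s T) xs = T xs.
Proof.
elim: xs n T => [//|x xs IH] [//|n] T hT [nE] /=.
rewrite -(IH n (fun l => T (x :: l)))//; last exact: (rform_cons hE).
apply: rdext_eq => ys ysE.
rewrite -[in LHS]/(t (s (fun x => dext s (fun l => T (x :: l)) ys)) x).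
rewrite (di_can hst)//; apply: (dext_dual (di_map hst) hT).
by rewrite ysE.
Qed.

Hypothesis hoc : oc_dual_norm jE \/ oc_dual_norm jF.

(** Variables before the pair are stripped by induction. When the pair comes first, extending the
    variables behind it leaves an orthosymmetric bilinear form on [E], to which [perp_extension]
    applies. *)
Lemma dext_oform n T : oform jE n T -> oform jF n (dext s T).
Proof.
move=> hT; have hs := di_map hst; split; first by apply: dext_pform (proj1 hT).
move=> l1 u v l2; elim: l1 n T hT => [|y l1 IH] n T hT; last first.
  case: n hT => [//|n] hT [nE] /= [y0 p1] p2 u0 v0 uv.
  set g := (fun x => _); suff -> : g = 0 by rewrite (dm0 hs).
  have lg : lin1 (g : E -> R^o).
    apply: dual_lin1; apply: (dext_dual hs (pform_rform (proj1 hT))).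
    by rewrite size_cat /= !addnS.
  have g0 x : bl_le jE 0 x -> g x = 0.
    by move=> x0; apply: (IH n) => //; exact: oform_cons.
  apply/funext => x; rewrite (vpos_decomp hE x) (lin1B lg) !g0 ?subr0//;
    exact: vpos_ge0.
move=> nE _ p2 u0 v0 uv; move: hT; rewrite -nE add0n => hT.
pose B x z := dext s (fun l => T (x :: z :: l)) l2.
apply: (@perp_extension _ _ _ _ _ hE hF s t hst hoc v v0 B _ u u0 uv).
have [hp ho] := hT; have hr := pform_rform hp.
have hr1 x := rform_cons hE x hr; have hr2 x z := rform_cons hE z (hr1 x).
split.
- move=> z a x x'; rewrite /= -[RHS]/(a * B x z + B x' z).
  rewrite -(dext_comb hs a (hr2 x z) (hr2 x' z) erefl).
  apply: dext_eq => l lE.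
  by apply: (@mlin_head _ _ R^o _ _ (z :: l) (rform_mlin hr)); rewrite /= lE.
- move=> x a z z'; rewrite /= -[RHS]/(a * B x z + B x z').
  rewrite -(dext_comb hs a (hr2 x z) (hr2 x z') erefl).
  apply: dext_eq => l lE.
  by apply: (@mlin_head _ _ R^o _ _ l (rform_mlin (hr1 x))); rewrite /= lE.
- move=> x z x0 z0; apply: (dext_ge0 hs _ erefl p2).
  exact: (pform_cons z0 (pform_cons x0 hp)).
- move=> x z x0 z0 xz; rewrite -(dext0 hs l2); apply: dext_eq.
  apply: (@mlin_pos_eq0 _ _ _ hE R^o); first exact: rform_mlin (hr2 x z).
  by move=> l lE pl; apply: (ho [::]) => //=; rewrite lE.
Qed.

End Extension.

(** [rdextK] undoes the extension in the opposite order of variables. Both successive extensions are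
    invariant under permutations, so reversing the lists turns [rdext] into [dext]. *)
Lemma dextK (R : realType) (E F : completeNormedModType R)
  (jE : E -> E -> E) (jF : F -> F -> F)
  (s : (E -> R) -> F -> R) (t : (F -> R) -> E -> R) n T xs :
  banach_lattice_axioms jE -> banach_lattice_axioms jF ->
  dual_iso jE jF s t -> oc_dual_norm jE \/ oc_dual_norm jF ->
  oform jE n T -> size xs = n -> dext t (dext s T) xs = T xs.
Proof.
move=> hE hF hst hoc hT nE.
have hoc' : oc_dual_norm jF \/ oc_dual_norm jE by tauto.
have hU := dext_oform hE hF hst hoc hT.
have hV := dext_oform hF hE (dual_iso_sym hst) hoc' hU.
rewrite -(rdextK hE hF hst (pform_rform (proj1 hT)) nE) rdextE.
have pr (l : seq E) : perm_eq l (rev l) by rewrite perm_sym perm_rev.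
rewrite (oform_perm hE hV nE (pr xs)); apply: dext_eq => l lE.
apply: (oform_perm hF hU); last by rewrite perm_sym perm_rev.
by rewrite lE size_rev.
Qed.

(** * Polarization and orthogonal additivity *)

Section Polarization.
Variables (R : realType) (E : normedModType R).

(** The linear coefficient is the derivative of the diagonal at [x] in direction [z], which exposes
    one argument off the diagonal. *)
Lemma diag_polynomial n (T : seq E -> R) x z : mlin n (T : seq E -> R^o) ->
  adjsym n T -> exists p : {poly R},
    [/\ forall t, T (nseq n (x + t *: z)) = p.[t], p`_0 = T (nseq n x) &
        p`_1 = n%:R * T (z :: nseq n.-1 x)].
Proof.
elim: n T => [|n IH] T hT aT.
  by exists (T [::])%:P; split=> [t||]; rewrite ?hornerC ?coefC ?mul0r.
have [px [ex px0 px1]] := IH _ (mlin_cons x hT) (adjsym_cons x aT).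
have [pz [ez pz0 pz1]] := IH _ (mlin_cons z hT) (adjsym_cons z aT).
exists (px + 'X * pz); split=> [t||].
- rewrite hornerD hornerM hornerX -ex -ez [RHS]addrC.
  have h := @mlin_head _ _ R^o _ T _ hT (size_nseq n (x + t *: z)).
  by rewrite -[RHS](h t z x) /= [x + _]addrC.
- by rewrite coefD coefXM addr0 px0.
- rewrite coefD coefXM px1 pz0 /= -addn1 natrD mulrDl mul1r; congr (_ + _).
  case: n {IH px ex px0 px1 pz ez pz0 pz1} hT aT => [|n] hT aT /=.
    by rewrite !mul0r.
  by rewrite (aT [::])//= size_nseq.
Qed.

(** A polynomial with more roots than its size allows is zero; its linear coefficient then kills the
    diagonal of each slice, and induction applies to the slices. *)
Lemma diag_eq0 n (T : seq E -> R) : mlin n (T : seq E -> R^o) -> adjsym n T ->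
  (forall x, T (nseq n x) = 0) -> forall l, size l = n -> T l = 0.
Proof.
elim: n T => [|n IH] T hT aT d0 l; first by move/size0nil => ->; exact: d0 0.
case: l => [//|z l] [nE].
apply: (IH _ (mlin_cons z hT) (adjsym_cons z aT)) => // x.
have [p [ep _]] := diag_polynomial x z hT aT.
suff -> : p = 0.
  by rewrite coef0 => /esym/eqP; rewrite mulf_eq0 pnatr_eq0/= => /eqP.
apply/eqP; apply: contraT => p0.
have := @max_poly_roots _ p [seq i%:R | i <- iota 0 (size p)] p0.
rewrite size_map size_iota ltnn => -> //.
  by apply/allP => _ /mapP[i _ ->]; rewrite rootE -ep d0.
by rewrite map_inj_uniq ?iota_uniq//; exact: (mulrIn (oner_neq0 R)).
Qed.

End Polarization.

Section OrthogonalAdditivity.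
Variables (R : realType) (E : normedModType R) (j : E -> E -> E).
Hypothesis hj : banach_lattice_axioms j.
Local Notation le := (bl_le j).
Local Notation pform := (pform j).
Local Notation allpos := (allpos j).

Fixpoint all_le (l l' : seq E) : Prop :=
  match l, l' with
  | x :: l, x' :: l' => le x x' /\ all_le l l'
  | [::], [::] => True
  | _, _ => False
  end.

Lemma all_le_refl l : all_le l l.
Proof. by elim: l => //= x l IH; split=> //; exact: vle_refl. Qed.

Lemma all_le_cat l1 l2 k1 k2 : all_le l1 k1 -> all_le l2 k2 ->
  all_le (l1 ++ l2) (k1 ++ k2).
Proof. by elim: l1 k1 => [|x l1 IH] [|y k1] //= [xy h] h2; split=> //; exact: IH. Qed.

Lemma all_le_nseq n x y : le x y -> all_le (nseq n x) (nseq n y).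
Proof. by move=> xy; elim: n. Qed.

Lemma allpos_nseq n x : le 0 x -> allpos (nseq n x).
Proof. by move=> x0; elim: n. Qed.

Lemma pform_mono n T l l' : pform n T -> size l = n -> allpos l -> all_le l l' ->
  T l <= T l'.
Proof.
elim: l n T l' => [|x l IH] [|n] T [|x' l'] //= hT [nE] [x0 pl] [xx ll].
have x'0 := vle_trans hj x0 xx.
apply: (@le_trans _ _ (T (x' :: l))).
  rewrite -subr_ge0 -[_ - _](lin1B (@mlin_head _ _ R^o _ _ _ (proj1 hT) nE)).
  by apply: (proj2 hT) => /=; [rewrite nE|split=> //; exact/vsub_ge0].
by apply: (IH n (fun l => T (x' :: l))) => //; exact: pform_cons.
Qed.

(** Each of the [k] replacements costs at most [c] times the value of [T] with [e] in all slots. *)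
Lemma pform_replace k T (rs : seq E) a a' e (c : R) :
  pform (k + size rs) T -> 0 <= c ->
  le 0 a -> le a e -> le 0 a' -> le a' e -> le a (a' + c *: e) ->
  allpos rs -> all_le rs (nseq (size rs) e) ->
  T (nseq k a ++ rs) <=
  T (nseq k a' ++ rs) + k%:R * (c * T (nseq (k + size rs) e)).
Proof.
move=> + c0 a0 ae a'0 a'e aa pr re.
have e0 := vle_trans hj a0 ae.
elim: k T => [|k IH] T hT /=; first by rewrite mul0r addr0.
have sz x : size (nseq k x ++ rs) = (k + size rs)%N by rewrite size_cat size_nseq.
have pa : allpos (nseq k a ++ rs) by apply/allpos_cat; split=> //; exact: allpos_nseq.
have ale : all_le (nseq k a ++ rs) (nseq (k + size rs) e).
  by rewrite nseqD; apply: all_le_cat => //; exact: all_le_nseq.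
have h1 : T (a :: nseq k a ++ rs) <= T ((a' + c *: e) :: nseq k a ++ rs).
  by apply: (pform_mono hT) => //=; [rewrite sz|split=> //; exact: all_le_refl].
have h2 : T ((a' + c *: e) :: nseq k a ++ rs) =
    T (a' :: nseq k a ++ rs) + c * T (e :: nseq k a ++ rs).
  by rewrite (lin1D (@mlin_head _ _ R^o _ _ _ (proj1 hT) (sz a)))
    (lin1Z (@mlin_head _ _ R^o _ _ _ (proj1 hT) (sz a))).
have h3 : T (e :: nseq k a ++ rs) <= T (e :: nseq (k + size rs) e).
  by apply: (pform_mono hT) => //=; [rewrite sz|split=> //; exact: vle_refl].
have h4 := IH _ (pform_cons a'0 hT).
have h5 : T (a' :: nseq (k + size rs) e) <= T (e :: nseq (k + size rs) e).
  apply: (pform_mono hT) => //=; first by rewrite size_nseq.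
    by split=> //; exact: allpos_nseq.
  by split=> //; exact: all_le_refl.
have h3' := ler_wpM2l c0 h3; have h5' := ler_wpM2l (ler0n R k) (ler_wpM2l c0 h5).
rewrite -addn1 natrD mulrDl mul1r.
apply: le_trans h1 _; rewrite h2; move: h3' h4 h5'.
move: (c * T (e :: _ ++ _)) (c * T (e :: nseq _ _)) (k%:R * _) (k%:R * (c * T (e :: _))).
by move=> q1 q2 q3 q4; lra.
Qed.

(** What diagonal additivity gives at once: two disjoint elements fill all the slots. [oform] asks
    for arbitrary positive elements in the other slots. *)
Definition mixed_null (n : nat) (T : seq E -> R) : Prop :=
  forall k l a b, (k.+1 + l.+1)%N = n -> le 0 a -> le 0 b -> perp j a b ->
    T (nseq k.+1 a ++ nseq l.+1 b) = 0.

(** Two terms of the multilinear expansion are kept; the others are positive. *)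
Lemma pform_diag_ge k l T a b : pform (k + l.+1) T -> le 0 a -> le 0 b ->
  T (nseq (k + l.+1) a) + T (nseq k a ++ nseq l.+1 b) <=
  T (nseq (k + l.+1) (a + b)).
Proof.
move=> + a0 b0; have ab0 : le 0 (a + b) by exact: vaddr_ge0.
have aab : le a (a + b) by exact: vleDl.
have bab : le b (a + b) by exact: vleDr.
elim: k T => [|k IH] T hT /=.
  rewrite (lin1D (@mlin_head _ _ R^o _ _ _ (proj1 hT) (size_nseq _ _))).
  by apply: lerD; apply: (pform_mono hT) => /=; rewrite ?size_nseq//;
    split=> //; solve [exact: allpos_nseq|exact: vle_refl|exact: all_le_nseq].
apply: le_trans (IH _ (pform_cons a0 hT)) _.
apply: (pform_mono hT) => /=; rewrite ?size_nseq//.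
  by split=> //; exact: allpos_nseq.
by split=> //; exact: all_le_refl.
Qed.

(** The pure terms already exhaust the value at [a + b], so a positive mixed term has no room. *)
Lemma additive_mixed_null n T : pform n T ->
  (forall a b, le 0 a -> le 0 b -> perp j a b ->
    T (nseq n (a + b)) = T (nseq n a) + T (nseq n b)) -> mixed_null n T.
Proof.
move=> hT hadd k l a b nE a0 b0 ab; rewrite -nE in hT hadd.
apply/eqP; rewrite eq_le; apply/andP; split; last first.
  apply: (proj2 hT); first by rewrite size_cat !size_nseq.
  by apply/allpos_cat; split; exact: allpos_nseq.
have := hadd _ _ a0 b0 ab; rewrite addSn /=.
rewrite (lin1D (@mlin_head _ _ R^o _ _ _ (proj1 hT) (size_nseq _ _))).
have h1 := pform_diag_ge (pform_cons a0 hT) a0 b0.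
have h2 : T (b :: nseq (k + l.+1) b) <= T (b :: nseq (k + l.+1) (a + b)).
  apply: (pform_mono hT) => /=; rewrite ?size_nseq//.
    by split=> //; exact: allpos_nseq.
  by split; [exact: vle_refl|apply: all_le_nseq; exact: vleDr].
move=> h3; rewrite -[_ + T _ in LHS]/(T _ + T _ : R) in h3.
move: h1 h2 h3 => /=; lra.
Qed.

(** Cut [z] at [m a]. The lower part is absorbed by the slots holding [a]. The upper part [w] is
    disjoint from [a' = (a - z / m)^+], and trading [a] for [a'] costs [O(1 / m)]; then [a'] is
    disjoint from [b + w], which can fill the remaining slots. *)
Lemma mixed_null_cons n T z : pform n.+1 T -> adjsym n.+1 T ->
  mixed_null n.+1 T -> le 0 z -> mixed_null n (fun l => T (z :: l)).
Proof.
move=> hT aT oT z0 k l a b nE a0 b0 ab.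
pose K := k.+1; pose L := l.+1; rewrite -/K -/L in nE *.
have szab (u v : E) : size (nseq K u ++ nseq L v) = n by rewrite size_cat !size_nseq.
have pab u v : le 0 u -> le 0 v -> allpos (nseq K u ++ nseq L v).
  by move=> u0 v0; apply/allpos_cat; split; exact: allpos_nseq.
apply/eqP; rewrite eq_le; apply/andP; split; last first.
  by apply: (proj2 hT); [exact: (congr1 S (szab _ _))|split=> //; exact: pab].
set e := a + b + z.
have ae : le a e by rewrite /e -addrA; apply: vleDl => //; exact: vaddr_ge0.
have be : le b e by rewrite /e -addrA addrCA; apply: vleDl => //; exact: vaddr_ge0.
have ze : le z e by apply: vleDr => //; exact: vaddr_ge0.
have e0 := vle_trans hj a0 ae.
apply: (@le0_archi R _ (K%:R * T (e :: nseq n e))) => i.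
set m : R := i.+1%:R; have m0 : 0 < m by rewrite ltr0n.
have mi0 : 0 <= m^-1 by rewrite invr_ge0 ltW.
set w := vpos j (z - m *: a); set a' := vpos j (a - m^-1 *: z).
have w0 : le 0 w by exact: vpos_ge0.
have a'0 : le 0 a' by exact: vpos_ge0.
have miz : le 0 (m^-1 *: z) by exact: vscale_ge0.
have a'a : le a' a by apply: vpos_le => //; exact: vle_subl.
have wz : le w z.
  by apply: vpos_le => //; apply: vle_subl => //; apply: vscale_ge0 => //; exact: ltW.
have h1 : T (vmeet j z (m *: a) :: nseq K a ++ nseq L b) <= 0.
  apply: (@le_trans _ _ (T (m *: a :: nseq K a ++ nseq L b))).
    apply: (pform_mono hT); first exact: (congr1 S (szab _ _)).
      by split; [apply: vmeet_ge0 => //; apply: vscale_ge0 => //; exact: ltW|exact: pab].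
    by split; [exact: vmeet_ler|exact: all_le_refl].
  rewrite (lin1Z (@mlin_head _ _ R^o _ _ _ (proj1 hT) (szab a b))).
  rewrite (oT K l a b)//; first by rewrite -[leLHS]/(m * 0) mulr0.
  by rewrite -nE addSn.
have h2 : T (w :: nseq K a ++ nseq L b) <= T (w :: nseq K a' ++ nseq L b) +
    K%:R * (m^-1 * T (w :: nseq n e)).
  have := @pform_replace K (fun l => T (w :: l)) (nseq L b) a a' e m^-1.
  rewrite size_nseq nE; apply=> //; first exact: pform_cons.
  - exact: (vle_trans hj a'a ae).
  - apply: (vle_trans hj (y := a' + m^-1 *: z)).
      by apply/(vleBl hj); exact: vle_pos.
    by apply/(vleD2l hj); exact: (bl_le_scale hj).
  - exact: allpos_nseq.
  - exact: all_le_nseq.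
have bw0 : le 0 (b + w) by exact: vaddr_ge0.
have h3 : T (w :: nseq K a' ++ nseq L b) <= 0.
  apply: (@le_trans _ _ (T ((b + w) :: nseq K a' ++ nseq L (b + w)))).
    apply: (pform_mono hT); first exact: (congr1 S (szab _ _)).
      by split=> //; exact: pab.
    split; first exact: vleDr.
    by apply: (all_le_cat (all_le_refl (nseq K a'))); apply: all_le_nseq; exact: vleDl.
  rewrite (adjsym_perm aT (l' := nseq K a' ++ nseq L.+1 (b + w))).
  - rewrite (oT k L)//; first by rewrite -nE -addnS.
    apply: perpDr => //; first by apply: perp_mono ab => //; exact: vle_refl.
    exact: perp_cut.
  - exact: (congr1 S (szab _ _)).
  - by rewrite -[_ :: _]cat1s perm_catCA.
have h4 : T (w :: nseq n e) <= T (e :: nseq n e).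
  apply: (pform_mono hT) => /=; first by rewrite size_nseq.
    by split=> //; exact: allpos_nseq.
  by split; [exact: (vle_trans hj wz ze)|exact: all_le_refl].
have h4' := ler_wpM2l (ler0n R K) (ler_wpM2l mi0 h4).
rewrite {1}(vmeet_split j z (m *: a)).
rewrite (lin1D (@mlin_head _ _ R^o _ _ _ (proj1 hT) (szab a b))) -/w.
rewrite mulrCA; rewrite -[leLHS]/(T _ + T _ : R).
apply: le_trans (lerD h1 (le_trans h2 (lerD h3 h4'))) _.
by rewrite !add0r.
Qed.

Lemma mixed_null_oform n T : pform n T -> adjsym n T -> mixed_null n T ->
  oform j n T.
Proof.
move=> hT aT oT; split=> // l1 x y l2.
elim: n T l1 l2 hT aT oT => [//|n IH] T l1 l2 hT aT oT nE p1 p2 x0 y0 xy.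
have st z : le 0 z -> forall k1 k2, (size k1 + size k2).+2 = n -> allpos k1 ->
    allpos k2 -> T (z :: k1 ++ x :: y :: k2) = 0.
  move=> z0 k1 k2 nk q1 q2; apply: (IH (fun l => T (z :: l))) => //.
  - exact: pform_cons.
  - exact: adjsym_cons.
  - exact: mixed_null_cons.
case: l1 nE p1 => [|z l1] nE p1.
  case: l2 nE p2 => [|z l2] nE p2.
    by case: nE => nE; apply: (oT 0%N 0%N) => //; rewrite -nE.
  have [z0 p2'] := p2; rewrite -(@st z z0 [::] l2)//=; last by case: nE => <-.
  apply: (adjsym_perm aT); first by rewrite -nE.
  by rewrite -[[:: x, y, z & l2]]/([:: x; y] ++ [:: z] ++ l2) perm_catCA.
have [z0 p1'] := p1; apply: st => //; by case: nE => <-.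
Qed.

Lemma oform_disjoint n T x y l : oform j n T -> (size l).+2 = n ->
  bl_disjoint j x y -> T (x :: y :: l) = 0.
Proof.
move=> [[hT pT] oT] nE /(disjoint_parts hj)[p1 p2 p3 p4].
subst n; have H u v : le 0 u -> le 0 v -> perp j u v -> T (u :: v :: l) = 0.
  move=> u0 v0 uv.
  apply: (@mlin_pos_eq0 _ _ _ hj R^o (size l) (fun l => T (u :: v :: l))) => //.
    exact: (@mlin_cons _ _ R^o _ (fun l => T (u :: l)) v (mlin_cons u hT)).
  by move=> k kE pk; apply: (oT [::]) => //=; rewrite kE.
have l1 v : lin1 (fun x => T (x :: v :: l) : R^o).
  exact: (@mlin_head _ _ R^o _ _ (v :: l) hT).
have l2 u : lin1 (fun y => T (u :: y :: l) : R^o).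
  exact: (@mlin_head _ _ R^o _ _ l (mlin_cons u hT)).
have px := vpos_ge0 hj x; have nx := vpos_ge0 hj (- x).
have py := vpos_ge0 hj y; have ny := vpos_ge0 hj (- y).
rewrite (vpos_decomp hj x) (lin1B (l1 _)) (vpos_decomp hj y) !(lin1B (l2 _)).
by rewrite !H// !subr0.
Qed.

Lemma diag_absorb m T x y : mlin m.+1 (T : seq E -> R^o) -> adjsym m.+1 T ->
  (forall l, (size l).+2 = m.+1 -> T (x :: y :: l) = 0) ->
  T (x :: nseq m (x + y)) = T (x :: nseq m x).
Proof.
elim: m T => [//|m IH] T hT aT oT.
rewrite [nseq m.+1 (x + y)]/= (lin1D (@mlin_head _ _ R^o _ _ _ (mlin_cons x hT) (size_nseq _ _))).
rewrite oT ?size_nseq// addr0.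
apply: (IH (fun l => T (x :: l))); [exact: mlin_cons|exact: adjsym_cons|].
move=> l nE; transitivity (T (x :: y :: x :: l)).
  by apply: (aT [:: x] x y l); rewrite -nE.
by apply: oT; rewrite /= nE.
Qed.

Lemma oform_diagD n T x y : oform j n.+1 T -> bl_disjoint j x y ->
  T (nseq n.+1 (x + y)) = T (nseq n.+1 x) + T (nseq n.+1 y).
Proof.
move=> hT xy; have aT := oform_adjsym hj hT; have hl := proj1 (proj1 hT).
rewrite /= (lin1D (@mlin_head _ _ R^o _ _ _ hl (size_nseq _ _))).
have yx : bl_disjoint j y x.
  by move: xy; rewrite /bl_disjoint /bl_meet (bl_joinC hj).
rewrite (diag_absorb hl aT); last by move=> l nE; exact: (oform_disjoint hT nE xy).
rewrite [x + y]addrC (diag_absorb hl aT)//.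
by move=> l nE; exact: (oform_disjoint hT nE yx).
Qed.

End OrthogonalAdditivity.

(** * Forms with values in a dual *)

Section GForms.
Variables (R : realType) (E G : completeNormedModType R).
Variables (jE : E -> E -> E) (jG : G -> G -> G).
Hypotheses (hE : banach_lattice_axioms jE) (hG : banach_lattice_axioms jG).

Record gform (n : nat) (H : seq E -> G -> R) : Prop := {
  gf_mlin : mlin n (H : seq E -> (G -> R^o));
  gf_lin : forall l, size l = n -> lin1 (H l : G -> R^o);
  gf_ge0 : forall l g, size l = n -> allpos jE l -> bl_le jG 0 g -> 0 <= H l g }.

Lemma gform_dual n H l : gform n H -> size l = n -> dual_space (H l).
Proof.
case=> hm hl hp; move: l.
apply: (@mlin_pos_ext _ _ _ hE (G -> R^o) n H (@dual_space R G)) => //.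
  by move=> f g; exact: dualB.
move=> l nE pl; apply: (pos_fun_dual hG) => [|g g0]; first exact: hl.
exact: hp.
Qed.

Lemma gform_comb n H H' (a : R) : 0 <= a -> gform n H -> gform n H' ->
  gform n (fun l g => a * H l g + H' l g).
Proof.
move=> a0 [hm hl hp] [hm' hl' hp']; split.
- exact: (@mlin_comb _ _ (G -> R^o) _ _ _ a hm hm').
- move=> l nE b u v; rewrite hl// hl'//.
  rewrite -[LHS]/(a * (b * H l u + H l v) + (b * H' l u + H' l v)).
  by rewrite -[RHS]/(b * (a * H l u + H' l u) + (a * H l v + H' l v)); ring.
- by move=> l g nE pl g0; rewrite addr_ge0 ?mulr_ge0 ?hp ?hp'.
Qed.

Lemma gform_ext n H H' : (forall l, size l = n -> H l = H' l) -> gform n H ->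
  gform n H'.
Proof.
move=> e [hm hl hp]; split.
- move=> l1 l2 a u v nE.
  have sz w : size (l1 ++ w :: l2) = n by rewrite size_cat /= addnS.
  by rewrite -!e ?sz// hm.
- by move=> l nE; rewrite -e//; exact: hl.
- by move=> l g nE; rewrite -e//; exact: hp.
Qed.

Lemma form_diag_inj n (H H' : seq E -> G -> R) :
  mlin n (H : seq E -> (G -> R^o)) -> mlin n (H' : seq E -> (G -> R^o)) ->
  adjsym n H -> adjsym n H' -> (forall x, H (nseq n x) = H' (nseq n x)) ->
  forall l, size l = n -> H l = H' l.
Proof.
move=> hm hm' aH aH' d l nE; apply/funext => g.
apply/eqP; rewrite -subr_eq0; apply/eqP.
apply: (@diag_eq0 _ _ n (fun l => H l g - H' l g)) => //.
- move=> l1 l2 a u v lE; rewrite hm// hm'//.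
  rewrite -[LHS]/(a * _ + _ - (a * _ + _)) -[RHS]/(a * (_ - _) + (_ - _)); ring.
- by move=> l1 x y l2 lE; rewrite aH// aH'.
- by move=> x; rewrite d subrr.
Qed.

Lemma nth_upd n (l1 l2 : seq E) w (i : 'I_n) : size l1 = i ->
  (fun k : 'I_n => nth 0 (l1 ++ w :: l2) k) =
  upd (fun k : 'I_n => nth 0 (l1 ++ 0 :: l2) k) i w.
Proof.
move=> iE; apply/funext => k; rewrite /upd !nth_cat iE.
have [->|ki] := eqVneq k i; first by rewrite ltnn subnn.
case: ltnP => // ik; suff: (0 < k - i)%N by case: (k - i)%N.
by rewrite subn_gt0 ltn_neqAle ik andbT eq_sym.
Qed.

Lemma pos_poly_form n P : pos_poly n jE jG P -> exists H,
  [/\ gform n H, adjsym n H & forall x, P x = H (nseq n x)].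
Proof.
move=> [T [mT sT dT PT pT]].
exists (fun l => T (fun i : 'I_n => nth 0 l i)); split.
- split=> [l1 l2 a u v nE|l _|l g nE pl g0].
  + have i1 : (size l1 < n)%N by rewrite -nE ltnS leq_addr.
    have e w := @nth_upd n l1 l2 w (Ordinal i1) erefl.
    by rewrite (e (a *: u + v)) (e u) (e v); exact: mT.
  + exact: dual_lin1.
  + apply: (pT _ _ g g0) => i.
    have := ltn_ord i; rewrite -[X in (_ < X)%N]nE; move: (nat_of_ord i) => {}i.
    elim: l i pl {nE} => [//|x l IH] [|i] [x0 pl] //= il; exact: IH.
- move=> l1 x y l2 nE.
  have i0 : (size l1 < n)%N by rewrite -nE !ltnS leqW// leq_addr.
  have i1 : ((size l1).+1 < n)%N by rewrite -nE !ltnS leq_addr.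
  rewrite -[RHS](sT (tperm (Ordinal i0) (Ordinal i1))); congr T.
  apply/funext => i /=; rewrite !nth_cat.
  case: tpermP => [->|->|/eqP ii0 /eqP ii1] /=.
  + by rewrite ltnn ltnNge leqnSn subnn subSnn.
  + by rewrite ltnn ltnNge leqnSn subnn subSnn.
  + case: ltnP => // il; suff: (1 < i - size l1)%N by case: (i - _)%N => [|[|]].
    move: ii0 ii1; rewrite -!val_eqE /= => ii0 ii1.
    by rewrite ltn_subRL addn1 ltn_neqAle eq_sym ii1 ltn_neqAle eq_sym ii0.
- move=> x; rewrite PT; congr T; apply/funext => i.
  by rewrite nth_nseq ltn_ord.
Qed.

Lemma form_pos_poly n H : gform n H -> adjsym n H ->
  pos_poly n jE jG (fun x => H (nseq n x)).
Proof.
move=> hH aH; have [hm hl hp] := hH.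
have sz (xs : 'I_n -> E) : size [seq xs i | i <- enum 'I_n] = n.
  by rewrite size_map size_enum_ord.
exists (fun xs : 'I_n -> E => H [seq xs i | i <- enum 'I_n]); split.
- move=> i xs a u v.
  have [p1 [p2 e]] : exists p1 p2, enum 'I_n = p1 ++ i :: p2.
    by have := mem_enum 'I_n i; case/splitPr => p1 p2; exists p1, p2.
  have := enum_uniq 'I_n; rewrite e cat_uniq /= negb_or => /and3P[_ /andP[i1 _] /andP[i2 _]].
  have me w : [seq upd xs i w k | k <- p1 ++ i :: p2] = map xs p1 ++ w :: map xs p2.
    rewrite map_cat /= {2}/upd eqxx; congr (_ ++ _ :: _); apply/eq_in_map => k kp;
      rewrite /upd; case: eqP => // ki; by rewrite ki ?(negPf i1) ?(negPf i2) in kp.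
  rewrite !me hm// !size_map.
  by have := size_enum_ord n; rewrite e size_cat /= addnS.
- move=> s xs; have a2 := adjsym_perm aH (sz _); apply: a2.
  rewrite (map_comp xs s); apply: (@perm_map _ _ xs); apply: uniq_perm.
  + by rewrite map_inj_uniq ?enum_uniq//; exact: perm_inj.
  + exact: enum_uniq.
  + move=> i; rewrite mem_enum; apply/mapP; exists ((s^-1)%g i).
      by rewrite mem_enum.
    by rewrite permKV.
- by move=> xs; apply: gform_dual hH _.
- move=> x; congr H; rewrite -[in LHS](size_enum_ord n).
  by elim: (enum _) => //= i l ->.
- move=> xs xs0 g g0; apply: hp => //.
  by elim: (enum _) => //= i l IH; split.
Qed.

(** Orthosymmetry is asked at each positive [g], because evaluation at such [g] preserves
    positivity. *)
Definition pof (n : nat) (H : seq E -> G -> R) : Prop :=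
  gform n H /\ forall g, bl_le jG 0 g -> oform jE n (H^~ g).

Lemma pof_intro n H : (forall g, bl_le jG 0 g -> oform jE n (H^~ g)) ->
  (forall l, size l = n -> lin1 (H l : G -> R^o)) -> pof n H.
Proof.
move=> ho hl; split=> //; split=> //; last first.
  by move=> l g nE pl g0; have [[_ p] _] := ho g g0; exact: p.
move=> l1 l2 a u v nE; apply/funext => g.
have sz w : size (l1 ++ w :: l2) = n by rewrite size_cat /= addnS.
have [[hp _] _] := ho _ (vpos_ge0 hG g).
have [[hn _] _] := ho _ (vpos_ge0 hG (- g)).
rewrite -[RHS]/(a * H (l1 ++ u :: l2) g + H (l1 ++ v :: l2) g).
rewrite (vpos_decomp hG g) !(lin1B (hl _ (sz _))) hp// hn//.
rewrite -[LHS]/(a * _ + _ - (a * _ + _)) -[RHS]/(a * (_ - _) + (_ - _)); ring.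
Qed.

Lemma pof_adjsym n H : pof n H -> adjsym n H.
Proof.
move=> [[_ hl _] ho] l1 x y l2 nE; apply/funext => g.
have sz u v : size (l1 ++ u :: v :: l2) = n by rewrite size_cat /= !addnS.
rewrite (vpos_decomp hG g) !(lin1B (hl _ (sz _ _))).
by congr (_ - _); exact: (oform_adjsym hE (ho _ (vpos_ge0 hG _))).
Qed.

(** A positive form squeezed under one that vanishes on disjoint pairs vanishes there too. *)
Lemma pof_dominated n H H' : gform n H -> pof n H' ->
  (forall l g, size l = n -> allpos jE l -> bl_le jG 0 g -> H l g <= H' l g) ->
  pof n H.
Proof.
move=> [hm hl hp] [_ ho] le_; apply: pof_intro => // g g0; split.
  by split=> [l1 l2 a u v nE|l nE pl]; [rewrite hm|exact: hp].
move=> l1 x y l2 nE p1 p2 x0 y0 xy.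
have sz : size (l1 ++ x :: y :: l2) = n by rewrite size_cat /= !addnS.
have pos : allpos jE (l1 ++ x :: y :: l2) by apply/allpos_cat.
apply/eqP; rewrite eq_le hp// andbT.
rewrite -((ho g g0).2 l1 x y l2 nE p1 p2 x0 y0 xy); exact: le_.
Qed.

Lemma pof_comb n H H' (a : R) : 0 <= a -> pof n H -> pof n H' ->
  pof n (fun l g => a * H l g + H' l g).
Proof.
move=> a0 [h1 h2] [h1' h2']; have hc := gform_comb a0 h1 h1'.
split=> // g g0; have [hp ho] := h2 g g0; have [hp' ho'] := h2' g g0.
split; first exact: pform_comb.
by move=> l1 x y l2 nE p1 p2 x0 y0 xy; rewrite ho// ho'// mulr0 addr0.
Qed.

Lemma pof_add n H H' : pof n H -> pof n H' -> pof n (fun l g => H l g + H' l g).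
Proof.
move=> h h'; have := pof_comb ler01 h h'.
suff -> : (fun l g => 1 * H l g + H' l g) = (fun l g => H l g + H' l g) by [].
by apply/funext => l; apply/funext => g; rewrite mul1r.
Qed.

Lemma pof0 n : pof n (fun _ _ => 0).
Proof.
apply: pof_intro => [g g0|l _ a u v]; last by rewrite scaler0 addr0.
by split=> //; split=> // l1 l2 a u v _; rewrite scaler0 addr0.
Qed.

(* The cone of positive orthogonally additive polynomials. *)
Definition opoly (n : nat) (P : E -> G -> R) : Prop :=
  exists H, pof n H /\ forall x, P x = H (nseq n x).

Lemma opoly_pos n P : opoly n P -> pos_poly n jE jG P.
Proof.
move=> [H [hH e]]; have -> : P = fun x => H (nseq n x) by apply/funext.
by apply: form_pos_poly; [exact: (proj1 hH)|exact: pof_adjsym].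
Qed.

Lemma opoly_orth n P : (0 < n)%N -> opoly n P -> orth_additive jE P.
Proof.
(* A nonzero constant, the case of degree 0, is not additive although its form is vacuously
   orthosymmetric. *)
case: n => // n _ [H [[[_ hl _] ho] e]] x y xy; apply/funext => g.
rewrite !e -[RHS]/(H (nseq n.+1 x) g + H (nseq n.+1 y) g).
have sz (z : E) : size (nseq n.+1 z) = n.+1 by rewrite size_nseq.
rewrite (vpos_decomp hG g) !(lin1B (hl _ (sz _))).
rewrite (oform_diagD hE (ho _ (vpos_ge0 hG g)) xy).
rewrite (oform_diagD hE (ho _ (vpos_ge0 hG (- g))) xy).
by rewrite -[LHS]/(_ + _ - (_ + _)) -[RHS]/(_ - _ + (_ - _)); ring.
Qed.

Lemma orth_pof n H : gform n H -> adjsym n H ->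
  orth_additive jE (fun x => H (nseq n x)) -> pof n H.
Proof.
move=> hH aH oH; split=> // g g0; have [hm hl hp] := hH.
have hf : pform jE n (H^~ g).
  by split=> [l1 l2 a u v nE|l nE pl]; [rewrite hm|exact: hp].
have ag : adjsym n (H^~ g) by move=> l1 x y l2 nE; rewrite aH.
apply: (mixed_null_oform hE) => //; apply: (additive_mixed_null hE) => //.
move=> a b a0 b0 ab; rewrite oH//; exact: perp_disjoint.
Qed.

End GForms.

(** * The modulus *)

Section ConeImage.
Variables (R : realType) (Y1 Y2 : lmodType R) (K : set Y1) (phi : Y1 -> Y2).
Hypotheses (cK : pointed_cone K) (phi_inj : injective phi).
Hypotheses (phiD : forall x y, phi (x + y) = phi x + phi y).
Hypothesis phiZ : forall (a : R) x, phi (a *: x) = a *: phi x.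

Let phiN x : phi (- x) = - phi x.
Proof. by rewrite -scaleN1r phiZ scaleN1r. Qed.

Lemma image_pointed_cone : pointed_cone (phi @` K).
Proof.
split.
- by exists 0; [exact: pcone0|rewrite -(scale0r (0 : Y1)) phiZ scale0r].
- move=> _ _ [x Kx <-] [y Ky <-]; exists (x + y) => //; exact: (pconeD cK).
- by move=> a _ a0 [x Kx <-]; exists (a *: x) => //; exact: (pconeZ cK).
- move=> _ [x Kx <-] [y Ky yE]; have e : y = - x by apply: phi_inj; rewrite phiN.
  rewrite (pcone_anti cK Kx); first by rewrite -(scale0r (0 : Y1)) phiZ scale0r.
  by rewrite -e.
Qed.

(** Members of a set bounded above differ by elements of the range of [phi], so after translation by
    [a0] the set can be pulled back. *)
Lemma image_cone_complete : cone_complete K -> cone_complete (phi @` K).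
Proof.
move=> dK A [a0 Aa0] [b ub].
have [||s [us ls]] := dK [set y | A (phi y + a0)].
- by exists 0 => /=; rewrite -(scale0r (0 : Y1)) phiZ scale0r add0r.
- have [k Kk kE] := ub _ Aa0; exists k => y /= Ay.
  have [k' Kk' k'E] := ub _ Ay; suff -> : k - y = k' by [].
  by apply: phi_inj; rewrite phiD phiN kE k'E opprD addrA addrAC.
exists (phi s + a0); split=> [a Aa|c uc].
  have [k Kk kE] := ub _ Aa0; have [k' Kk' k'E] := ub _ Aa.
  have aE : a = phi (k - k') + a0.
    by rewrite phiD phiN kE k'E opprB [X in X + a0]addrC addrA !subrK.
  exists (s - (k - k')); first by apply: us; rewrite /= -aE.
  by rewrite phiD phiN aE opprD addrACA subrr addr0.
have [k Kk kE] := uc _ Aa0; exists (k - s); last first.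
  by rewrite phiD phiN kE opprD addrA addrAC.
apply: ls => y /= Ay; have [k' Kk' k'E] := uc _ Ay.
suff -> : k - y = k' by [].
by apply: phi_inj; rewrite phiD phiN kE k'E opprD addrA addrAC.
Qed.

End ConeImage.

Section Modulus.
Variables (R : realType) (E G : completeNormedModType R).
Variables (jE : E -> E -> E) (jG : G -> G -> G).
Hypotheses (hE : banach_lattice_axioms jE) (hG : banach_lattice_axioms jG).
Local Notation Y := (seq E -> (G -> R^o)).

(** One module [Y] hosts forms of every degree, so that the recursion defining [form_cone] keeps a
    fixed type. *)
Let emb0 (f : G -> R^o) : Y := fun l => if l is [::] then f else 0.
Let embS (f : E -> Y) : Y := fun l => if l is x :: l' then f x l' else 0.

(* Positive [n]-linear forms, curried one variable at a time so that
   Riesz-Kantorovich applies to each; values at lists of other lengths are [0]. *)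
Fixpoint form_cone (n : nat) : set Y :=
  if n is m.+1 then embS @` pos_maps jE (form_cone m)
  else emb0 @` pos_maps jG [set r : R^o | 0 <= r].

Let emb0_inj : injective emb0.
Proof. by move=> f g /(congr1 (fun h => h [::])). Qed.

Let embS_inj : injective embS.
Proof.
move=> f g e; apply/funext => x; apply/funext => l.
by have /(congr1 (fun h => h (x :: l))) := e.
Qed.

Let emb0D x y : emb0 (x + y) = emb0 x + emb0 y.
Proof. by apply/funext => -[|z l] //=; rewrite fctE /= addr0. Qed.

Let emb0Z (a : R) x : emb0 (a *: x) = a *: emb0 x.
Proof. by apply/funext => -[|z l] //=; rewrite fctE /= scaler0. Qed.

Let embSD x y : embS (x + y) = embS x + embS y.
Proof. by apply/funext => -[|z l] //=; rewrite fctE /= addr0. Qed.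

Let embSZ (a : R) x : embS (a *: x) = a *: embS x.
Proof. by apply/funext => -[|z l] //=; rewrite fctE /= scaler0. Qed.

Lemma form_cone_pointed n : pointed_cone (form_cone n).
Proof.
elim: n => [|n IH] /=; apply: image_pointed_cone => //;
  apply: pos_maps_cone => //; exact: real_cone.
Qed.

Lemma form_cone_complete n : cone_complete (form_cone n).
Proof.
elim: n => [|n IH] /=; apply: image_cone_complete => //.
  by apply: pos_maps_complete => //; [exact: real_cone|exact: real_cone_complete].
by apply: pos_maps_complete => //; exact: form_cone_pointed.
Qed.

Lemma form_cone_gform n H : form_cone n H -> gform jE jG n H.
Proof.
elim: n H => [|n IH] _ [f [lf pf] <-].
  by split=> [//|l /size0nil ->//|l g /size0nil -> _ g0 /=]; exact: pf.
have dec x : f x = f (vpos jE x) - f (vpos jE (- x)).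
  by rewrite {1}(vpos_decomp hE x) (lin1B lf).
have hp x := IH _ (pf _ (vpos_ge0 hE x)).
split=> [[|x l1] l2 a u v nE|[//|x l] [nE]|[//|x l] g [nE] [x0 pl] g0] /=.
- by rewrite lf.
- have nE' : (size l1 + size l2).+1 = n by case: nE.
  rewrite dec -[LHS]/(f _ _ - f _ _) (gf_mlin (hp _))// (gf_mlin (hp _))//.
  by rewrite opprD addrACA scalerBr.
- rewrite dec; apply: lin1_sub; exact: gf_lin (hp _) _ nE.
- by apply: (gf_ge0 (IH _ (pf x x0))).
Qed.

(** Reconciles [gform], which ignores lists of other lengths, with [form_cone], whose members vanish
    there. *)
Definition ftrunc (n : nat) (H : Y) : Y := fun l => if size l == n then H l else 0.

Lemma gform_cone n H : gform jE jG n H -> form_cone n (ftrunc n H).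
Proof.
elim: n H => [|n IH] H [hm hl hp] /=.
  exists (H [::]); last by apply/funext => -[|z l].
  by split=> [|g g0]; [exact: hl|exact: hp].
exists (fun x => ftrunc n (fun l => H (x :: l))); last first.
  by apply/funext => -[|z l].
split=> [a u v|x x0].
  apply/funext => l; rewrite /ftrunc -[RHS]/(a *: (if _ then _ else _) + (if _ then _ else _)).
  case: eqP => [nE|_]; last by rewrite scaler0 addr0.
  exact: (@mlin_head _ _ _ _ _ _ hm nE).
apply: IH; split; first exact: mlin_cons.
  by move=> l nE; apply: hl; rewrite /= nE.
by move=> l g nE pl g0; apply: hp => //=; rewrite nE.
Qed.

(** The supremum of [U] and [- U] exists since [S = H1 + H2] bounds both: [S - U] and [S + U] are
    [2 H2] and [2 H1]. Then [M <= S] and [M - U, M + U <= 2 S] keep all three in the cone. Leastness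
    is against all positive forms, as the modulus is taken among all regular polynomials. *)
Lemma pof_modulus n H1 H2 : pof jE jG n H1 -> pof jE jG n H2 ->
  exists M, [/\ pof jE jG n M,
    pof jE jG n (fun l g => M l g - (H1 l g - H2 l g)),
    pof jE jG n (fun l g => M l g + (H1 l g - H2 l g)) &
    forall B, gform jE jG n (fun l g => B l g - (H1 l g - H2 l g)) ->
      gform jE jG n (fun l g => B l g + (H1 l g - H2 l g)) ->
      gform jE jG n (fun l g => B l g - M l g)].
Proof.
move=> h1 h2; pose U : Y := fun l g => H1 l g - H2 l g.
have trunc_sub (P Q : Y) : ftrunc n P - ftrunc n Q = ftrunc n (P - Q).
  apply/funext => l; rewrite /ftrunc -[LHS]/((if _ then _ else _) - (if _ then _ else _)).
  by case: ifP => // _; rewrite subr0.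
have trunc_opp (P : Y) : - ftrunc n P = ftrunc n (- P).
  apply/funext => l; rewrite /ftrunc -[LHS]/(- (if _ then _ else _)).
  by case: ifP => // _; rewrite oppr0.
have back (P : Y) : gform jE jG n (ftrunc n P) -> gform jE jG n P.
  by apply: gform_ext => l nE; rewrite /ftrunc nE eqxx.
have f2 (P Q : Y) : gform jE jG n (fun l g => P l g - Q l g) ->
    form_cone n (ftrunc n P - ftrunc n Q).
  by rewrite trunc_sub => h; exact: gform_cone.
pose S : Y := fun l g => H1 l g + H2 l g.
pose A := [set a | a = ftrunc n U \/ a = - ftrunc n U].
have hS : pof jE jG n S by exact: pof_add.
have [||M [uM lM]] := @form_cone_complete n A.
- by exists (ftrunc n U); left.
- exists (ftrunc n S) => _ [->|->].
    apply: f2; have [h _] := pof_add h2 h2.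
    by apply: gform_ext h => l _; apply/funext => g; rewrite /S /U; ring.
  rewrite trunc_opp; apply: f2; have [h _] := pof_add h1 h1.
  apply: gform_ext h => l _; apply/funext => g.
  by rewrite -[RHS]/(S l g - - U l g) /S /U; ring.
have m1 : form_cone n (M - ftrunc n U) by apply: uM; left.
have m2 : form_cone n (M + ftrunc n U).
  by rewrite -[ftrunc n U]opprK; apply: uM; right.
(* Positivity of [M] comes from [2 M = (M - U) + (M + U)]. *)
have mM : form_cone n M.
  have := pconeD (form_cone_pointed n) m1 m2; rewrite addrACA addNr addr0.
  have i0 : (0 : R) <= 2^-1 by rewrite invr_ge0.
  move=> /(pconeZ (form_cone_pointed n) i0).
  have -> : M + M = 2 *: M by rewrite scaler_nat mulr2n.
  by rewrite scalerA mulVf ?pnatr_eq0// scale1r.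
have least (B : Y) : gform jE jG n (fun l g => B l g - U l g) ->
    gform jE jG n (fun l g => B l g + U l g) ->
    gform jE jG n (fun l g => B l g - M l g).
  move=> b1 b2.
  have : form_cone n (ftrunc n B - M).
    apply: lM => _ [->|->]; first exact: f2.
    rewrite trunc_opp; apply: f2; apply: gform_ext b2 => l _; apply/funext => g.
    by rewrite -[RHS]/(B l g - - U l g) opprK.
  move=> /form_cone_gform; apply: gform_ext => l nE; apply/funext => g.
  by rewrite -[LHS]/(ftrunc n B l g - M l g) /ftrunc nE eqxx.
have gM1 : gform jE jG n (fun l g => M l g - U l g).
  move: m1 => /form_cone_gform; apply: gform_ext => l nE; apply/funext => g.
  by rewrite -[LHS]/(M l g - ftrunc n U l g) /ftrunc nE eqxx.
have gM2 : gform jE jG n (fun l g => M l g + U l g).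
  move: m2 => /form_cone_gform; apply: gform_ext => l nE; apply/funext => g.
  by rewrite -[LHS]/(M l g + ftrunc n U l g) /ftrunc nE eqxx.
have MS l g : size l = n -> allpos jE l -> bl_le jG 0 g -> M l g <= S l g.
  move=> nE pl g0; have := @least S _ _; case.
  - have [h _] := pof_add h2 h2; apply: gform_ext h => k _.
    by apply/funext => z; rewrite /S /U; ring.
  - have [h _] := pof_add h1 h1; apply: gform_ext h => k _.
    by apply/funext => z; rewrite /S /U; ring.
  by move=> _ _ /(_ l g nE pl g0); rewrite subr_ge0.
have hM : pof jE jG n M by apply: pof_dominated hS MS => //; exact: form_cone_gform.
have hSS := pof_add hS hS.
have UP l g : size l = n -> allpos jE l -> bl_le jG 0 g -> 0 <= H1 l g /\ 0 <= H2 l g.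
  by move=> nE pl g0; split; [apply: (gf_ge0 (proj1 h1))|apply: (gf_ge0 (proj1 h2))].
exists M; split=> //.
- apply: (pof_dominated hG gM1 hSS) => l g nE pl g0.
  have [p1 p2] := UP _ _ nE pl g0; have := MS _ _ nE pl g0.
  by rewrite /U /S; lra.
- apply: (pof_dominated hG gM2 hSS) => l g nE pl g0.
  have [p1 p2] := UP _ _ nE pl g0; have := MS _ _ nE pl g0.
  by rewrite /U /S; lra.
Qed.

End Modulus.

(** * The spaces of orthogonally additive polynomials *)

Section ProCharacterization.
Variables (R : realType) (E G : completeNormedModType R).
Variables (jE : E -> E -> E) (jG : G -> G -> G).
Hypotheses (hE : banach_lattice_axioms jE) (hG : banach_lattice_axioms jG).
Variable n : nat.
Local Notation gform := (gform jE jG n).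
Local Notation pof := (pof jE jG n).
Local Notation opoly := (opoly jE jG n).

Definition gdiff (H1 H2 : seq E -> G -> R) : E -> G -> R :=
  fun x g => H1 (nseq n x) g - H2 (nseq n x) g.

Definition pro_rep (P : E -> G -> R) (H1 H2 : seq E -> G -> R) : Prop :=
  [/\ pof H1, pof H2 & P = gdiff H1 H2].

Lemma gdiff0 (H : seq E -> G -> R) : gdiff H (fun _ _ => 0) = fun x => H (nseq n x).
Proof. by apply/funext => x; apply/funext => g; rewrite /gdiff subr0. Qed.

(** Sums across the two representations keep both sides in the cone, where diagonal values determine
    the form. *)
Lemma pro_rep_inj H1 H2 H1' H2' : pof H1 -> pof H2 -> pof H1' -> pof H2' ->
  gdiff H1 H2 = gdiff H1' H2' ->
  forall l g, size l = n -> H1 l g + H2' l g = H1' l g + H2 l g.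
Proof.
move=> h1 h2 h1' h2' e l g nE.
have a1 := pof_add h1 h2'; have a2 := pof_add h1' h2.
have := @form_diag_inj _ _ _ n (fun l g => H1 l g + H2' l g)
  (fun l g => H1' l g + H2 l g) (gf_mlin (proj1 a1)) (gf_mlin (proj1 a2))
  (pof_adjsym hE hG a1) (pof_adjsym hE hG a2).
move=> /(_ _ l nE) /(congr1 (fun f => f g)); apply => x; apply/funext => z.
have : gdiff H1 H2 x z = gdiff H1' H2' x z by rewrite e.
by rewrite /gdiff => /eqP; rewrite subr_eq addrAC eq_sym subr_eq => /eqP ->.
Qed.

(** With [Q] the modulus, [Q - P] and [Q + P] are positive with orthogonally additive sum [2 Q], so
    domination puts both in the cone; [P] is half their difference. *)
Lemma Pro_rep P : Pro n jE jG P -> exists H1 H2, pro_rep P H1 H2.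
Proof.
move=> [_ [Q [[_ PQ NPQ _] oQ]]].
have [H1 [g1 a1 e1]] := pos_poly_form PQ.
have [H2 [g2 a2 e2]] := pos_poly_form NPQ.
have gK := gform_comb ler01 g1 g2.
have hK : pof (fun l g => 1 * H1 l g + H2 l g).
  apply: orth_pof => //.
    by move=> l1 x y l2 nE; apply/funext => g; rewrite a1// a2.
  have e x : (fun g => 1 * H1 (nseq n x) g + H2 (nseq n x) g) = Q x + Q x.
    apply/funext => g; rewrite -e1 -e2 -[RHS]/(Q x g + Q x g).
    by rewrite -[LHS]/(1 * (Q x g - P x g) + (Q x g - - P x g)); ring.
  by move=> x y xy; rewrite !e oQ// addrACA.
have h1 : pof H1.
  apply: (pof_dominated hG g1 hK) => l g nE pl g0; rewrite mul1r lerDl.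
  exact: (gf_ge0 g2).
have h2 : pof H2.
  apply: (pof_dominated hG g2 hK) => l g nE pl g0; rewrite mul1r lerDr.
  exact: (gf_ge0 g1).
have i0 : (0 : R) <= 2^-1 by rewrite invr_ge0.
have z : pof (fun _ _ => 0) by exact: pof0.
exists (fun l g => 2^-1 * H2 l g + 0), (fun l g => 2^-1 * H1 l g + 0).
split; [exact: (pof_comb i0 h2 z)|exact: (pof_comb i0 h1 z)|].
apply/funext => x; apply/funext => g; rewrite /gdiff !addr0 -e1 -e2.
rewrite -[RHS]/(2^-1 * (Q x g - - P x g) - 2^-1 * (Q x g - P x g)).
by field.
Qed.

Lemma pof_opoly H : pof H -> opoly (fun x => H (nseq n x)).
Proof. by exists H. Qed.

Lemma opoly_reg P : opoly P -> reg_poly n jE jG P.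
Proof.
move=> hP; exists P, (fun _ _ => 0); split.
- exact: opoly_pos.
- by apply: opoly_pos => //; exists (fun _ _ => 0); split=> //; exact: pof0.
- by apply/funext => x; apply/funext => g; rewrite -[RHS]/(P x g - 0) subr0.
Qed.

Lemma rep_Pro P H1 H2 : (0 < n)%N -> pro_rep P H1 H2 -> Pro n jE jG P.
Proof.
move=> n0 [h1 h2 ->]; have [M [hM hM1 hM2 least]] := pof_modulus hE hG h1 h2.
split.
  exists (fun x => H1 (nseq n x)), (fun x => H2 (nseq n x)).
  by split=> //; apply: opoly_pos => //; exact: pof_opoly.
exists (fun x => M (nseq n x)); split; last first.
  exact: (opoly_orth hE hG n0 (pof_opoly hM)).
split.
- exact: opoly_reg (pof_opoly hM).
- exact: opoly_pos (pof_opoly hM1).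
- have e : (fun x => M (nseq n x) - - gdiff H1 H2 x) =
      fun x => (fun l g => M l g + (H1 l g - H2 l g)) (nseq n x).
    by apply/funext => x; rewrite opprK.
  by rewrite /poly_le e; exact: opoly_pos (pof_opoly hM2).
- move=> S _ le1 le2.
  have [A1 [g1 a1 e1]] := pos_poly_form le1.
  have [A2 [g2 a2 e2]] := pos_poly_form le2.
  have aH1 := pof_adjsym hE hG h1; have aH2 := pof_adjsym hE hG h2.
  (* On the diagonal both sides are [S + H1 + H2]; hence [B], the form of [S], satisfies
     [B - U = A1] and [B + U = A2]. *)
  have e l : size l = n -> (fun g => A1 l g + (H1 l g + H1 l g)) =
      (fun g => A2 l g + (H2 l g + H2 l g)).
    apply: (form_diag_inj (H := fun l g => A1 l g + (H1 l g + H1 l g))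
      (H' := fun l g => A2 l g + (H2 l g + H2 l g))).
    + have := gf_mlin (gform_comb ler01 g1 (proj1 (pof_add h1 h1))).
      suff -> : (fun l g => 1 * A1 l g + (H1 l g + H1 l g)) =
        (fun l g => A1 l g + (H1 l g + H1 l g)) by [].
      by apply/funext => k; apply/funext => g; rewrite mul1r.
    + have := gf_mlin (gform_comb ler01 g2 (proj1 (pof_add h2 h2))).
      suff -> : (fun l g => 1 * A2 l g + (H2 l g + H2 l g)) =
        (fun l g => A2 l g + (H2 l g + H2 l g)) by [].
      by apply/funext => k; apply/funext => g; rewrite mul1r.
    + by move=> l1 x y l2 nE; rewrite a1// aH1.
    + by move=> l1 x y l2 nE; rewrite a2// aH2.
    + move=> x; apply/funext => g; rewrite -e1 -e2.
      rewrite -[LHS]/(S x g - (H1 (nseq n x) g - H2 (nseq n x) g) + _).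
      by rewrite -[RHS]/(S x g - - (H1 (nseq n x) g - H2 (nseq n x) g) + _); ring.
  pose B l g := A1 l g + (H1 l g - H2 l g).
  have gB : gform (fun l g => B l g - M l g).
    apply: least.
      by apply: gform_ext g1 => l nE; apply/funext => g; rewrite /B addrK.
    apply: gform_ext g2 => l nE; apply/funext => g; have := congr1 (fun f => f g) (e l nE).
    rewrite /B => h; apply: (addIr (H2 l g + H2 l g)); rewrite -h; ring.
  have aM := pof_adjsym hE hG hM.
  rewrite /poly_le; have -> : (fun x => S x - M (nseq n x)) = fun x => (fun l g => B l g - M l g) (nseq n x).
    apply/funext => x; apply/funext => g; rewrite /B -e1.
    rewrite -[LHS]/(S x g - M (nseq n x) g).
    by rewrite -[RHS]/(S x g - (H1 (nseq n x) g - H2 (nseq n x) g) +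
      (H1 (nseq n x) g - H2 (nseq n x) g) - M (nseq n x) g); ring.
  apply: (form_pos_poly hE hG gB) => l1 x y l2 nE; apply/funext => g.
  by rewrite /B a1// aH1// aH2// aM.
Qed.

(** The form of a positive [Q - P] is dominated by [L1 + K2], so the order of the space is the one
    given by the transported cone. *)
Lemma poly_le_Pro P Q : Pro n jE jG P -> Pro n jE jG Q ->
  (poly_le n jE jG P Q <-> opoly (fun x => Q x - P x)).
Proof.
move=> /Pro_rep[K1 [K2 [k1 k2 ->]]] /Pro_rep[L1 [L2 [l1 l2 ->]]].
split; last exact: opoly_pos.
move=> /pos_poly_form[H [hH aH e]]; exists H; split=> //.
have hS := pof_add l1 k2; have hT := pof_add k1 l2.
apply: (pof_dominated hG hH hS) => l g nE pl g0.
have eq l' : size l' = n -> (fun g => 1 * H l' g + (K1 l' g + L2 l' g)) =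
    (fun g => L1 l' g + K2 l' g).
  apply: (form_diag_inj (H := fun l g => 1 * H l g + (K1 l g + L2 l g))
    (H' := fun l g => L1 l g + K2 l g)).
  - exact: (gf_mlin (gform_comb ler01 hH (proj1 hT))).
  - exact: (gf_mlin (proj1 hS)).
  - have aT := pof_adjsym hE hG hT.
    move=> m1 x y m2 mE; rewrite aH//.
    apply/funext => z; congr (_ + _).
    exact: (congr1 (fun f => f z) (aT m1 x y m2 mE)).
  - exact: (pof_adjsym hE hG hS).
  - move=> x; apply/funext => z; rewrite -e.
    rewrite -[LHS]/(1 * ((L1 (nseq n x) z - L2 (nseq n x) z) -
      (K1 (nseq n x) z - K2 (nseq n x) z)) + (K1 (nseq n x) z + L2 (nseq n x) z)).
    by ring.
have <- : 1 * H l g + (K1 l g + L2 l g) = L1 l g + K2 l g.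
  exact: (congr1 (fun f => f g) (eq l nE)).
rewrite mul1r lerDl addr_ge0//; first exact: (gf_ge0 (proj1 k1)).
exact: (gf_ge0 (proj1 l2)).
Qed.

End ProCharacterization.

(** * The induced map between the spaces of polynomials *)

Section Transport.
Variables (R : realType) (E F G : completeNormedModType R).
Variables (jE : E -> E -> E) (jF : F -> F -> F) (jG : G -> G -> G).
Hypotheses (hE : banach_lattice_axioms jE) (hF : banach_lattice_axioms jF).
Hypothesis hG : banach_lattice_axioms jG.
Variables (s : (E -> R) -> F -> R) (t : (F -> R) -> E -> R).
Hypothesis hst : dual_iso jE jF s t.
Hypothesis hoc : oc_dual_norm jE \/ oc_dual_norm jF.
Variable n : nat.

Definition gext (H : seq E -> G -> R) : seq F -> G -> R :=
  fun ys g => dext s (H^~ g) ys.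

Lemma pof_rform H g : pof jE jG n H -> rform jE n (H^~ g).
Proof.
move=> [[_ hl _] ho].
exists (H^~ (vpos jG g)), (H^~ (vpos jG (- g))); split.
- by have [] := ho _ (vpos_ge0 hG g).
- by have [] := ho _ (vpos_ge0 hG (- g)).
- by move=> l nE; rewrite {1}(vpos_decomp hG g) (lin1B (hl l nE)).
Qed.

Lemma gext_comb (a : R) H H' ys g : pof jE jG n H -> pof jE jG n H' ->
  size ys = n -> gext (fun l g => a * H l g + H' l g) ys g =
  a * gext H ys g + gext H' ys g.
Proof.
move=> h h' nE.
exact: (dext_comb hE hF (di_map hst) a (pof_rform g h) (pof_rform g h') nE).
Qed.

Lemma gext_pof H : pof jE jG n H -> pof jF jG n (gext H).
Proof.
move=> hH; apply: (pof_intro hG) => [g g0|ys nE a u v].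
  exact: dext_oform hst hoc _ _ (proj2 hH g g0).
rewrite -[RHS]/(a * dext s (H^~ u) ys + dext s (H^~ v) ys).
rewrite -(dext_comb hE hF (di_map hst) a (pof_rform u hH) (pof_rform v hH) nE).
apply: dext_eq => l lE; rewrite nE in lE.
exact: (gf_lin (proj1 hH) lE).
Qed.

Lemma gext_eq H H' ys g : (forall l g, size l = n -> H l g = H' l g) ->
  size ys = n -> gext H ys g = gext H' ys g.
Proof. by move=> e nE; apply: dext_eq => l lE; rewrite e// lE. Qed.

Lemma gext0 ys g : gext (fun _ _ => 0) ys g = 0.
Proof. exact: dext0 (di_map hst) ys. Qed.

Lemma gext_wd H1 H2 H1' H2' : pof jE jG n H1 -> pof jE jG n H2 ->
  pof jE jG n H1' -> pof jE jG n H2' -> gdiff n H1 H2 = gdiff n H1' H2' ->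
  gdiff n (gext H1) (gext H2) = gdiff n (gext H1') (gext H2').
Proof.
move=> h1 h2 h1' h2' e; apply/funext => y; apply/funext => g; rewrite /gdiff.
set ys := nseq n y; have nE : size ys = n by rewrite size_nseq.
have : gext (fun l g => 1 * H1 l g + H2' l g) ys g =
    gext (fun l g => 1 * H1' l g + H2 l g) ys g.
  apply: gext_eq => // l z lE; rewrite !mul1r.
  exact: (pro_rep_inj hE hG h1 h2 h1' h2' e).
by rewrite !gext_comb// !mul1r => h; apply/eqP; rewrite subr_eq addrAC eq_sym
  subr_eq h.
Qed.

(** One value must serve all representations of [P]; [gext_wd] makes this consistent, and choice
    produces such a map. *)
Definition transports (Th : (E -> G -> R) -> F -> G -> R) : Prop :=
  forall P H1 H2, pro_rep jE jG n P H1 H2 ->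
    Th P = gdiff n (gext H1) (gext H2).

Lemma transports_ex : exists Th, transports Th.
Proof.
have ex (P : E -> G -> R) : exists U : F -> G -> R, forall H1 H2,
    pro_rep jE jG n P H1 H2 -> U = gdiff n (gext H1) (gext H2).
  have [[H1 [H2 [h1 h2 e]]]|no] := pselect (exists H1 H2, pro_rep jE jG n P H1 H2).
    exists (gdiff n (gext H1) (gext H2)) => K1 K2 [k1 k2 e'].
    by apply: gext_wd => //; rewrite -e.
  by exists (fun _ _ => 0) => H1 H2 h; exfalso; apply: no; exists H1, H2.
by have [Th h] := choice ex; exists Th.
Qed.

Variable Th : (E -> G -> R) -> F -> G -> R.
Hypothesis hTh : transports Th.

Lemma transports_rep P H1 H2 : pro_rep jE jG n P H1 H2 ->
  pro_rep jF jG n (Th P) (gext H1) (gext H2).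
Proof.
move=> h; have [h1 h2 _] := h; split; [exact: gext_pof|exact: gext_pof|].
exact: hTh.
Qed.

Lemma transports_lin (a : R) P Q : Pro n jE jG P -> Pro n jE jG Q ->
  Th (a *: (P : E -> G -> R^o) + Q) = a *: (Th P : F -> G -> R^o) + Th Q.
Proof.
move=> /(Pro_rep hE hG)[H1 [H2 hP]] /(Pro_rep hE hG)[K1 [K2 hQ]].
rewrite (hTh hP) (hTh hQ).
have [h1 h2 eP] := hP; have [k1 k2 eQ] := hQ.
have sz (y : F) : size (nseq n y) = n by rewrite size_nseq.
have [a0|/ltW a0] := leP 0 a.
  rewrite (@hTh _ (fun l g => a * H1 l g + K1 l g) (fun l g => a * H2 l g + K2 l g)).
    apply/funext => y; apply/funext => g.
    rewrite /gdiff !gext_comb//.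
    rewrite -[RHS]/(a * (gext H1 (nseq n y) g - gext H2 (nseq n y) g) +
      (gext K1 (nseq n y) g - gext K2 (nseq n y) g)); ring.
  split; [exact: pof_comb|exact: pof_comb|].
  rewrite eP eQ; apply/funext => x; apply/funext => g.
  rewrite /gdiff -[LHS]/(a * (H1 (nseq n x) g - H2 (nseq n x) g) +
    (K1 (nseq n x) g - K2 (nseq n x) g)); ring.
(* For negative [a] the two cone elements of [P] exchange roles, which keeps all coefficients
   nonnegative. *)
rewrite -oppr_ge0 in a0.
rewrite (@hTh _ (fun l g => - a * H2 l g + K1 l g) (fun l g => - a * H1 l g + K2 l g)).
  apply/funext => y; apply/funext => g.
  rewrite /gdiff !gext_comb//.
  rewrite -[RHS]/(a * (gext H1 (nseq n y) g - gext H2 (nseq n y) g) +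
    (gext K1 (nseq n y) g - gext K2 (nseq n y) g)); ring.
split; [exact: pof_comb|exact: pof_comb|].
rewrite eP eQ; apply/funext => x; apply/funext => g.
rewrite /gdiff -[LHS]/(a * (H1 (nseq n x) g - H2 (nseq n x) g) +
  (K1 (nseq n x) g - K2 (nseq n x) g)); ring.
Qed.

Lemma transports_opoly P : opoly jE jG n P -> opoly jF jG n (Th P).
Proof.
move=> [H [hH e]]; have hr : pro_rep jE jG n P H (fun _ _ => 0).
  by split=> //; [exact: pof0|rewrite gdiff0; apply/funext].
exists (gext H); split; first exact: gext_pof.
move=> y; rewrite (hTh hr); apply/funext => g.
by rewrite /gdiff gext0 subr0.
Qed.

End Transport.

Lemma gextK (R : realType) (E F G : completeNormedModType R)
  (jE : E -> E -> E) (jF : F -> F -> F) (jG : G -> G -> G)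
  (s : (E -> R) -> F -> R) (t : (F -> R) -> E -> R) n H xs g :
  banach_lattice_axioms jE -> banach_lattice_axioms jF ->
  banach_lattice_axioms jG -> dual_iso jE jF s t ->
  oc_dual_norm jE \/ oc_dual_norm jF -> pof jE jG n H -> size xs = n ->
  gext t (gext s H) xs g = H xs g.
Proof.
move=> hE hF hG hst hoc hH nE.
have hoc' : oc_dual_norm jF \/ oc_dual_norm jE by tauto.
have hK := gext_pof hE hF hG hst hoc hH.
have hL := gext_pof hF hE hG (dual_iso_sym hst) hoc' hK.
have pos z : bl_le jG 0 z -> gext t (gext s H) xs z = H xs z.
  by move=> z0; exact: dextK hE hF hst hoc (proj2 hH z z0) nE.
rewrite (vpos_decomp hG g) (lin1B (gf_lin (proj1 hL) nE)).
by rewrite (lin1B (gf_lin (proj1 hH) nE)) !pos//; exact: vpos_ge0.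
Qed.

Lemma transportsK (R : realType) (E F G : completeNormedModType R)
  (jE : E -> E -> E) (jF : F -> F -> F) (jG : G -> G -> G)
  (s : (E -> R) -> F -> R) (t : (F -> R) -> E -> R) n Th Th' P :
  banach_lattice_axioms jE -> banach_lattice_axioms jF ->
  banach_lattice_axioms jG -> dual_iso jE jF s t ->
  oc_dual_norm jE \/ oc_dual_norm jF ->
  transports jE jG s n Th -> transports jF jG t n Th' ->
  Pro n jE jG P -> Th' (Th P) = P.
Proof.
move=> hE hF hG hst hoc hT hT' /(Pro_rep hE hG)[H1 [H2 hP]].
have [h1 h2 e] := hP.
rewrite (hT' _ _ _ (transports_rep hE hF hG hst hoc hT hP)) e.
apply/funext => x; apply/funext => g; rewrite /gdiff.
have sz : size (nseq n x) = n by rewrite size_nseq.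
by rewrite (gextK g hE hF hG hst hoc h1 sz) (gextK g hE hF hG hst hoc h2 sz).
Qed.

Theorem theorem2p10 (R : realType) (E F : completeNormedModType R)
  (joinE : E -> E -> E) (joinF : F -> F -> F)
  (hE : banach_lattice_axioms joinE) (hF : banach_lattice_axioms joinF)
  (hdual : lattice_iso (@dual_space R E) (dual_le joinE)
                       (@dual_space R F) (dual_le joinF))
  (hoc : oc_dual_norm joinE \/ oc_dual_norm joinF) :
  forall (n : nat), (0 < n)%N ->
  forall (G : completeNormedModType R) (joinG : G -> G -> G),
    banach_lattice_axioms joinG ->
    lattice_iso (Pro n joinE joinG) (poly_le n joinE joinG)
                (Pro n joinF joinG) (poly_le n joinF joinG).
Proof.
move=> n n0 G jG hG.
have [s [t hst]] := lattice_iso_dual hE hF hdual.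
have hts := dual_iso_sym hst.
have hoc' : oc_dual_norm joinF \/ oc_dual_norm joinE by tauto.
have [Th hTh] := transports_ex hE hF hG hst n.
have [Th' hTh'] := transports_ex hF hE hG hts n.
have stable P : Pro n joinE jG P -> Pro n joinF jG (Th P).
  move=> /(Pro_rep hE hG)[H1 [H2 /(transports_rep hE hF hG hst hoc hTh) h]].
  exact: (rep_Pro hF hG n0 h).
have stable' P : Pro n joinF jG P -> Pro n joinE jG (Th' P).
  move=> /(Pro_rep hF hG)[H1 [H2 /(transports_rep hF hE hG hts hoc' hTh') h]].
  exact: (rep_Pro hE hG n0 h).
have ThD P Q : Pro n joinE jG P -> Pro n joinE jG Q -> Th (P + Q) = Th P + Th Q.
  move=> hP hQ; have := transports_lin hE hF hG hst hTh 1 hP hQ.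
  by rewrite !scale1r.
have P0 : Pro n joinE jG 0.
  apply: (rep_Pro hE hG n0 (H1 := fun _ _ => 0) (H2 := fun _ _ => 0)).
  split; [exact: pof0|exact: pof0|].
  by apply/funext => x; apply/funext => g; rewrite /gdiff subr0.
have Th0 : Th 0 = 0.
  by have := ThD _ _ P0 P0; rewrite addr0 => /eqP; rewrite -subr_eq0 opprD
    addNKr oppr_eq0 => /eqP.
exists Th; split => //.
- move=> a P hP; have := transports_lin hE hF hG hst hTh a hP P0.
  by rewrite Th0 !addr0.
- move=> U hU; exists (Th' U); first exact: stable'.
  exact: (transportsK hF hE hG hts hoc' hTh' hTh hU).
(* Stated for arbitrary spaces, so that it serves [Th] and its inverse [Th'], one for each direction
   of the equivalence. *)
- have le_sub (E1 F1 : completeNormedModType R) (j1 : E1 -> E1 -> E1)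
      (j2 : F1 -> F1 -> F1) s1 t1 Th1 P Q :
      banach_lattice_axioms j1 -> banach_lattice_axioms j2 ->
      dual_iso j1 j2 s1 t1 -> oc_dual_norm j1 \/ oc_dual_norm j2 ->
      transports j1 jG s1 n Th1 -> Pro n j1 jG P -> Pro n j1 jG Q ->
      Pro n j2 jG (Th1 P) -> Pro n j2 jG (Th1 Q) ->
      poly_le n j1 jG P Q -> poly_le n j2 jG (Th1 P) (Th1 Q).
    move=> h1 h2 hst1 hoc1 hTh1 hP hQ hP' hQ'.
    move=> /(poly_le_Pro h1 hG hP hQ) /(transports_opoly h1 h2 hG hst1 hoc1 hTh1) h.
    apply/(poly_le_Pro h2 hG hP' hQ'); move: h.
    suff -> : Th1 (fun x => Q x - P x) = (fun x => Th1 Q x - Th1 P x) by [].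
    have := transports_lin h1 h2 hG hst1 hTh1 (-1) hP hQ.
    by rewrite !scaleN1r addrC => ->; rewrite addrC.
  move=> P Q hP hQ; split.
    exact: (le_sub _ _ _ _ _ _ _ _ _ hE hF hst hoc hTh hP hQ (stable _ hP) (stable _ hQ)).
  move=> /(le_sub _ _ _ _ _ _ _ _ _ hF hE hts hoc' hTh' (stable _ hP) (stable _ hQ)).
  have eP := transportsK hE hF hG hst hoc hTh hTh' hP.
  have eQ := transportsK hE hF hG hst hoc hTh hTh' hQ.
  by rewrite eP eQ; apply.
Qed.
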